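(* Let $d\ge 1$, $1\le p\le\infty$, $\alpha>d-d/p$, and let $\mathcal{A}$ be either the Gr\''ochenig-Schur algebra $\mathcal{A}_{p,\alpha}$, or the Baskakov-Gohberg-Sj\''ostrand algebra $\mathcal{C}_{p,\alpha}$, or the Beurling algebra $\mathcal{B}_{p,\alpha}$ of infinite matrices. If $A,B\in\mathcal{A}$ have their spectra $\sigma_{\mathcal{B}(\ell^2)}(A)$ and $\sigma_{\mathcal{B}(\ell^2)}(B)$ in $\mathcal{B}(\ell^2)$ being disjoint, then for every $Q\in\mathcal{A}$, the operator Sylvester equation $BX-XA=Q$ has a unique solution in $\mathcal{A}$. Furthermore, if $A,B$ are normal in $\mathcal{B}(\ell^2)$, then there is a bivariate function $g$ on $\mathbb{R}_+\times\mathbb{R}_+$ such that $$\|X\|_{\mathcal{A}}\le g\big((d(A,B))^{-1},\ \|A\|_{\mathcal{A}}+\|B\|_{\mathcal{A}}\big)$$ holds for the unique solution $X$ of the operator Sylvester equation $BX-XA=Q$, where $d(A,B)$ is the distance of the spectra of $A$ and $B$ in $\mathcal{B}(\ell^2)$.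
   Context: $\mathbb{R}_+$ is the set of all nonnegative real numbers. $\ell^p=\ell^p(\mathbb{Z}^d)$, $1\le p\le\infty$, is the Banach space of all $p$-summable sequences on $\mathbb{Z}^d$ (bounded sequences if $p=\infty$) with norm $\|\cdot\|_p$, and $\mathcal{B}(\ell^2)$ is the algebra of all bounded linear operators on $\ell^2$. For $\alpha\ge0$ let $u_\alpha(i,j)=(1+|i-j|)^\alpha$, $i,j\in\mathbb{Z}^d$, be the polynomial weights. For an infinite matrix $A=(a(i,j))_{i,j\in\mathbb{Z}^d}$ define $$\|A\|_{\mathcal{A}_{p,\alpha}}=\max\Big\{\sup_{i\in\mathbb{Z}^d}\big\|(a(i,j)u_\alpha(i,j))_{j\in\mathbb{Z}^d}\big\|_p,\ \sup_{j\in\mathbb{Z}^d}\big\|(a(i,j)u_\alpha(i,j))_{i\in\mathbb{Z}^d}\big\|_p\Big\},$$ $$\|A\|_{\mathcal{C}_{p,\alpha}}=\Big\|\Big(\sup_{i-j=k}|a(i,j)|u_\alpha(i,j)\Big)_{k\in\mathbb{Z}^d}\Big\|_p,$$ $$\|A\|_{\mathcal{B}_{p,\alpha}}=\Big\|\Big(\sup_{|i-j|\ge|k|}|a(i,j)|u_\alpha(i,j)\Big)_{k\in\mathbb{Z}^d}\Big\|_p.$$ The algebras $\mathcal{A}_{p,\alpha}$, $\mathcal{C}_{p,\alpha}$, $\mathcal{B}_{p,\alpha}$ consist of all infinite matrices $A$ for which $\|A\|_{\mathcal{A}_{p,\alpha}}<\infty$, $\|A\|_{\mathcal{C}_{p,\alpha}}<\infty$,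 $\|A\|_{\mathcal{B}_{p,\alpha}}<\infty$, respectively; for $\alpha>d-d/p$ they are subalgebras of $\mathcal{B}(\ell^2)$. An operator $A$ is normal in $\mathcal{B}(\ell^2)$ if $A^\star A=AA^\star$. The distance of the spectra is $d(A,B)=\inf\{|z-w|:\ z\in\sigma_{\mathcal{B}(\ell^2)}(A),\ w\in\sigma_{\mathcal{B}(\ell^2)}(B)\}$.
   Formalization: The norm estimate is stated with the factor ‖Q‖ on the right, with g chosen independently of A, B and Q; without it the bound fails, since for A = 0 and B = I the solution is X = Q, of arbitrarily large norm. *)

(* Defs.v *)
From HB Require Import structures.
From mathcomp Require Import all_boot all_order all_algebra.
From mathcomp Require Import all_classical all_reals all_analysis.
From mathcomp Require Import complex.

Set Implicit Arguments.
Unset Strict Implicit.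
Unset Printing Implicit Defensive.
Import Order.TTheory GRing.Theory Num.Theory.

Local Open Scope classical_set_scope.
Local Open Scope ring_scope.

(* Z^d with the discrete sigma-algebra: for the counting measure, every function
   is measurable, Lnorm is the l^p-norm and the integral is the sum.  The alias
   keeps these instances off 'rV[int]_d itself. *)
Definition lattice (d : nat) := 'rV[int]_d.
HB.instance Definition _ d := GRing.Zmodule.copy (lattice d) 'rV[int]_d.
HB.instance Definition _ d := Countable.copy (lattice d) 'rV[int]_d.
HB.instance Definition _ d := isPointed.Build (lattice d) 0.
HB.instance Definition _ d := @isMeasurable.Build default_measure_display
  (lattice d) (@discrete_measurable (lattice d))
  (@discrete_measurable0 _) (@discrete_measurableC _) (@discrete_measurableU _).

(* The Euclidean norm |k|. *)
Definition enorm (R : realType) d (k : lattice d) : R :=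
  Num.sqrt (\sum_(l < d) ((k : 'rV[int]_d) 0 l)%:~R ^+ 2).

(* Modulus as a real number; `|z| is an element of R[i]. *)
Definition cabs (R : realType) (z : R[i]) : R := ComplexField.Normc.normc z.

Section Sequences.
Context (R : realType) (d : nat).
Implicit Types (x y : lattice d -> R[i]).

Definition lnorm (p : \bar R) (f : lattice d -> \bar R) : \bar R :=
  ('N[@counting (lattice d) R]_p[f])%E.

(* The sum over Z^d of an absolutely summable complex family. *)
Definition csum (f : lattice d -> R[i]) : R[i] :=
  ((\int[@counting (lattice d) R]_k complex.Re (f k)) +i*
   (\int[@counting (lattice d) R]_k complex.Im (f k)))%C.

Definition norm2 x : \bar R := lnorm 2%:E (fun k => (cabs (x k))%:E).
Definition l2 x : Prop := (norm2 x < +oo)%E.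
Definition dot2 x y : R[i] := csum (fun k => x k * conjc (y k)).

(* Membership in B(l^2).  Operators are functions on all sequences, of which
   only the restriction to l^2 matters. *)
Record bounded_op (T : (lattice d -> R[i]) -> (lattice d -> R[i])) : Prop :=
  BoundedOp {
    bounded_op_l2 : forall x, l2 x -> l2 (T x);
    bounded_op_linear : forall (c : R[i]) x y, l2 x -> l2 y ->
      T (fun k => c * x k + y k) = (fun k => c * T x k + T y k);
    bounded_op_bound : exists M : R, forall x, l2 x ->
      (norm2 (T x) <= M%:E * norm2 x)%E }.

Definition invertible_op (T : (lattice d -> R[i]) -> (lattice d -> R[i])) :=
  bounded_op T /\
  exists S, bounded_op S /\ forall x, l2 x -> S (T x) = x /\ T (S x) = x.

Definition spectrum (T : (lattice d -> R[i]) -> (lattice d -> R[i])) :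
    set R[i] :=
  [set z | ~ invertible_op (fun x k => z * x k - T x k)].

Definition adjoint_op (T S : (lattice d -> R[i]) -> (lattice d -> R[i])) :=
  bounded_op S /\
  forall x y, l2 x -> l2 y -> dot2 (T x) y = dot2 x (S y).

Definition normal_op (T : (lattice d -> R[i]) -> (lattice d -> R[i])) :=
  bounded_op T /\
  exists S, adjoint_op T S /\ forall x, l2 x -> S (T x) = T (S x).

End Sequences.

Section InfiniteMatrices.
Context (R : realType) (d : nat).

Definition imatrix := lattice d -> lattice d -> R[i].
Implicit Types (A B X Q : imatrix).

Definition imx_op A (x : lattice d -> R[i]) : lattice d -> R[i] :=
  fun i => csum (fun j => A i j * x j).

Definition imx_mul A B : imatrix :=
  fun i j => csum (fun k => A i k * B k j).

Definition imx_sub A B : imatrix := fun i j => A i j - B i j.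

Definition sigma A : set R[i] := spectrum (imx_op A).

Definition spectra_dist A B : R :=
  inf [set cabs (z - w) | z in sigma A & w in sigma B].

Definition weight (alpha : R) (i j : lattice d) : R :=
  (1 + @enorm R d (i - j)) `^ alpha.

Definition wentry (alpha : R) A (i j : lattice d) : \bar R :=
  (cabs (A i j) * weight alpha i j)%:E.

Definition schur_norm (p : \bar R) (alpha : R) A : \bar R :=
  maxe (ereal_sup [set lnorm p (fun j => wentry alpha A i j) | i in setT])
       (ereal_sup [set lnorm p (fun i => wentry alpha A i j) | j in setT]).

Definition bgs_norm (p : \bar R) (alpha : R) A : \bar R :=
  lnorm p (fun k : lattice d => ereal_sup
    [set wentry alpha A ij.1 ij.2 |
      ij in [set ij : lattice d * lattice d | ij.1 - ij.2 = k]]).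

Definition beurling_norm (p : \bar R) (alpha : R) A : \bar R :=
  lnorm p (fun k : lattice d => ereal_sup
    [set wentry alpha A ij.1 ij.2 |
      ij in
        [set ij : lattice d * lattice d |
          enorm R k <= @enorm R d (ij.1 - ij.2)]]).

Inductive algebra_kind := GrochenigSchur | BaskakovGohbergSjostrand | Beurling.

Definition alg_norm (K : algebra_kind) : \bar R -> R -> imatrix -> \bar R :=
  match K with
  | GrochenigSchur => schur_norm
  | BaskakovGohbergSjostrand => bgs_norm
  | Beurling => beurling_norm
  end.

Definition alg (K : algebra_kind) (p : \bar R) (alpha : R) : set imatrix :=
  [set A | (alg_norm K p alpha A < +oo)%E].

Definition sylvester A B Q X : Prop :=
  imx_sub (imx_mul B X) (imx_mul X A) = Q.

End InfiniteMatrices.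

(* Main.v *)
(* The solution of [b x - x a = q] is a discrete Cauchy integral.  Cut a large square of the plane
   into small ones and colour each of them according to which of [a - l] and [b - l] is invertible
   at its center [l].  Summing [(b - l)^-1 q (a - l)^-1 dl] over the edges that separate the two
   colours inverts [x |-> b x - x a] up to a contraction, with bounds that depend only on the norms
   of [a] and [b] and on a common bound, over the square, for the smaller of the two resolvents.

   The three matrix norms satisfy [N (x x) <= K N x (D^n P x + t^n N x)] for all [n], where
   [P] is the norm of B(l^2) and [t < 1]: cut the rows and columns at distance [2^n] from the
   diagonal.  Hence [N (x^k)] decays geometrically once [P x < 1], and applying this to
   [1 - x^* x / s] shows that the inverse in B(l^2) of a matrix [x] of the algebra lies in the
   algebra, with norm bounded in terms of [N x] and the operator norm of the inverse.  Compactness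
   of the square then gives the first part.  For normal matrices the operator norm of a resolvent
   is the reciprocal of the distance to the spectrum, and no point is closer than half the distance
   of the spectra to both of them. *)

Require Import Defs.
From HB Require Import structures.
From mathcomp Require Import all_boot all_order all_algebra finmap.
From mathcomp Require Import all_classical all_reals all_analysis.
From mathcomp Require Import complex ess_sup_inf ring lra zify.

Set Implicit Arguments.
Unset Strict Implicit.
Unset Printing Implicit Defensive.
Import Order.TTheory GRing.Theory Num.Theory.
Import numFieldNormedType.Exports.

Local Open Scope classical_set_scope.
Local Open Scope ring_scope.

(** * Banach algebras over the complex numbers *)

(** The function [g] sees only two numbers, so every constant has to be fixed before the matrices
    are known. This is why inverses always come with bounds, and why the large square is chosen from
    the norms alone and its mesh from the resolvent bound.

    Let [S q] be the sum over the edges and [alpha], [beta] the same sums of the resolvents of [a]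
    and of [b] alone. Each term loses one resolvent under [x |-> b x - x a], so that
    [b S(q) - S(q) a = q alpha - beta q]. Here [alpha] is a sum of boundary sums of squares on which
    [a - l] is invertible, and is nearly [0] by Cauchy's theorem. And [beta] is the boundary sum of
    the large square minus those of squares on which [b - l] is invertible, so it is nearly the sum
    of [- 1 / l] over the outer boundary, a negative scalar.

    With [m ^ 2] squares and [u = L / m] the errors add up to order [1 / m], whereas the scalar
    grows like [m]. *)

Arguments cabs {R} z : simpl never.

Section ComplexModulus.
Context {R : realType}.
Implicit Types (z w : R[i]) (x : R).

Lemma cabs0 : cabs (0 : R[i]) = 0. Proof. exact: ComplexField.Normc.normc0. Qed.
Lemma cabs1 : cabs (1 : R[i]) = 1. Proof. exact: ComplexField.Normc.normc1. Qed.
Lemma cabsM z w : cabs (z * w) = cabs z * cabs w.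
Proof. exact: ComplexField.Normc.normcM. Qed.
Lemma cabsV z : cabs z^-1 = (cabs z)^-1.
Proof. exact: ComplexField.Normc.normcV. Qed.
Lemma cabsN z : cabs (- z) = cabs z. Proof. exact: normcN. Qed.
Lemma cabsB z w : cabs (z - w) = cabs (w - z). Proof. by rewrite -cabsN opprB. Qed.
Lemma cabs_ge0 z : 0 <= cabs z.
Proof. by case: z => a b; rewrite /cabs/= sqrtr_ge0. Qed.
Lemma cabsD z w : cabs (z + w) <= cabs z + cabs w. Proof. exact: le_normcD. Qed.
Lemma cabs_eq0 z : (cabs z == 0) = (z == 0).
Proof.
by apply/eqP/eqP => [|->]; [exact: ComplexField.Normc.eq0_normc|exact: cabs0].
Qed.
Lemma cabs_gt0 z : (0 < cabs z) = (z != 0).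
Proof. by rewrite lt0r cabs_eq0 cabs_ge0 andbT. Qed.
Lemma cabs_real x : cabs (x%:C)%C = `|x|.
Proof. by rewrite /cabs/= expr0n addr0 sqrtr_sqr. Qed.
Lemma cabsX z n : cabs (z ^+ n) = cabs z ^+ n.
Proof. by elim: n => [|n IH]; rewrite ?expr0 ?cabs1// !exprS cabsM IH. Qed.
Lemma cabs_i : cabs ('i%C : R[i]) = 1.
Proof. by rewrite /cabs/= expr0n expr1n add0r sqrtr1. Qed.
Lemma cabs_sum I (r : seq I) (P : pred I) (F : I -> R[i]) :
  cabs (\sum_(i <- r | P i) F i) <= \sum_(i <- r | P i) cabs (F i).
Proof.
elim/big_ind2 : _ => [|a b c d ab cd|//]; first by rewrite cabs0.
by rewrite (le_trans (cabsD _ _))// lerD.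
Qed.
Lemma cabs_ge_Re z : `|complex.Re z| <= cabs z.
Proof.
case: z => a b; rewrite /cabs/= -[leLHS]sqrtr_sqr ler_wsqrtr// lerDl sqr_ge0//.
Qed.
Lemma cabs_ge_Im z : `|complex.Im z| <= cabs z.
Proof.
case: z => a b; rewrite /cabs/= -[leLHS]sqrtr_sqr ler_wsqrtr// lerDr sqr_ge0//.
Qed.
Lemma cabs_conj z : cabs (conjc z) = cabs z.
Proof. by case: z => a b; rewrite /cabs/= sqrrN. Qed.
Lemma cabs_ReIm z : cabs z <= `|complex.Re z| + `|complex.Im z|.
Proof.
have -> : z = (complex.Re z)%:C%C + 'i%C * (complex.Im z)%:C%C.
  by case: z => a b /=; apply/eqP; rewrite eq_complex/=; apply/andP; split; apply/eqP; ring.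
by rewrite (le_trans (cabsD _ _))// cabsM !cabs_real cabs_i/=; simpl; rewrite !(mulr0,mul0r,mul1r,subr0,addr0,add0r,mulr1).
Qed.

End ComplexModulus.

Section BanachAlgebra.
Context {R : realType} {E : algType R[i]}.
Implicit Types (x y z q : E) (N : E -> R).

(** Completeness is stated for series dominated by a geometric one, with an explicit remainder,
    which is the form of every limit taken in [E]. The norm of [1] is not normalised, hence the
    factors [N 1] in later bounds. *)
Record banach_norm N : Prop := BanachNorm {
  bnD : forall x y, N (x + y) <= N x + N y;
  bnZ : forall c x, N (c *: x) <= cabs c * N x;
  bnM : forall x y, N (x * y) <= N x * N y;
  bn_eq0 : forall x, N x <= 0 -> x = 0;
  bn_complete : forall (u : nat -> E) M, (forall n, N (u n) <= M / 2 ^+ n) ->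
    exists x, forall n, N (x - \sum_(k < n) u k) <= M *+ 2 / 2 ^+ n }.

Context {N : E -> R} (bnN : banach_norm N).

Lemma bnN_le x : N (- x) <= N x.
Proof. by rewrite -scaleN1r (le_trans (bnZ bnN _ _))// cabsN cabs1 mul1r. Qed.

Lemma bn_opp x : N (- x) = N x.
Proof. by apply/eqP; rewrite eq_le bnN_le/= -{1}(opprK x) bnN_le. Qed.

Lemma bn0 : N 0 = 0.
Proof.
have h : N 0 <= 0 by rewrite -(scale0r 0) (le_trans (bnZ bnN _ _))// cabs0 mul0r.
apply/eqP; rewrite eq_le h/=; have := bnD bnN 0 0; rewrite addr0 => k; lra.
Qed.

Lemma bn_ge0 x : 0 <= N x.
Proof. have := bnD bnN x (- x); rewrite subrr bn0 bn_opp => h; lra. Qed.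

Lemma bnB x y : N (x - y) <= N x + N y.
Proof. by rewrite -(bn_opp y) bnD. Qed.

Lemma bn_sum I (r : seq I) (P : pred I) (F : I -> E) :
  N (\sum_(i <- r | P i) F i) <= \sum_(i <- r | P i) N (F i).
Proof.
elim/big_ind2 : _ => [|a b c d ab cd|//]; first by rewrite bn0.
by rewrite (le_trans (bnD bnN _ _))// lerD.
Qed.

Lemma bn1_ge1 : 1 <= N 1.
Proof.
have N1 : 0 < N 1.
  by rewrite lt_neqAle bn_ge0 andbT; apply/eqP => /esym h; have := @bn_eq0 _ bnN 1; rewrite h => /(_ (lexx _))/eqP; rewrite oner_eq0.
by have := bnM bnN 1 1; rewrite mulr1 ler_pMr.
Qed.

Lemma bnX x n : (0 < n)%N -> N (x ^+ n) <= N x ^+ n.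
Proof.
case: n => // n _; elim: n => [|n IH]; first by rewrite !expr1.
rewrite exprS [leRHS]exprS (le_trans (bnM bnN _ _))// ler_wpM2l ?bn_ge0//.
Qed.

Lemma half_pow_small (C e : R) : 0 < e -> exists n, C / 2 ^+ n <= e.
Proof.
move=> e0; have [n hn] : exists n, C / e <= n%:R.
  by exists (Num.bound `|C / e|); exact: ltW (le_lt_trans (ler_norm _) (archi_boundP (normr_ge0 _))).
exists n; rewrite ler_pdivrMr ?exprn_gt0// mulrC -ler_pdivrMr//.
rewrite (le_trans hn)// -natrX ler_nat ltnW// ltn_expl//.
Qed.

Lemma contraction_solve (f : E -> E) : (forall x y, f (x - y) = f x - f y) ->
  (forall x, N (f x) <= N x / 2) ->
  forall q, exists x, x - f x = q /\ N x <= N q *+ 2.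
Proof.
move=> fB fN q; have [|x hx] := @bn_complete _ bnN (fun n => iter n f q) (N q).
  elim=> [|n IH]; first by rewrite expr0 divr1.
  by rewrite iterS (le_trans (fN _))// exprSr invfM mulrA ler_wpM2r.
have f0 : f 0 = 0 by have := fB 0 0; rewrite !subrr.
have fD y z : f (y + z) = f y + f z.
  by rewrite -[z in LHS]opprK fB -{1}(sub0r z) fB f0 sub0r opprK.
exists x; split; last first.
  by have := hx 0%N; rewrite big_ord0 subr0 expr0 divr1.
apply/eqP; rewrite -subr_eq0; apply/eqP; apply: (@bn_eq0 _ bnN).
rewrite leNgt; apply/negP => pos.
(* The constant 4 is 2 + 1 + 1: the remainder [x - S], its image under [f], and the residual
   [iter n f q] of the partial sum. *)
have [n hn] := @half_pow_small (N q *+ 4) (N (x - f x - q) / 2) (divr_gt0 pos (ltr0n _ 2)).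
pose S := \sum_(k < n) iter k f q.
have SE : S - f S = q - iter n f q.
  rewrite /S; elim: n {hn S} => [|n IH]; first by rewrite big_ord0 f0 subrr /= subrr.
  rewrite big_ord_recr/= fD opprD addrACA IH; by rewrite addrA subrK.
have := hx n; rewrite -/S => hS.
have iN : N (iter n f q) <= N q / 2 ^+ n.
  elim: n {hn S SE hS} => [|n IH]; first by rewrite expr0 divr1.
  by rewrite iterS (le_trans (fN _))// exprSr invfM mulrA ler_wpM2r.
have : x - f x - q = (x - S) - f (x - S) - iter n f q.
  rewrite fB opprB [f S - f x]addrC addrACA.
  by rewrite -[- S + _]opprK opprD opprK SE -[RHS]addrA -(opprD (q - _)) subrK.
move=> eq; have : N (x - f x - q) <= N q *+ 4 / 2 ^+ n.
  rewrite eq (le_trans (bnB _ _))// (le_trans (lerD (bnB _ _) iN))//.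
  have := fN (x - S) => h.
  rewrite (le_trans (lerD (lerD hS (le_trans h (ler_wpM2r _ hS))) (lexx _)))//.
  have p : 0 <= (2 ^+ n : R)^-1 by rewrite invr_ge0 exprn_ge0.
  rewrite le_eqVlt; apply/orP; left; apply/eqP; field; exact: lt0r_neq0 (exprn_gt0 _ _).
move=> /le_trans/(_ hn); move: pos; clear; move: (N _) => w; lra.
Qed.

End BanachAlgebra.

Section FourthRoots.
Context {F : comNzRingType} (i : F) (i2 : i * i = -1).

Lemma root4_3 (u w : F) : w ^+ 4 = 1 -> w * (u * w) ^+ 3 = u ^+ 3.
Proof. by move=> w4; rewrite -[RHS]mulr1 -w4; ring. Qed.

Lemma root4_X4 k : (i ^+ k) ^+ 4 = 1.
Proof.
by rewrite exprAC (_ : i ^+ 4 = 1) ?expr1n// (exprM _ 2 2) !expr2 i2 mulrNN mulr1.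
Qed.

(** These cancellations remove the terms of order 0, 1 and 2 of a sum over the midpoints of a
    square. The third order survives, since the fourth power of [i ^ k] is [1]. *)
Lemma root4_sums (u : F) : [/\ \sum_(k < 4) i ^+ k = 0,
  \sum_(k < 4) i ^+ k * (u * i ^+ k) = 0 &
  \sum_(k < 4) i ^+ k * (u * i ^+ k) ^+ 2 = 0].
Proof.
rewrite !big_ord_recl !big_ord0 /= !expr1 !expr0 !addr0 /bump/= !add1n.
have i3 : i ^+ 3 = - i by rewrite exprS expr2 i2 mulrN1.
have i2' : i ^+ 2 = - 1 by rewrite expr2.
split; rewrite ?i3 ?i2'; first by ring.
  have -> : 1 * (u * 1) + (i * (u * i) + (-1 * (u * -1) + - i * (u * - i))) =
    u *+ 2 + u * (i * i) *+ 2 by ring.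
  by rewrite i2; ring.
have -> : 1 * (u * 1) ^+ 2 + (i * (u * i) ^+ 2 + (-1 * (u * -1) ^+ 2 + - i * (u * - i) ^+ 2)) =
  0 by ring.
by [].
Qed.

End FourthRoots.

Definition inv_of {E : nzRingType} (x y : E) := x * y = 1 /\ y * x = 1.

Section Inverses.
Context {E : nzRingType}.
Implicit Types x y z : E.

Lemma inv_ofC x y : inv_of x y -> inv_of y x. Proof. by case. Qed.

Lemma inv_of_uniq x y z : inv_of x y -> inv_of x z -> y = z.
Proof. by move=> [_ yx] [xz _]; rewrite -[y]mulr1 -xz mulrA yx mul1r. Qed.

Lemma inv_ofM x y x' y' : inv_of x x' -> inv_of y y' -> inv_of (x * y) (y' * x').
Proof.
move=> [h1 h2] [k1 k2]; split.
  by rewrite mulrA -[x * y * y']mulrA k1 mulr1.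
by rewrite mulrA -[y' * x' * x]mulrA h2 mulr1.
Qed.

Lemma inv_of_comm x y z : inv_of x y -> GRing.comm z x -> GRing.comm z y.
Proof.
move=> [xy yx] zx; rewrite /GRing.comm.
have -> : z * y = y * (x * z) * y by rewrite mulrA yx mul1r.
by rewrite -zx -!mulrA xy mulr1.
Qed.

End Inverses.

Section Perturbation.
Context {R : realType} {E : algType R[i]} {N : E -> R} (bnN : banach_norm N).
Implicit Types (a b x y z q r : E) (c l : R[i]) (C : R).

Lemma neumann x : N x <= 2^-1 -> exists y, inv_of (1 - x) y /\ N y <= N 1 *+ 2.
Proof.
move=> Nx; have [||y [hy Ny]] := @contraction_solve _ _ _ bnN (fun z => x * z) _ _ 1.
- by move=> u v; rewrite mulrBr.
- move=> z; rewrite (le_trans (bnM bnN _ _))// mulrC ler_wpM2l// (bn_ge0 bnN)//.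
have [||w [hw _]] := @contraction_solve _ _ _ bnN (fun z => z * x) _ _ 1.
- by move=> u v; rewrite mulrBl.
- move=> z; rewrite (le_trans (bnM bnN _ _))// ler_wpM2l// (bn_ge0 bnN)//.
exists y; split => //; have xy : (1 - x) * y = 1 by rewrite mulrBl mul1r.
have wx : w * (1 - x) = 1 by rewrite mulrBr mulr1.
split=> //; suff -> : y = w by [].
by rewrite -[y]mul1r -wx -mulrA xy mulr1.
Qed.

Lemma inv_perturb x r l C : inv_of x r -> N r <= C -> cabs l * C <= 2^-1 ->
  exists y, inv_of (x - l%:A) y /\ N y <= N 1 *+ 2 * C.
Proof.
move=> xr Nr lC; have [|y [hy Ny]] := @neumann (l *: r).
  by rewrite (le_trans (bnZ bnN _ _))// (le_trans _ lC)// ler_wpM2l// cabs_ge0.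
exists (y * r); split; last first.
  by rewrite (le_trans (bnM bnN _ _))// ler_pM// (bn_ge0 bnN).
have -> : x - l%:A = x * (1 - l *: r) by rewrite mulrBr mulr1 -scalerAr (proj1 xr).
exact: inv_ofM.
Qed.

Lemma inv_large b l M : N b <= M -> 2 * M <= cabs l -> 0 < cabs l ->
  exists y, inv_of (b - l%:A) y /\ N y <= N 1 *+ 2 / cabs l.
Proof.
move=> Nb Ml l0; have l0' : l != 0 by rewrite -cabs_gt0.
have [|y [[h1 h2] Ny]] := @neumann (l^-1 *: b).
  rewrite (le_trans (bnZ bnN _ _))// cabsV mulrC ler_pdivrMr// (le_trans Nb)//.
  by rewrite ler_pdivlMl.
exists (- l^-1 *: y); split; last first.
  rewrite (le_trans (bnZ bnN _ _))// cabsN cabsV mulrC ler_wpM2r// invr_ge0 cabs_ge0//.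
have -> : b - l%:A = - l *: (1 - l^-1 *: b).
  by rewrite scalerBr scalerA mulNr divff// !scaleNr scale1r opprK addrC.
by split; rewrite -scalerAl -scalerAr scalerA ?h1 ?h2 mulrNN ?divff ?mulVf// scale1r.
Qed.

Lemma inv_comm_scalar a l r : inv_of (a - l%:A) r -> GRing.comm a r.
Proof.
move=> h; apply: inv_of_comm h _; rewrite /GRing.comm mulrBr mulrBl.
by rewrite -scalerAl -scalerAr mulr1 mul1r.
Qed.

(** The resolvent identity in a form that can be iterated: substituting it into its own right-hand
    side raises the order in [l] by one. *)
Lemma inv_shift x l r f : inv_of x r -> inv_of (x - l%:A) f -> f = r + l *: (r * f).
Proof.
move=> [_ rx] [xf _]; have : r * ((x - l%:A) * f) = r by rewrite xf mulr1.
rewrite mulrBl -scalerAl mul1r mulrBr mulrA rx mul1r -scalerAr.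
by move/(canRL (subrK _)) => {1}->.
Qed.

(* The four midpoint values of the resolvent around a small square agree with its
   expansion up to third order, so that the discrete contour sum only retains a
   term of order [u ^+ 3]. *)
Lemma four_corners x r (u : R[i]) (f : nat -> E) : inv_of x r ->
  (forall k, inv_of (x - (u * 'i%C ^+ k)%:A) (f k)) ->
  \sum_(k < 4) 'i%C ^+ k *: f k = u ^+ 3 *: (r ^+ 3 * \sum_(k < 4) f k).
Proof.
move=> xr hf; have i2 : ('i%C : R[i]) * 'i%C = -1 by rewrite -expr2 sqr_i.
have fE k : f k = r + (u * 'i%C ^+ k) *: r ^+ 2 + (u * 'i%C ^+ k) ^+ 2 *: r ^+ 3 +
    (u * 'i%C ^+ k) ^+ 3 *: (r ^+ 3 * f k).
  set l := u * _; have h := inv_shift xr (hf k).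
  rewrite {1}h -/l {1}h -/l {1}h -/l !(mulrDr, scalerDr) -!scalerAr !scalerA.
  by rewrite !exprS expr0 !mulr1 !mulrA !addrA.
have sE k : 'i%C ^+ k *: f k = 'i%C ^+ k *: r + ('i%C ^+ k * (u * 'i%C ^+ k)) *: r ^+ 2 +
    ('i%C ^+ k * (u * 'i%C ^+ k) ^+ 2) *: r ^+ 3 + u ^+ 3 *: (r ^+ 3 * f k).
  by rewrite {1}fE !scalerDr !scalerA (root4_3 _ (root4_X4 i2 _)).
under eq_bigr do rewrite sE.
rewrite !big_split/= -!scaler_suml -scaler_sumr -mulr_sumr.
by case: (root4_sums i2 u) => -> -> ->; rewrite !scale0r !add0r.
Qed.

End Perturbation.

(** * A discrete Cauchy integral for the Sylvester equation *)

Lemma abel_summation (F : nzRingType) (V : lmodType F) (x : nat -> F) (v : nat -> V) m :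
  x 0%N = 0 -> x m.+1 = 0 ->
  \sum_(0 <= s < m.+1) (x s - x s.+1) *: v s =
  \sum_(0 <= s < m) x s.+1 *: (v s.+1 - v s).
Proof.
move=> x0 xm; suff : forall n, \sum_(0 <= s < n.+1) (x s - x s.+1) *: v s =
  \sum_(0 <= s < n) x s.+1 *: (v s.+1 - v s) - x n.+1 *: v n.
  by move=> ->; rewrite xm scale0r subr0.
elim=> [|n IH].
  by rewrite big_nat1 big_geq// x0 sub0r scaleNr sub0r.
rewrite big_nat_recr//= IH [in RHS]big_nat_recr//= -!addrA; congr (_ + _).
by rewrite scalerBl scalerBr addrCA addrA.
Qed.

Lemma sum_allpairs (V : nmodType) I (h : nat -> nat -> I) (r1 r2 : seq nat) (F : I -> V) :
  \sum_(e <- [seq h i j | i <- r1, j <- r2]) F e = \sum_(i <- r1) \sum_(j <- r2) F (h i j).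
Proof. exact: big_allpairs_dep. Qed.

Section Contour.
Context {R : realType} (m : nat) (u : R) (chi : nat -> nat -> bool).
Local Notation C := R[i].

(** The mesh is [u], but the small squares have side [2 u]: two odd indices give a center, one odd
    and one even index the midpoint of an edge. *)
Definition grid (p q : nat) : C := (((p%:R - m%:R) * u) +i* ((q%:R - m%:R) * u))%C.
Definition sqcenter (s t : nat) : C := grid s.*2.+1 t.*2.+1.

(* The indices are shifted by one. *)
Definition chi0 (s t : nat) : C :=
  if s is s'.+1 then if t is t'.+1 then
    ((s' < m)%N && (t' < m)%N && chi s' t')%:R else 0 else 0.

(** Each edge occurs once, weighted by the colour of the square before it minus that of the square
    after it. The weighted sum is the midpoint rule for a counterclockwise boundary integral divided
    by [2 u i], which leaves the factor [1] on vertical edges and ['i] on horizontal ones. *)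
Definition contour : seq (C * C) :=
  [seq (chi0 s t.+1 - chi0 s.+1 t.+1, grid s.*2 t.*2.+1)
     | t <- index_iota 0 m, s <- index_iota 0 m.+1] ++
  [seq ('i%C * (chi0 s.+1 t - chi0 s.+1 t.+1), grid s.*2.+1 t.*2)
     | s <- index_iota 0 m, t <- index_iota 0 m.+1].

Arguments chi0 : simpl never.

Lemma grid_cornerE s t k : (k < 4)%N -> sqcenter s t + u%:C%C * 'i%C ^+ k =
  nth 0 [:: grid s.*2.+2 t.*2.+1; grid s.*2.+1 t.*2.+2;
            grid s.*2 t.*2.+1; grid s.*2.+1 t.*2] k.
Proof.
rewrite /sqcenter /grid; have i2 : 'i%C ^+ 2 = -1 :> C by rewrite sqr_i.
have i3 : 'i%C ^+ 3 = - 'i%C :> C by rewrite exprS i2 mulrN1.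
have E p : (p.+1)%:R = p%:R + 1 :> R by rewrite -natr1.
case: k => [|[|[|[|//]]]] _; rewrite ?expr0 ?expr1 ?i2 ?i3 /=; simpl;
  apply/eqP; rewrite eq_complex /= !E; apply/andP; split; apply/eqP; simpl; ring.
Qed.

Lemma contour_corner (V : lmodType C) (f : C -> V) s t :
  \sum_(k < 4) 'i%C ^+ k *: f (sqcenter s t + u%:C%C * 'i%C ^+ k) =
    (f (grid s.*2.+2 t.*2.+1) - f (grid s.*2 t.*2.+1)) +
    'i%C *: (f (grid s.*2.+1 t.*2.+2) - f (grid s.*2.+1 t.*2)).
Proof.
under eq_bigr => k _ do rewrite grid_cornerE//.
rewrite !big_ord_recl big_ord0 /= /bump /= !add1n expr0 expr1 scale1r addr0.
have i2 : 'i%C ^+ 2 = -1 :> C by rewrite sqr_i.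
have i3 : 'i%C ^+ 3 = - 'i%C :> C by rewrite exprS i2 mulrN1.
by rewrite i2 i3 scaleN1r scaleNr scalerBr -!addrA; congr (_ + _); rewrite addrCA.
Qed.

(** Abel summation along rows and columns moves the differences from the colours to the values of
    [f]; an edge shared by two coloured squares cancels. *)
Lemma contour_sum (V : lmodType C) (f : C -> V) :
  \sum_(e <- contour) e.1 *: f e.2 =
  \sum_(0 <= t < m) \sum_(0 <= s < m) (chi s t)%:R *:
     \sum_(k < 4) 'i%C ^+ k *: f (sqcenter s t + u%:C%C * 'i%C ^+ k).
Proof.
rewrite /contour big_cat !(sum_allpairs _ _ _ (fun e => e.1 *: f e.2))/=.
have -> : \sum_(0 <= t < m) \sum_(0 <= s < m.+1)
      (chi0 s t.+1 - chi0 s.+1 t.+1) *: f (grid s.*2 t.*2.+1) =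
   \sum_(0 <= t < m) \sum_(0 <= s < m) (chi s t)%:R *:
     (f (grid s.*2.+2 t.*2.+1) - f (grid s.*2 t.*2.+1)).
  apply: eq_big_nat => t /= tm; rewrite (@abel_summation _ _ (fun s => chi0 s t.+1)
    (fun s => f (grid s.*2 t.*2.+1)))//; last by rewrite /chi0 ltnn.
  by apply: eq_big_nat => s /= sm; rewrite /chi0 sm tm.
have -> : \sum_(0 <= s < m) \sum_(0 <= t < m.+1)
      ('i%C * (chi0 s.+1 t - chi0 s.+1 t.+1)) *: f (grid s.*2.+1 t.*2) =
   \sum_(0 <= s < m) \sum_(0 <= t < m) (chi s t)%:R *:
     ('i%C *: (f (grid s.*2.+1 t.*2.+2) - f (grid s.*2.+1 t.*2))).
  apply: eq_big_nat => s /= sm; under eq_bigr do rewrite -scalerA.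
  rewrite -scaler_sumr (@abel_summation _ _ (fun t => chi0 s.+1 t)
    (fun t => f (grid s.*2.+1 t.*2)))//; last by rewrite /chi0 ltnn andbF.
  rewrite scaler_sumr; apply: eq_big_nat => t /= tm; rewrite /chi0 sm tm /=.
  by rewrite !scalerA mulrC.
rewrite [X in _ + X]exchange_big_nat/= -big_split/=; apply: eq_bigr => t _.
by rewrite -big_split/=; apply: eq_bigr => s _; rewrite contour_corner [RHS]scalerDr.
Qed.

Lemma cabs_boolB (b c : bool) : cabs (b%:R - c%:R : C) <= 1.
Proof.
by case: b; case: c; rewrite ?mulr1n ?mulr0n ?subrr ?subr0 ?sub0r ?cabsN ?cabs1 ?cabs0; rewrite ?ler01 ?lexx.
Qed.

Lemma chi0_bool s t : exists b : bool, chi0 s t = b%:R.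
Proof. case: s => [|s]; [by exists false|case: t => [|t]; [by exists false|by eexists]]. Qed.

Lemma contour_coef e : e \in contour -> cabs e.1 <= 1.
Proof.
rewrite mem_cat => /orP[] /allpairsPdep[x [y [_ _ ->]]]/=.
  by have [b ->] := chi0_bool y x.+1; have [c ->] := chi0_bool y.+1 x.+1; exact: cabs_boolB.
rewrite cabsM cabs_i mul1r.
by have [b ->] := chi0_bool x.+1 y; have [c ->] := chi0_bool x.+1 y.+1; exact: cabs_boolB.
Qed.

Lemma size_contour : size contour = (m * m.+1 + m * m.+1)%N.
Proof. by rewrite size_cat !size_allpairs !size_iota !subn0. Qed.

(** On every edge that counts both resolvents can be controlled: it is either far enough out for the
    Neumann series, or close to one center of each colour. *)
Lemma contour_edge e : 0 <= u -> e \in contour ->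
  [\/ e.1 = 0, m%:R * u <= cabs e.2 |
    exists s t s' t', [/\ (s < m)%N && (t < m)%N, (s' < m)%N && (t' < m)%N,
      chi s t /\ ~~ chi s' t', cabs (sqcenter s t - e.2) = u & cabs (sqcenter s' t' - e.2) = u]].
Proof.
move=> u0; have E p : (p.+1)%:R = p%:R + 1 :> R by rewrite -natr1.
have nE p : (p.*2)%:R = p%:R *+ 2 :> R by rewrite -mul2n natrM mulr_natl.
have dx p q : cabs (grid p.+1 q - grid p q) = u.
  have -> : grid p.+1 q - grid p q = (u%:C)%C.
    by apply/eqP; rewrite eq_complex/= E; apply/andP; split; apply/eqP; ring.
  by rewrite cabs_real ger0_norm.
have dy p q : cabs (grid p q.+1 - grid p q) = u.
  have -> : grid p q.+1 - grid p q = 'i%C * (u%:C)%C.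
    by apply/eqP; rewrite eq_complex/= E; apply/andP; split; apply/eqP; simpl; ring.
  by rewrite cabsM cabs_i mul1r cabs_real ger0_norm.
have dx' p q : cabs (grid p q - grid p.+1 q) = u by rewrite cabsB dx.
have dy' p q : cabs (grid p q - grid p q.+1) = u by rewrite cabsB dy.
rewrite mem_cat => /orP[] /allpairsPdep[x [y []]]; rewrite !mem_index_iota => /= xm ym ->/=.
  case: y ym => [_|y ym].
    constructor 2; apply: le_trans (cabs_ge_Re _); rewrite /grid/= sub0r mulNr normrN.
    by rewrite ger0_norm// mulr_ge0.
  have [->|ym'] := eqVneq y.+1 m.
    constructor 2; apply: le_trans (cabs_ge_Re _); rewrite /grid/= nE.
    by rewrite mulr2n addrK ger0_norm// mulr_ge0.
  rewrite /chi0 xm !andbT; have y1m : (y.+1 < m)%N by lia.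
  rewrite (ltnW y1m) y1m /=.
  case c1 : (chi y x); case c2 : (chi y.+1 x); rewrite ?subrr; first by constructor 1.
  - by constructor 3; exists y, x, y.+1, x; rewrite c1 c2 xm y1m (ltnW y1m) /sqcenter dx doubleS dx'.
  - by constructor 3; exists y.+1, x, y, x; rewrite c1 c2 xm y1m (ltnW y1m) /sqcenter dx doubleS dx'.
  - by constructor 1.
case: y ym => [_|y ym].
  constructor 2; apply: le_trans (cabs_ge_Im _); rewrite /grid/= sub0r mulNr normrN.
  by rewrite ger0_norm// mulr_ge0.
have [->|ym'] := eqVneq y.+1 m.
  constructor 2; apply: le_trans (cabs_ge_Im _); rewrite /grid/= nE.
  by rewrite mulr2n addrK ger0_norm// mulr_ge0.
rewrite /chi0 xm /=; have y1m : (y.+1 < m)%N by lia.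
rewrite (ltnW y1m) y1m /=.
case c1 : (chi x y); case c2 : (chi x y.+1); rewrite ?subrr ?mulr0; first by constructor 1.
- by constructor 3; exists x, y, x, y.+1; rewrite c1 c2 xm y1m (ltnW y1m) /sqcenter dy doubleS dy'.
- by constructor 3; exists x, y.+1, x, y; rewrite c1 c2 xm y1m (ltnW y1m) /sqcenter dy doubleS dy'.
- by constructor 1.
Qed.

End Contour.

Section SylvesterSolve.
Context {R : realType} {E : algType R[i]} {N : E -> R} (bnN : banach_norm N).
Local Notation C := R[i].
Implicit Types (a b x y z q r : E) (l : C).

(** The default [0] makes [res a l] commute with [a] even at points of the spectrum. *)
Definition res a l : E := xget 0 [set y | inv_of (a - l%:A) y].

Lemma resE a l y : inv_of (a - l%:A) y -> res a l = y.
Proof.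
move=> h; have := @xgetPex _ 0 [set y | inv_of (a - l%:A) y] (ex_intro _ y h).
by move=> /inv_of_uniq; exact.
Qed.

Lemma res_comm a l : GRing.comm a (res a l).
Proof.
rewrite /res; case: xgetP => [y _ /= /inv_comm_scalar//|_]; exact: commr0.
Qed.

Section Contour.
Context (a b : E) (es : seq (C * C)) (k B : R).
Hypothesis k0 : 0 < k.
Hypothesis B0 : 0 <= B.
Hypothesis es_res : forall e, e \in es -> e.1 = 0 \/
  [/\ inv_of (a - e.2%:A) (res a e.2), inv_of (b - e.2%:A) (res b e.2),
      N (res a e.2) <= B & N (res b e.2) <= B].
Hypothesis es_le1 : forall e, e \in es -> cabs e.1 <= 1.
Hypothesis small : N (\sum_(e <- es) e.1 *: res a e.2) +
  N (\sum_(e <- es) e.1 *: res b e.2 + (k%:C)%C%:A) <= k / 2.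

Let S q := \sum_(e <- es) e.1 *: (res b e.2 * q * res a e.2).
Let T x := b * x - x * a.
Let alpha := \sum_(e <- es) e.1 *: res a e.2.
Let beta := \sum_(e <- es) e.1 *: res b e.2.

(** With [r] and [r'] the resolvents of [b] and [a] at the same point [l], one has
    [b r q r' - r q r' a = q r' - r q], because the two multiples of [l] cancel. *)
Let TS q : T (S q) = q * alpha - beta * q.
Proof.
rewrite /T /S /alpha /beta !mulr_sumr !mulr_suml -!sumrB.
apply: eq_big_seq => e ees; have [->|[[a1 a2] [b1 b2] _ _]] := es_res ees.
  by rewrite !scale0r !(mulr0,mul0r).
move: a1 a2 b1 b2; set l := e.2; set ra := res a l; set rb := res b l => a1 a2 b1 b2.
have bE : b = (b - l%:A) + l%:A by rewrite subrK.
have aE : a = (a - l%:A) + l%:A by rewrite subrK.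
rewrite -!scalerAr -!scalerAl -!scalerBr; congr (_ *: _).
rewrite {1}bE {1}aE mulrDl mulrDr -!scalerAl mul1r -!scalerAr mulr1.
rewrite opprD addrACA subrr addr0 !mulrA b1 mul1r.
by rewrite -[rb * q * ra * _]mulrA a2 mulr1.
Qed.

Let ST x : S (T x) = T (S x).
Proof.
rewrite /T /S mulr_sumr mulr_suml -sumrB; apply: eq_bigr => e _.
rewrite -!scalerAr -!scalerAl -scalerBr mulrBr mulrBl.
rewrite !mulrA (res_comm b); congr (_ *: (_ - _)).
by rewrite -!mulrA (res_comm a).
Qed.

Let S_le q : N (S q) <= (size es)%:R * B ^+ 2 * N q.
Proof.
rewrite (le_trans (bn_sum bnN _ _ _))// big_seq.
have -> : (size es)%:R * B ^+ 2 * N q = \sum_(e <- es | e \in es) B ^+ 2 * N q.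
  by rewrite -big_seq big_const_seq count_predT iter_addr_0 -mulrA mulr_natl.
apply: ler_sum => e ees; have Bq : 0 <= B ^+ 2 * N q.
  by rewrite mulr_ge0 ?(bn_ge0 bnN)// exprn_ge0.
have [->|[_ _ ha hb]] := es_res ees; first by rewrite scale0r (bn0 bnN).
rewrite (le_trans (bnZ bnN _ _))// (le_trans (ler_wpM2r (bn_ge0 bnN _) (es_le1 ees)))//.
rewrite mul1r (le_trans (bnM bnN _ _))// expr2 mulrAC ler_pM// ?(bn_ge0 bnN)//.
by rewrite (le_trans (bnM bnN _ _))// ler_wpM2r// (bn_ge0 bnN).
Qed.

(** The defect of [S / k] as a right inverse of [T]; it is a contraction because [alpha] is near [0]
    and [beta] near [- k]. *)
Let D x := x - (k^-1)%:C%C *: T (S x).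

Let D_le x : N (D x) <= N x / 2.
Proof.
have kC : (k^-1)%:C%C * (k%:C)%C = 1 :> C.
  by rewrite -(rmorphM (real_complex R)) mulVf ?gt_eqF// rmorph1.
have -> : D x = (k^-1)%:C%C *: ((beta + (k%:C)%C%:A) * x - x * alpha).
  rewrite /D TS mulrDl -scalerAl mul1r [in RHS]addrAC [RHS]scalerDr scalerA kC scale1r.
  by rewrite -scalerN opprB [RHS]addrC.
have -> : N x / 2 = k^-1 * (k / 2 * N x) by rewrite mulrC; field; rewrite gt_eqF.
rewrite (le_trans (bnZ bnN _ _))// cabs_real gtr0_norm ?invr_gt0//.
apply: ler_wpM2l; first by rewrite invr_ge0 ltW.
rewrite (le_trans (bnB bnN _ _))//.
rewrite (le_trans _ (ler_wpM2r (bn_ge0 bnN _) small))// [leRHS]mulrDl [leRHS]addrC lerD//.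
  exact: (bnM bnN).
by rewrite mulrC (bnM bnN).
Qed.

Let SD x y : S (x - y) = S x - S y.
Proof.
by rewrite /S -sumrB; apply: eq_bigr => e _; rewrite -scalerBr mulrBr mulrBl.
Qed.

Let TD x y : T (x - y) = T x - T y.
Proof. by rewrite /T mulrBr mulrBl !opprB addrACA [in RHS]addrACA; congr (_ + _); rewrite addrC. Qed.

Lemma sylvester_solve q : exists x, b * x - x * a = q /\
  N x <= (k^-1 * ((size es)%:R * B ^+ 2) * 2) * N q.
Proof.
have DB x y : D (x - y) = D x - D y.
  by rewrite /D SD TD scalerBr !opprB addrACA [in RHS]addrACA; congr (_ + _); rewrite addrC.
(* The equation [z - D z = q] says that [T (S z) = k q]. *)
have [z [hz Nz]] := @contraction_solve _ _ _ bnN D DB D_le q.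
exists ((k^-1)%:C%C *: S z); split.
  by rewrite -hz /D subKr /T -scalerAr -scalerAl -scalerBr.
rewrite (le_trans (bnZ bnN _ _))// cabs_real gtr0_norm ?invr_gt0//.
rewrite -!mulrA; apply: ler_wpM2l; first by rewrite invr_ge0 ltW.
rewrite (le_trans (S_le _))//.
rewrite -mulrA; apply: ler_wpM2l => //.
by rewrite mulrA -expr2; apply: ler_wpM2l; [exact: exprn_ge0|rewrite mulr_natl].
Qed.

(** [S] commutes with [T], so a zero of [T] is fixed by the contraction [D]. *)
Lemma sylvester_uniq x : b * x - x * a = 0 -> x = 0.
Proof.
move=> Tx; apply: (bn_eq0 bnN); have := D_le x.
have -> : D x = x.
  rewrite /D -ST /T Tx /S big1 ?scaler0 ?subr0// => e _.
  by rewrite mulr0 mul0r scaler0.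
by move: (N x) => w h; lra.
Qed.

End Contour.

End SylvesterSolve.

Section OuterContour.
Context {R : realType} (m : nat) (u : R).
Local Notation C := R[i].

(** Inner edges telescope and only the four sides of the large square remain. *)
Lemma contour_outer (V : lmodType C) (f : C -> V) :
  \sum_(0 <= t < m) \sum_(0 <= s < m)
     \sum_(k < 4) 'i%C ^+ k *: f (sqcenter m u s t + u%:C%C * 'i%C ^+ k) =
  \sum_(0 <= t < m) (f (grid m u m.*2 t.*2.+1) - f (grid m u 0 t.*2.+1)) +
  \sum_(0 <= s < m) 'i%C *: (f (grid m u s.*2.+1 m.*2) - f (grid m u s.*2.+1 0)).
Proof.
transitivity (\sum_(0 <= t < m) \sum_(0 <= s < m)
    ((f (grid m u s.*2.+2 t.*2.+1) - f (grid m u s.*2 t.*2.+1)) +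
    'i%C *: (f (grid m u s.*2.+1 t.*2.+2) - f (grid m u s.*2.+1 t.*2)))).
  by apply: eq_bigr => t _; apply: eq_bigr => s _; rewrite contour_corner.
under eq_bigr do rewrite big_split/=.
rewrite big_split/=; congr (_ + _).
  apply: eq_bigr => t _.
  exact: (@telescope_sumr _ 0 m (fun s => f (grid m u s.*2 t.*2.+1))).
rewrite exchange_big_nat/=; apply: eq_bigr => s _; rewrite -scaler_sumr; congr (_ *: _).
exact: (@telescope_sumr _ 0 m (fun t => f (grid m u s.*2.+1 t.*2))).
Qed.

Lemma inv_pair_re (L y : R) : 0 < L ->
  (L +i* y)%C^-1 - ((- L) +i* y)%C^-1 = (2 * L / (L ^+ 2 + y ^+ 2))%:C%C.
Proof.
move=> L0; have n0 : L ^+ 2 + y ^+ 2 != 0.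
  by rewrite gt_eqF// ltr_pwDl ?exprn_gt0// sqr_ge0.
apply/eqP; rewrite eq_complex/= sqrrN; apply/andP; split; apply/eqP; field => //.
Qed.

Lemma inv_pair_im (L x : R) : 0 < L ->
  'i%C * ((x +i* L)%C^-1 - (x +i* (- L))%C^-1) = (2 * L / (L ^+ 2 + x ^+ 2))%:C%C.
Proof.
move=> L0; have n0 : L ^+ 2 + x ^+ 2 != 0.
  by rewrite gt_eqF// ltr_pwDl ?exprn_gt0// sqr_ge0.
have n1 : x ^+ 2 + L ^+ 2 != 0 by rewrite addrC.
apply/eqP; rewrite eq_complex/= sqrrN; apply/andP; split; apply/eqP; simpl; field => //.
Qed.

End OuterContour.

Section SylvesterBound.
Context {R : realType} {E : algType R[i]} {N : E -> R} (bnN : banach_norm N).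
Local Notation C := R[i].
Implicit Types (a b x y z q r : E) (l : C).

(** Far out the resolvent is [- 1 / l], up to the remainder [b y / l] with [y] the resolvent
    itself. *)
Lemma res_outer b l (M L : R) : 0 < L -> 0 <= M -> N b <= M -> 2 * M <= L -> L <= cabs l ->
  N (res b l + l^-1%:A) <= N 1 *+ 2 * M / L ^+ 2.
Proof.
move=> L0 M0 Nb ML Ll; have l0 := lt_le_trans L0 Ll.
have [|y [hy Ny]] := @inv_large _ _ _ bnN b l M Nb _ l0; first exact: le_trans Ll.
rewrite (resE hy); have l0' : l != 0 by rewrite -cabs_gt0.
have -> : y + l^-1%:A = l^-1 *: (b * y).
  case: hy => hy _; move: hy; rewrite mulrBl -scalerAl mul1r => /(canRL (subrK _)) ->.
  by rewrite scalerDr scalerA mulVf// scale1r addrC.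
rewrite (le_trans (bnZ bnN _ _))// cabsV.
rewrite (_ : _ / L ^+ 2 = L^-1 * (M * (N 1 *+ 2 / L))); last first.
  by field; rewrite gt_eqF.
apply: ler_pM; rewrite ?invr_ge0 ?cabs_ge0 ?(bn_ge0 bnN)//; first by rewrite lef_pV2.
rewrite (le_trans (bnM bnN _ _))// ler_pM ?(bn_ge0 bnN)// (le_trans Ny)//.
by rewrite ler_wpM2l ?mulrn_wge0 ?(bn_ge0 bnN)// lef_pV2.
Qed.

Lemma corner_small (x : E) (K u : R) l : 0 < u -> 0 < K -> u * K <= 2^-1 ->
  (exists y, inv_of (x - l%:A) y /\ N y <= K) ->
  N (\sum_(k < 4) 'i%C ^+ k *: res x (l + u%:C%C * 'i%C ^+ k)) <=
    N 1 *+ 8 * (u ^+ 3 * K ^+ 4).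
Proof.
move=> u0 K0 uK [y [hy Ny]].
have cu k : cabs (u%:C%C * 'i%C ^+ k) = u.
  by rewrite cabsM cabsX cabs_i expr1n mulr1 cabs_real gtr0_norm.
have H k : exists z, inv_of (x - (l + u%:C%C * 'i%C ^+ k)%:A) z /\ N z <= N 1 *+ 2 * K.
  have [|z [hz Nz]] := @inv_perturb _ _ _ bnN _ _ (u%:C%C * 'i%C ^+ k) _ hy Ny.
    by rewrite cu.
  by exists z; split => //; rewrite scalerDl opprD addrA.
rewrite (@four_corners _ _ (x - l%:A) y u%:C%C (fun k => res x (l + u%:C%C * 'i%C ^+ k))); first last.
- move=> k; have [z [hz _]] := H k; rewrite (resE hz).
  by move: hz; rewrite scalerDl opprD addrA.
- exact: hy.
rewrite (le_trans (bnZ bnN _ _))// cabsX cabs_real gtr0_norm//.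
rewrite (_ : _ *+ 8 * _ = u ^+ 3 * (K ^+ 3 * (N 1 *+ 2 * K *+ 4))); last by ring.
apply: ler_wpM2l; first by rewrite exprn_ge0 ?ltW.
rewrite (le_trans (bnM bnN _ _))//; apply: ler_pM; rewrite ?(bn_ge0 bnN)//.
  by rewrite (le_trans (bnX bnN _ _))//; apply: lerXn2r; rewrite ?nnegrE ?(bn_ge0 bnN) ?(ltW K0).
rewrite (le_trans (bn_sum bnN _ _ _))// -[leRHS]mulr_natl -[4%N in leRHS]card_ord.
rewrite mulr_natl -sumr_const ler_sum// => k _; have [z [hz Nz]] := H k.
by rewrite (resE hz).
Qed.

Lemma sum_center_le (F : nat -> nat -> E) (B : R) m :
  (forall s t, (s < m)%N -> (t < m)%N -> N (F s t) <= B) ->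
  N (\sum_(0 <= t < m) \sum_(0 <= s < m) F s t) <= m%:R ^+ 2 * B.
Proof.
move=> FB; rewrite expr2 -mulrA.
have aux (H : nat -> E) D : (forall s, (s < m)%N -> N (H s) <= D) ->
    N (\sum_(0 <= s < m) H s) <= m%:R * D.
  move=> HD; rewrite (le_trans (bn_sum bnN _ _ _))//.
  rewrite [leRHS](_ : _ = \sum_(0 <= s < m) D); last first.
    by rewrite sumr_const_nat subn0 mulr_natl.
  by apply: ler_sum_nat => s /= sm; exact: HD.
by apply: (aux _ _) => t tm; apply: (aux _ _) => s sm; exact: FB.
Qed.

(** [L] is chosen before [K]: the square must make the outer sum dominant using the norms alone,
    since a resolvent bound on the square exists only once the square is fixed. The mesh then
    depends on both. *)
Lemma sylvester_bound (M : R) : exists L, forall K, exists G, forall a b,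
  N a <= M -> N b <= M ->
  (forall l, `|complex.Re l| <= L -> `|complex.Im l| <= L ->
     (exists y, inv_of (a - l%:A) y /\ N y <= K) \/
     (exists y, inv_of (b - l%:A) y /\ N y <= K)) ->
  (forall q, exists x, b * x - x * a = q /\ N x <= G * N q) /\
  (forall x, b * x - x * a = 0 -> x = 0).
Proof.
have [M0|M0] := ltP M 0.
  exists 0 => K; exists 0 => a b Na; have := le_lt_trans Na M0.
  by rewrite ltNge (bn_ge0 bnN).
have n1 := bn1_ge1 bnN; set n := N 1 in n1 *.
pose L := n * M *+ 16 + 1; exists L => K.
have nM : 0 <= n * M by rewrite mulr_ge0// (le_trans ler01).
have L1 : 1 <= L by rewrite lerDr mulrn_wge0.
have L0 : 0 < L by rewrite (lt_le_trans ltr01).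
pose K1 := Num.max K 1; have K1_1 : 1 <= K1 by rewrite le_max lexx orbT.
have K10 : 0 < K1 by rewrite (lt_le_trans ltr01).
(* The first summand keeps the two inner errors below a quarter of [m / L] each. The second gives
   [u K1 <= 1 / 2], which carries a resolvent bound from a center to the midpoints around it. *)
pose big := n * L ^+ 4 * K1 ^+ 4 *+ 32 + L * K1 *+ 2.
have [m [m0 hm]] : exists m, (0 < m)%N /\ big <= m%:R.
  exists (Num.bound `|big|).+1; split => //.
  rewrite -natr1 (le_trans (ler_norm _))// (le_trans (ltW (archi_boundP (normr_ge0 _))))//.
  by rewrite lerDl.
have mR : 0 < m%:R :> R by rewrite ltr0n.
pose u := L / m%:R; have u0 : 0 < u by rewrite divr_gt0.
have mu : m%:R * u = L by rewrite mulrC divfK// gt_eqF.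
exists ((L / m%:R) * ((m * m.+1 + m * m.+1)%:R * (n *+ 2 * K1) ^+ 2) * 2).
move=> a b Na Nb hres.
pose good (x : E) l := exists y, inv_of (x - l%:A) y /\ N y <= K1.
have hres' l : `|complex.Re l| <= L -> `|complex.Im l| <= L -> good a l \/ good b l.
  move=> h1 h2; have KK : K <= K1 by rewrite le_max lexx.
  by case: (hres l h1 h2) => -[y [hy Ny]]; [left|right]; exists y; split => //; exact: le_trans KK.
have ML : 2 * M <= L.
  have MnM : M <= n * M by rewrite ler_peMl.
  by rewrite /L; move: (n * M) MnM nM => w; lra.
have uK : u * K1 <= 2^-1.
  rewrite /u mulrAC ler_pdivrMr// (le_trans (y := big / 2))//; last first.
    by rewrite mulrC ler_wpM2l.
  have : 0 <= n * L ^+ 4 * K1 ^+ 4.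
    by rewrite !mulr_ge0 ?exprn_ge0 ?(ltW L0) ?(ltW K10)// (le_trans ler01).
  by rewrite /big; move: (n * _ * _) (L * K1) => v w; lra.
pose chi s t := `[< good a (sqcenter m u s t) >].
have sqcenter_le s t : (s < m)%N -> (t < m)%N ->
    `|complex.Re (sqcenter m u s t)| <= L /\ `|complex.Im (sqcenter m u s t)| <= L.
  have aux p : (p < m)%N -> `|(p.*2.+1%:R - m%:R) * u| <= L.
    move=> pm; rewrite -mu normrM [ `|u|]gtr0_norm// ler_wpM2r ?(ltW u0)//.
    rewrite ler_norml; apply/andP; split.
      by rewrite lerBrDl subrr.
    by rewrite lerBlDl -natrD ler_nat; move: pm; clear; lia.
  by move=> sm tm; split; exact: aux.
have near_res (x : E) l c : good x c -> cabs (c - l) = u ->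
    inv_of (x - l%:A) (res x l) /\ N (res x l) <= n *+ 2 * K1.
  move=> [y [hy Ny]] cl; have [|z [hz Nz]] := @inv_perturb _ _ _ bnN _ _ (l - c) _ hy Ny.
    by rewrite cabsB cl; exact: uK.
  have E1 : x - c%:A - (l - c)%:A = x - l%:A.
    by rewrite scalerBl opprB addrA subrK.
  by rewrite E1 in hz; rewrite (resE hz).
have outer_res (x : E) l : N x <= M -> L <= cabs l ->
    inv_of (x - l%:A) (res x l) /\ N (res x l) <= n *+ 2 * K1.
  move=> Nx Ll; have l0 := lt_le_trans L0 Ll.
  have [|z [hz Nz]] := @inv_large _ _ _ bnN x l M Nx _ l0; first exact: le_trans Ll.
  rewrite (resE hz); split=> //; rewrite (le_trans Nz)// ler_wpM2l ?mulrn_wge0 ?(bn_ge0 bnN)//.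
  by rewrite (le_trans _ K1_1)// invf_le1// (le_trans L1).
pose es := contour m u chi.
have es_res e : e \in es -> e.1 = 0 \/
    [/\ inv_of (a - e.2%:A) (res a e.2), inv_of (b - e.2%:A) (res b e.2),
        N (res a e.2) <= n *+ 2 * K1 & N (res b e.2) <= n *+ 2 * K1].
  move=> /(contour_edge (ltW u0)) [->|h|[s [t [s' [t' [/andP[sm tm] /andP[sm' tm'] [c1 c2] d1 d2]]]]]].
  - by left.
  - rewrite mu in h; have [? ?] := outer_res _ _ Na h; have [? ?] := outer_res _ _ Nb h.
    by right.
  - have [[h1 h2] [h1' h2']] := (sqcenter_le _ _ sm tm, sqcenter_le _ _ sm' tm').
    move: c1 => /asboolP ga; move: c2 => /asboolPn nga.
    have gb : good b (sqcenter m u s' t') by case: (hres' _ h1' h2').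
    have [? ?] := near_res _ _ _ ga d1; have [? ?] := near_res _ _ _ gb d2.
    by right.
pose crn (x : E) s t := \sum_(k < 4) 'i%C ^+ k *: res x (sqcenter m u s t + u%:C%C * 'i%C ^+ k).
have alphaE : \sum_(e <- es) e.1 *: res a e.2 =
    \sum_(0 <= t < m) \sum_(0 <= s < m) (chi s t)%:R *: crn a s t.
  exact: contour_sum.
(* Coloured squares are good for [a]. For [b] the sum over them is the sum over all squares minus
   that over the uncoloured ones, which are good for [b]. *)
have betaE : \sum_(e <- es) e.1 *: res b e.2 =
    \sum_(0 <= t < m) \sum_(0 <= s < m) crn b s t -
    \sum_(0 <= t < m) \sum_(0 <= s < m) (~~ chi s t)%:R *: crn b s t.
  rewrite /es contour_sum -sumrB; apply: eq_bigr => t _; rewrite -sumrB; apply: eq_bigr => s _.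
  by case: (chi s t); rewrite ?scale1r ?scale0r ?subr0 ?subrr.
pose w := n *+ 8 * (u ^+ 3 * K1 ^+ 4).
have w0 : 0 <= w.
  by rewrite mulr_ge0 ?mulrn_wge0 ?(bn_ge0 bnN)// mulr_ge0// exprn_ge0// ltW.
have Nalpha : N (\sum_(e <- es) e.1 *: res a e.2) <= m%:R ^+ 2 * w.
  rewrite alphaE; have := @sum_center_le (fun s t => (chi s t)%:R *: crn a s t) w m; apply => s t sm tm; rewrite /chi; case: asboolP => h.
    by rewrite scale1r; exact: corner_small.
  by rewrite scale0r (bn0 bnN).
have Nbeta : N (\sum_(0 <= t < m) \sum_(0 <= s < m) (~~ chi s t)%:R *: crn b s t) <= m%:R ^+ 2 * w.
  have := @sum_center_le (fun s t => (~~ chi s t)%:R *: crn b s t) w m; apply => s t sm tm; rewrite /chi; case: asboolP => h.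
    by rewrite scale0r (bn0 bnN).
  rewrite scale1r; apply: corner_small => //.
  by have [h1 h2] := sqcenter_le _ _ sm tm; case: (hres' _ h1 h2).
(* The outer sum of [1 / l]. Opposite sides combine into real terms, the same for both pairs of
   sides. This is a Riemann sum for [pi / u], of which only the crude lower bound [2 m / L] is
   used. *)
pose kap := \sum_(0 <= t < m) (2 * L / (L ^+ 2 + ((t.*2.+1%:R - m%:R) * u) ^+ 2)) *+ 2.
have kapE : \sum_(0 <= t < m) \sum_(0 <= s < m) crn b s t + (kap%:C)%C%:A =
   \sum_(0 <= t < m) ((res b (grid m u m.*2 t.*2.+1) + (grid m u m.*2 t.*2.+1)^-1%:A) -
      (res b (grid m u 0 t.*2.+1) + (grid m u 0 t.*2.+1)^-1%:A)) +
   \sum_(0 <= s < m) 'i%C *: ((res b (grid m u s.*2.+1 m.*2) + (grid m u s.*2.+1 m.*2)^-1%:A) -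
      (res b (grid m u s.*2.+1 0) + (grid m u s.*2.+1 0)^-1%:A)).
  have gridr (q : nat) : grid m u m.*2 q = (L +i* ((q%:R - m%:R) * u))%C.
    by rewrite /grid -mul2n natrM mulr_natl mulr2n addrK mu.
  have gridl (q : nat) : grid m u 0 q = ((- L) +i* ((q%:R - m%:R) * u))%C.
    by rewrite /grid sub0r mulNr mu.
  have gridt (p : nat) : grid m u p m.*2 = (((p%:R - m%:R) * u) +i* L)%C.
    by rewrite /grid -mul2n natrM mulr_natl mulr2n addrK mu.
  have gridb (p : nat) : grid m u p 0 = (((p%:R - m%:R) * u) +i* (- L))%C.
    by rewrite /grid sub0r mulNr mu.
  rewrite /crn contour_outer /kap.
  have dist (F : lmodType C) (x y x' y' : F) : (x + x') - (y + y') = (x - y) + (x' - y').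
    by rewrite opprD addrACA.
  under [in RHS]eq_bigr do rewrite dist.
  under [X in _ = _ + X]eq_bigr do rewrite dist scalerDr.
  rewrite [X in _ = X + _]big_split [X in _ = _ + X]big_split/= [in RHS]addrACA; congr (_ + _).
  rewrite -big_split (rmorph_sum (real_complex R)) scaler_suml; apply: eq_bigr => t _.
  rewrite -!scalerBl scalerA /= -scalerDl; congr (_ *: _).
  by rewrite gridr gridl gridt gridb inv_pair_re// inv_pair_im// -(rmorphD (real_complex R)) -mulr2n.
have kap_ge : 2 * m%:R / L <= kap.
  have -> : 2 * m%:R / L = \sum_(0 <= t < m) (L^-1 *+ 2).
    by rewrite sumr_const_nat subn0; ring.
  apply: ler_sum_nat => t /= tm; rewrite ler_pMn2r//.
  have [h _] := sqcenter_le _ _ tm tm; move: h; rewrite /sqcenter /grid /=; set y := _ * u => yL.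
  have y2 : y ^+ 2 <= L ^+ 2 by rewrite -real_normK ?num_real// ler_sqr ?nnegrE// ltW.
  have L2 : 0 < L ^+ 2 by rewrite exprn_gt0.
  rewrite ler_pdivlMr ?ltr_pwDl ?sqr_ge0//.
  by rewrite ler_pdivrMl// mulrCA -expr2 mulr_natl mulr2n lerD2l.
pose dl := n *+ 2 * M / L ^+ 2.
have Nouter : N (\sum_(0 <= t < m) \sum_(0 <= s < m) crn b s t + (kap%:C)%C%:A) <= m%:R * (dl *+ 4).
  have Lg (p q : nat) : [|| p == 0%N, p == m.*2, q == 0%N | q == m.*2] -> N (res b (grid m u p q) + (grid m u p q)^-1%:A) <= dl.
    move=> h; apply: res_outer => //; rewrite /grid.
    have m2 : m.*2%:R - m%:R = m%:R :> R by rewrite -mul2n natrM mulr_natl mulr2n addrK.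
    case/or4P: h => /eqP ->; rewrite ?m2 ?sub0r ?mulNr mu.
    - by rewrite (le_trans _ (cabs_ge_Re _))//= normrN ger0_norm// ltW.
    - by rewrite (le_trans _ (cabs_ge_Re _))//= ger0_norm// ltW.
    - by rewrite (le_trans _ (cabs_ge_Im _))//= normrN ger0_norm// ltW.
    - by rewrite (le_trans _ (cabs_ge_Im _))//= ger0_norm// ltW.
  rewrite kapE (le_trans (bnD bnN _ _))//.
  have aux (H : nat -> E) D : (forall s, N (H s) <= D) -> N (\sum_(0 <= s < m) H s) <= m%:R * D.
    move=> HD; rewrite (le_trans (bn_sum bnN _ _ _))//.
    rewrite [leRHS](_ : _ = \sum_(0 <= s < m) D); last by rewrite sumr_const_nat subn0 mulr_natl.
    by apply: ler_sum => s _; exact: HD.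
  have -> : dl *+ 4 = dl *+ 2 + dl *+ 2 by rewrite -mulrnDr.
  rewrite [leRHS]mulrDr; apply: lerD; apply: (aux _ _) => t.
    by rewrite (le_trans (bnB bnN _ _))// mulr2n lerD// Lg// eqxx ?orbT.
  rewrite (le_trans (bnZ bnN _ _))// cabs_i mul1r (le_trans (bnB bnN _ _))// mulr2n lerD// Lg// eqxx ?orbT//.
have kap0 : 0 < kap by rewrite (lt_le_trans _ kap_ge)// divr_gt0// mulr_gt0.
have small : N (\sum_(e <- es) e.1 *: res a e.2) +
    N (\sum_(e <- es) e.1 *: res b e.2 + (kap%:C)%C%:A) <= kap / 2.
  rewrite betaE addrAC (le_trans (lerD (lexx _) (bnB bnN _ _)))//.
  rewrite (le_trans (lerD Nalpha (lerD Nouter Nbeta)))//.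
  rewrite (le_trans (y := m%:R / L))//; last first.
    by rewrite ler_pdivlMr// mulrC mulrA.
  have -> : m%:R * (dl *+ 4) = m%:R / L * ((n * M *+ 8) / L).
    by rewrite /dl; field; rewrite gt_eqF.
  have -> : m%:R ^+ 2 * w = m%:R / L * ((n * L ^+ 4 * K1 ^+ 4 *+ 8) / m%:R ^+ 2).
    by rewrite /w /u; field; rewrite !gt_eqF.
  have h1 : n * M *+ 8 / L <= 2^-1.
    by rewrite ler_pdivrMr// /L; move: (n * M) nM => v v0; lra.
  have v0 : 0 <= n * L ^+ 4 * K1 ^+ 4.
    by rewrite !mulr_ge0 ?exprn_ge0 ?(ltW L0) ?(ltW K10)// (le_trans ler01).
  have h2 : n * L ^+ 4 * K1 ^+ 4 *+ 8 / m%:R ^+ 2 <= 4^-1.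
    rewrite ler_pdivrMr ?exprn_gt0//.
    have mm : m%:R <= m%:R ^+ 2 :> R by rewrite expr2 ler_pMl// ler1n.
    have LK : 0 <= L * K1 by rewrite mulr_ge0 ?ltW.
    move: hm; rewrite /big; move: (n * L ^+ 4 * K1 ^+ 4) (L * K1) (m%:R ^+ 2) v0 mm LK => v z q; lra.
  have mL : 0 < m%:R / L by rewrite divr_gt0.
  move: h1 h2; move: (_ / L) (_ / _ ^+ 2) (m%:R / L) mL => x y z z0 h1 h2.
  by rewrite -!mulrDr ler_piMr ?(ltW z0)//; lra.
have coef e : e \in es -> cabs e.1 <= 1 by exact: contour_coef.
have B0 : 0 <= n *+ 2 * K1 by rewrite mulr_ge0 ?mulrn_wge0 ?(ltW K10) ?(le_trans ler01).
split; last exact: (sylvester_uniq bnN kap0 es_res small).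
move=> q; have [x [hx Nx]] := sylvester_solve bnN kap0 B0 es_res coef small q.
exists x; split => //; rewrite (le_trans Nx)// size_contour.
apply: ler_wpM2r; first exact: (bn_ge0 bnN).
apply: ler_wpM2r => //; apply: ler_wpM2r; first by rewrite mulr_ge0 ?exprn_ge0.
rewrite -[leRHS]invrK lef_pV2 ?posrE ?invr_gt0 ?divr_gt0// invf_div (le_trans _ kap_ge)//.
by rewrite -mulrA; apply: ler_peMl; [rewrite divr_ge0 ?(ltW L0)|rewrite ler1n].
Qed.

End SylvesterBound.

(** * Inverses and normal elements *)

(** Monotonicity in the bound turns the local hypothesis into one about all large integers [n] near
    each point, and compactness in its covering form makes [n] uniform. *)
Lemma square_bound {R : realType} (F : R[i] -> R -> Prop) (L : R) :
  (forall z K K', K <= K' -> F z K -> F z K') ->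
  (forall z, `|complex.Re z| <= L -> `|complex.Im z| <= L ->
     exists K e, 0 < e /\ forall z', cabs (z' - z) < e -> F z' K) ->
  exists K, forall z, `|complex.Re z| <= L -> `|complex.Im z| <= L -> F z K.
Proof.
move=> Fmono Floc.
have cpt : compact (`[- L, L] `*` `[- L, L] : set (R * R)).
  by apply: compact_setX; exact: segment_compact.
have inK (x : R) : (`[- L, L]%classic x) = (`|x| <= L).
  by rewrite /= in_itv /= ler_norml.
move/compact_near_coveringP : cpt => /(_ nat \oo (fun n z => F (z.1 +i* z.2)%C n%:R) _).
case=> [[x y] /= [hx hy]|n _ hn].
  have [||K [e [e0 he]]] := Floc (x +i* y)%C; rewrite /= ?ler_norml//.
  have e2 : 0 < e / 2 by rewrite divr_gt0.
  exists ([set z : R * R | `|z.1 - x| < e / 2 /\ `|z.2 - y| < e / 2],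
          [set n | (Num.bound `|K| <= n)%N]).
    split; last by exists (Num.bound `|K|).
    exists (ball x (e / 2), ball y (e / 2)); first by split; exact: nbhsx_ballx.
    by case=> z1 z2 /= []; rewrite -!ball_normE/= distrC => ?; rewrite distrC.
  case=> [[z1 z2] n] /= [[h1 h2] hn]; apply: (Fmono _ K).
    rewrite (le_trans (ler_norm _))// (le_trans (ltW (archi_boundP (normr_ge0 _))))//.
    by rewrite ler_nat.
  by apply: he; rewrite (le_lt_trans (cabs_ReIm _))//= [e]splitr ltrD.
exists n%:R => z hx hy.
have := hn n (leqnn n) (complex.Re z, complex.Im z).
case: z hx hy => x y /= hx hy; apply; split => /=; rewrite in_itv/= -ler_norml//.
Qed.

(** * Decay of powers under repeated squaring *)

Lemma expr_small {R : realType} (r C e : R) : 0 <= r -> r < 1 -> 0 < e ->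
  exists n, forall m, (n <= m)%N -> C * r ^+ m <= e.
Proof.
move=> r0 r1 e0; have nr : `|r| < 1 by rewrite ger0_norm.
have /cvgrPdist_le/(_ (e / (`|C| + 1))) := cvg_expr nr.
have C0 : 0 < `|C| + 1 by rewrite ltr_wpDl.
rewrite divr_gt0// => /(_ isT)[n _ hn]; exists n => m nm.
have := hn m nm; rewrite /= sub0r normrN ger0_norm ?exprn_ge0// ler_pdivlMr// mulrC.
apply: le_trans; rewrite ler_wpM2r ?exprn_ge0// (le_trans (ler_norm _))// lerDl//.
Qed.

(** Used for the norms of the powers [x ^ (2 ^ k)]. At stage [j + k] the free exponent [n] is set to
    [2 ^ k], so that both terms carry [tau ^ (2 ^ k)]; since each stage squares, the root of order
    [2 ^ k] of the bound loses a fixed factor every time. The final stage is the same for all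
    sequences [t], which later makes the bounds on inverses uniform. *)
Lemma doubling_decay {R : realType} (K D q tau M eta : R) :
  1 <= K -> 1 <= D -> 0 <= q -> q < 1 -> 0 < tau -> tau < 1 -> 0 < eta ->
  exists k, forall t : nat -> R, (forall k, 0 <= t k) -> t 0%N <= M ->
    (forall k n, t k.+1 <= K * t k * (D ^+ n * q ^+ (2 ^ k) + tau ^+ n * t k)) ->
    t k <= eta.
Proof.
move=> K1 D1 q0 q1 tau0 tau1 eta0.
have K0 : 0 <= K by rewrite (le_trans ler01).
(* With [tau = r ^ 4], half of the decay at each stage absorbs the constant [2 K] and the other half
   is kept. *)
pose r := Num.sqrt (Num.sqrt tau).
have r0 : 0 < r by rewrite !sqrtr_gt0.
have r4 : r ^+ 4 = tau by rewrite (exprM _ 2 2) !sqr_sqrtr ?sqrtr_ge0 ?(ltW tau0).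
have r1 : r < 1.
  rewrite ltNge; apply/negP => h; move: tau1; rewrite -r4 ltNge => /negP; apply.
  exact: exprn_ege1.
have pow2 n : (n <= 2 ^ n)%N by rewrite ltnW// ltn_expl.
have [j hj] := expr_small D q0 q1 tau0.
(* The exponent [n = 0] gives a crude bound, enough for the finitely many stages before the decay
   sets in. *)
pose b k := iter k (fun x => K * x * (1 + x)) (Num.max M 0).
have r2 : r ^+ 2 < 1 by rewrite expr_lt1// ltW.
have [k0 hk0] := expr_small (K *+ 2) (exprn_ge0 2 (ltW r0)) r2 ltr01.
pose A := Num.max 1 (b (j + k0)%N).
have A1 : 1 <= A by rewrite le_max lexx.
have [i1 hi1] := expr_small A (ltW r0) r1 ltr01.
have [k1 hk1] := expr_small 1 (ltW r0) r1 eta0.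
exists (j + (k0 + i1 + k1).+1)%N => t t0 tM tS.
have tb k : 0 <= b k /\ t k <= b k.
  elim: k => [|k [b0 IH]]; first by rewrite /b /= !le_max lexx orbT tM.
  have bS : b k.+1 = K * b k * (1 + b k) by [].
  rewrite bS; split; first by rewrite !mulr_ge0 ?addr_ge0.
  rewrite (le_trans (tS k 0%N))// !expr0 !mul1r -!mulrA; apply: ler_wpM2l => //.
  apply: ler_pM => //; first by rewrite addr_ge0// exprn_ge0.
  by rewrite lerD// exprn_ile1// ltW.
pose s k := t (j + k)%N; have s0 k : 0 <= s k by exact: t0.
have sS k : (k0 <= k)%N -> s k.+1 <= (r ^+ (2 ^ k) * Num.max 1 (s k)) ^+ 2.
  move=> kk; rewrite /s addnS (le_trans (tS _ (2 ^ k)%N))//; rewrite -/(s k).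
  have m1 : 1 <= Num.max 1 (s k) by rewrite le_max lexx.
  have m2 : s k <= Num.max 1 (s k) by rewrite le_max lexx orbT.
  set m := Num.max 1 (s k) in m1 m2 *.
  have m0 : 0 <= m by rewrite (le_trans ler01).
  have h1 : D ^+ (2 ^ k) * q ^+ (2 ^ (j + k)) <= tau ^+ (2 ^ k).
    rewrite expnD exprM -exprMn; apply: lerXn2r; rewrite ?nnegrE ?(ltW tau0) ?mulr_ge0 ?exprn_ge0 ?(le_trans ler01 D1)//.
    exact: hj.
  have T0 : 0 <= tau ^+ (2 ^ k) by rewrite exprn_ge0// ltW.
  rewrite (le_trans (y := K * m * (tau ^+ (2 ^ k) * m *+ 2)))//.
    apply: ler_pM; rewrite ?mulr_ge0 ?addr_ge0 ?mulr_ge0 ?exprn_ge0 ?(le_trans ler01 D1) ?(ltW tau0)//.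
      by rewrite ler_wpM2l.
    by rewrite mulr2n lerD ?ler_wpM2l// (le_trans h1)// ler_peMr.
  have -> : K * m * (tau ^+ (2 ^ k) * m *+ 2) =
      (K *+ 2 * (r ^+ 2) ^+ (2 ^ k)) * (r ^+ (2 ^ k) * m) ^+ 2.
    rewrite -r4; rewrite [(r ^+ 4) ^+ _]exprAC [(r ^+ 2) ^+ _]exprAC; move: (r ^+ _) => v.
    by ring.
  by rewrite ler_piMl ?exprn_ge0 ?mulr_ge0 ?exprn_ge0 ?(ltW r0)// hk0// (leq_trans kk).
(* Once [r ^ i A] is below [1] the sequence stays below [1], and one further stage leaves at most
   [r ^ (2 ^ k)]. *)
have claim i : s (k0 + i)%N <= Num.max 1 (r ^+ i * A) ^+ (2 ^ (k0 + i)).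
  elim: i => [|i IH].
    rewrite addn0 expr0 mul1r; have [_ h] := tb (j + k0)%N; rewrite (le_trans h)//.
    have -> : Num.max 1 A = A by apply/max_idPr.
    rewrite (le_trans (y := A)) ?le_max ?lexx ?orbT//.
    by rewrite -[leLHS]expr1 ler_weXn2l// expn_gt0.
  rewrite addnS (le_trans (sS _ (leq_addr _ _)))// expnS mulnC exprM.
  set n := (2 ^ _)%N; set w := Num.max 1 (r ^+ i * A) in IH.
  have w1 : 1 <= w by rewrite le_max lexx.
  have r0' := ltW r0.
  apply: lerXn2r; rewrite ?nnegrE ?mulr_ge0 ?exprn_ge0 ?le_max ?ler01//.
  rewrite (le_trans (y := (r * w) ^+ n))//.
    rewrite exprMn ler_wpM2l ?exprn_ge0// ge_max IH andbT exprn_ege1//.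
  apply: lerXn2r; rewrite ?nnegrE ?mulr_ge0 ?le_max ?ler01 ?(le_trans ler01 w1)//.
  rewrite /w maxr_pMr// mulr1 exprS -mulrA !ge_max lexx andbT (ltW r1)/=.
  by case: (leP (r * (r ^+ i * A)) 1) => //= h; rewrite (ltW (lt_trans r1 h)).
have s1 k : (k0 + i1 <= k)%N -> s k <= 1.
  move=> kk; have -> : k = (k0 + (k - k0))%N by move: kk; clear; lia.
  rewrite (le_trans (claim _))//.
  have -> : Num.max 1 (r ^+ (k - k0) * A) = 1.
    by apply/max_idPl; rewrite mulrC hi1//; move: kk; clear; lia.
  by rewrite expr1n.
rewrite -/(s _) (le_trans (sS _ _))//; first by clear; lia.
have -> : Num.max 1 (s (k0 + i1 + k1)%N) = 1.
  by apply/max_idPl; rewrite s1//; clear; lia.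
have := hk1 (2 ^ (k0 + i1 + k1))%N; rewrite mul1r mulr1 => h.
have n1 : (k1 <= 2 ^ (k0 + i1 + k1))%N by rewrite (leq_trans _ (pow2 _))// leq_addl.
rewrite (le_trans _ (h n1))// expr2 ler_piMl ?exprn_ge0 ?(ltW r0)//.
by rewrite exprn_ile1 ?(ltW r0) ?(ltW r1).
Qed.

Section Decay.
Context {R : realType} {E : algType R[i]} {N : E -> R} (bnN : banach_norm N).
Implicit Types (x y r : E).

Lemma inv_of_geometric r y n : inv_of (1 - r ^+ n) y ->
  inv_of (1 - r) ((\sum_(i < n) r ^+ i) * y).
Proof.
set S := \sum_(i < n) _ => hy.
have rS : GRing.comm r S by apply: commr_sum => i _; exact: commrX.
have e1 : (1 - r) * S = 1 - r ^+ n.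
  by rewrite -opprB mulNr -subrX1 opprB.
have yS : GRing.comm S y.
  apply: (inv_of_comm hy); apply: commrB; first exact: commr1.
  by apply: commrX; apply: commr_sym.
case: hy => h1 h2; split; first by rewrite mulrA e1.
have e2 : S * (1 - r) = (1 - r) * S by rewrite mulrBr mulrBl mul1r mulr1 rS.
by rewrite yS -mulrA e2 e1.
Qed.

(** Some power [r ^ (2 ^ k)], with [k] depending only on [q], [M] and the constants, has norm at
    most [1 / 2]. The Neumann series inverts [1] minus this power, which has [1 - r] as a factor. *)
Lemma decay_inv (P : E -> R) (K D tau : R) :
  1 <= K -> 1 <= D -> 0 < tau -> tau < 1 -> (forall x, 0 <= P x) ->
  (forall x y, P (x * y) <= P x * P y) ->
  (forall x n, N (x * x) <= K * N x * (D ^+ n * P x + tau ^+ n * N x)) ->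
  forall q M, 0 <= q -> q < 1 -> exists H, forall r, P r <= q -> N r <= M ->
    exists y, inv_of (1 - r) y /\ N y <= H.
Proof.
move=> K1 D1 t0 t1 P0 PM NP q M q0 q1.
have h2 : 0 < 2^-1 :> R by rewrite invr_gt0.
have [k hk] := doubling_decay M K1 D1 q0 q1 t0 t1 h2.
exists ((\sum_(i < 2 ^ k) N 1 * M ^+ i) * (N 1 *+ 2)) => r Pr Nr.
have M0 : 0 <= M by rewrite (le_trans (bn_ge0 bnN r)).
have pow2 j : r ^+ (2 ^ j.+1) = r ^+ (2 ^ j) * r ^+ (2 ^ j).
  by rewrite expnS mul2n -addnn exprD.
have Pj j : P (r ^+ (2 ^ j)) <= q ^+ (2 ^ j).
  elim: j => [|j IH]; first by rewrite expn0 !expr1.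
  by rewrite pow2 (le_trans (PM _ _))// expnS mul2n -addnn exprD ler_pM.
have : N (r ^+ (2 ^ k)) <= 2^-1.
  apply: (hk (fun j => N (r ^+ (2 ^ j)))) => [j||j n]; first exact: (bn_ge0 bnN).
    by rewrite expn0 expr1.
  rewrite pow2 (le_trans (NP _ n))// ler_wpM2l//.
    by rewrite mulr_ge0 ?(bn_ge0 bnN) ?(le_trans ler01).
  by rewrite lerD2r ler_wpM2l ?exprn_ge0 ?(le_trans ler01).
move/(neumann bnN) => [y [hy Ny]].
exists ((\sum_(i < 2 ^ k) r ^+ i) * y); split; first exact: inv_of_geometric.
rewrite (le_trans (bnM bnN _ _))//; apply: ler_pM; rewrite ?(bn_ge0 bnN)//.
rewrite (le_trans (bn_sum bnN _ _ _))//; apply: ler_sum => i _.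
case: (nat_of_ord i) => [|i']; first by rewrite !expr0 mulr1.
rewrite (le_trans (bnX bnN _ _))// (le_trans (y := M ^+ i'.+1))//.
  by apply: lerXn2r; rewrite ?nnegrE ?(bn_ge0 bnN).
by rewrite ler_peMl ?exprn_ge0// (bn1_ge1 bnN).
Qed.

End Decay.

(** * Normal elements and their resolvents *)

Section Normal.
Context {R : realType} {E : algType R[i]}.
Local Notation C := R[i].
Implicit Types (x y z r : E).

(** [P] stands for the norm of B(l^2) on the matrix algebra, which need not be complete for it.
    Inverses are therefore produced in the Banach norm and only estimated in [P]. *)
Record cstar_seminorm (P : E -> R) (star : E -> E) : Prop := CstarSeminorm {
  csD : forall x y, P (x + y) <= P x + P y;
  csZ : forall c x, P (c *: x) <= cabs c * P x;
  csM : forall x y, P (x * y) <= P x * P y;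
  cs1 : P 1 <= 1;
  csE : forall x, P (star x * x) = P x ^+ 2;
  starB : forall x y, star (x - y) = star x - star y;
  starZ : forall c x, star (c *: x) = conjc c *: star x;
  starM : forall x y, star (x * y) = star y * star x;
  starK : forall x, star (star x) = x }.

Context {P : E -> R} {star : E -> E} (csP : cstar_seminorm P star).

Lemma csN x : P (- x) = P x.
Proof.
have le y : P (- y) <= P y.
  by rewrite -scaleN1r (le_trans (csZ csP _ _))// cabsN cabs1 mul1r.
by apply/eqP; rewrite eq_le le/= -{1}(opprK x) le.
Qed.

Lemma cs_ge0 x : 0 <= P x.
Proof.
have h : P 0 <= 0 by rewrite -(scale0r 0) (le_trans (csZ csP _ _))// cabs0 mul0r.
have h0 : 0 <= P 0 by have := csD csP 0 0; rewrite addr0; move: (P 0) => w; lra.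
by have := csD csP x (- x); rewrite subrr csN; move: h0; move: (P 0) (P x) => v w; lra.
Qed.

Lemma csB x y : P (x - y) <= P x + P y.
Proof. by rewrite -(csN y) (csD csP). Qed.

Lemma csZE c x : P (c *: x) = cabs c * P x.
Proof.
have [->|c0] := eqVneq c 0.
  apply/eqP; rewrite eq_le (csZ csP) scale0r cabs0 mul0r/=; exact: cs_ge0.
apply/eqP; rewrite eq_le (csZ csP)/=.
have := csZ csP c^-1 (c *: x); rewrite scalerA mulVf// scale1r cabsV.
by rewrite ler_pdivlMl ?cabs_gt0// mulrC.
Qed.

Lemma star1 : star 1 = 1.
Proof.
by have := starM csP 1 (star 1); rewrite !mul1r (starK csP) mul1r => {1}->; rewrite (starK csP).
Qed.

Definition normal x := GRing.comm (star x) x.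

Lemma comm_scalar x (l : C) : GRing.comm x l%:A.
Proof. by rewrite /GRing.comm -scalerAl -scalerAr mulr1 mul1r. Qed.

Lemma normal_shift x l : normal x -> normal (x - l%:A).
Proof.
rewrite /normal => h; rewrite (starB csP) (starZ csP) star1.
apply: commrB; last exact: comm_scalar.
apply: commr_sym; apply: commrB; last exact: comm_scalar.
exact: commr_sym.
Qed.

Lemma inv_of_star x y : inv_of x y -> inv_of (star x) (star y).
Proof. by case=> h1 h2; split; rewrite -(starM csP) ?h1 ?h2 star1. Qed.

Lemma normal_inv x y : normal x -> inv_of x y -> normal y.
Proof.
move=> nx xy; rewrite /normal; apply: (inv_of_comm xy); apply: commr_sym.
by apply: (inv_of_comm (inv_of_star xy)); exact: commr_sym.
Qed.

Lemma normalM x : normal x -> normal (x * x).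
Proof.
rewrite /normal (starM csP) => h; apply: commrM; apply: commr_sym; apply: commrM;
  exact: commr_sym.
Qed.

(** Writing [x'] for [star x], the C-star identity used twice gives [|x x|^2 = |x' x' x x| = |x' x
    x' x| = |x' x|^2 = |x|^4]; normality enters in the second equality. *)
Lemma csM_normal x : normal x -> P (x * x) = P x ^+ 2.
Proof.
move=> nx; have : P (x * x) ^+ 2 = (P x ^+ 2) ^+ 2.
  rewrite -(csE csP (x * x)) (starM csP) -mulrA (mulrA (star x) x x) nx.
  rewrite -mulrA mulrA -(csE csP x) -(csE csP (star x * x)).
  by rewrite (starM csP) (starK csP).
by move/eqP; rewrite eqrXn2 ?exprn_ge0 ?cs_ge0// => /eqP.
Qed.

Lemma csX_normal x k : normal x -> P (x ^+ (2 ^ k)) = P x ^+ (2 ^ k).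
Proof.
move=> nx; have pow2 (F : nzRingType) (y : F) j : y ^+ (2 ^ j.+1) = y ^+ (2 ^ j) * y ^+ (2 ^ j).
  by rewrite expnS mul2n -addnn exprD.
have nk : normal (x ^+ (2 ^ k)).
  by elim: k => [|k IH]; [rewrite expn0 expr1|rewrite pow2; exact: normalM].
elim: k nk => [|k IH] nk; first by rewrite !expn0 !expr1.
suff nk' : normal (x ^+ (2 ^ k)) by rewrite !pow2 csM_normal// IH.
by elim: k {IH nk} => [|k IH]; [rewrite expn0 expr1|rewrite pow2; exact: normalM].
Qed.

Lemma inv_of_sqr x f g : inv_of (1 - x) f -> inv_of (1 + x) g ->
  inv_of (1 - x * x) (2^-1 *: (f + g)).
Proof.
move=> [f1 f2] [g1 g2].
have e1 : 1 - x * x = (1 + x) * (1 - x) by rewrite mulrBr mulr1 mulrDl mul1r opprD addrA addrK.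
have e2 : 1 - x * x = (1 - x) * (1 + x) by rewrite mulrDr mulr1 mulrBl mul1r addrA subrK.
have h2 : (2^-1 : C) *: ((1 + x) + (1 - x)) = 1.
  rewrite addrACA subrr addr0 (_ : 1 + 1 = (2 : C) *: (1 : E)); last by rewrite scaler_nat.
  by rewrite scalerA mulVf ?scale1r// pnatr_eq0.
split.
  by rewrite -scalerAr mulrDr {1}e1 e2 -mulrA f1 -mulrA g1 !mulr1 h2.
by rewrite -scalerAl mulrDl {1}e2 e1 mulrA f2 mulrA g2 !mul1r h2.
Qed.

(* Averaging the inverses of [1 - x] and [1 + x] gives that of [1 - x ^ 2]: the bound on the
   difference of the inverses at the radii [a] and [b] survives all squarings, whereas the
   radii move to 0 and infinity relative to the norm of the powers. *)
Lemma normal_radius y (rho K : R) : 0 < rho -> normal y ->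
  (forall l, cabs l <= rho -> exists f, inv_of (1 - l *: y) f /\ P f <= K) ->
  P y * rho <= 1.
Proof.
move=> rho0 ny hK; rewrite leNgt; apply/negP => h.
set p := P y in h; have p0 : 0 < p by rewrite -(pmulr_lgt0 _ rho0) (lt_trans ltr01).
(* The three bounds keep the outer radius within [rho], the inner radius positive, and the inverses
   at the two radii within [1 / 4] of each other. *)
pose d := Num.min (rho - p^-1) (Num.min ((p *+ 2)^-1) (((K ^+ 2 + 1) * p *+ 8)^-1)).
have K2 : 0 < K ^+ 2 + 1 by rewrite ltr_wpDl// sqr_ge0.
have d0 : 0 < d.
  rewrite !lt_min subr_gt0 !invr_gt0 !pmulrn_lgt0// p0 mulr_gt0// !andbT.
  by rewrite -(ltr_pM2l p0) divff ?gt_eqF.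
pose a := p^-1 - d; pose b := p^-1 + d.
have a0 : 0 < a.
  rewrite subr_gt0 (@le_lt_trans _ _ ((p *+ 2)^-1))//; first by rewrite !ge_min lexx orbT.
  by rewrite ltf_pV2 ?posrE ?pmulrn_lgt0// mulr2n ltrDl.
have b0 : 0 < b by rewrite addr_gt0// invr_gt0.
have brho : b <= rho by rewrite -lerBrDl ge_min lexx.
have ab : a <= b by rewrite lerD2l (le_trans _ (ltW d0))// oppr_le0 ltW.
have bap : K ^+ 2 * ((b - a) * p) <= 4^-1.
  have dd : d <= ((K ^+ 2 + 1) * p *+ 8)^-1 by rewrite !ge_min lexx !orbT.
  have -> : b - a = d *+ 2 by rewrite /a /b; ring.
  have q0 : 0 < (K ^+ 2 + 1) * p *+ 8 by rewrite pmulrn_lgt0// mulr_gt0.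
  move: dd; rewrite -(ler_pM2r q0) mulVf ?gt_eqF//.
  have : 0 <= d * p by rewrite mulr_ge0 ?ltW.
  have -> : d * ((K ^+ 2 + 1) * p *+ 8) = (K ^+ 2 + 1) * (d * p) *+ 8 by ring.
  have -> : K ^+ 2 * (d *+ 2 * p) = K ^+ 2 * (d * p) *+ 2 by ring.
  by move: (d * p) (K ^+ 2) => w v; lra.
have claim k mu : cabs mu = 1 -> exists f g,
    [/\ inv_of (1 - (mu * (b%:C)%C ^+ (2 ^ k)) *: y ^+ (2 ^ k)) f,
        inv_of (1 - (mu * (a%:C)%C ^+ (2 ^ k)) *: y ^+ (2 ^ k)) g & P (f - g) <= 4^-1].
  elim: k mu => [|k IH] mu mu1.
    rewrite expn0 !expr1.
    have [|f [hf Pf]] := hK (mu * (b%:C)%C).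
      by rewrite cabsM mu1 mul1r cabs_real gtr0_norm.
    have [|g [hg Pg]] := hK (mu * (a%:C)%C).
      by rewrite cabsM mu1 mul1r cabs_real gtr0_norm// (le_trans ab).
    exists f, g; split=> //.
    have -> : f - g = f * ((mu * ((b - a)%:C)%C) *: y) * g.
      have -> : (mu * ((b - a)%:C)%C) *: y =
          (1 - (mu * (a%:C)%C) *: y) - (1 - (mu * (b%:C)%C) *: y).
        rewrite [in RHS]opprB [RHS]addrC [RHS]addrA subrK -scalerBl; congr (_ *: _).
        by rewrite -mulrBr (rmorphB (real_complex R)).
      rewrite mulrBr mulrBl (proj2 hf) mul1r -mulrA (proj1 hg) mulr1//.
    rewrite (le_trans (csM csP _ _))// (le_trans (y := K * ((b - a) * p) * K))//; last first.
      by rewrite mulrAC -expr2.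
    apply: ler_pM; rewrite ?cs_ge0// (le_trans (csM csP _ _))//.
    apply: ler_pM; rewrite ?cs_ge0// (le_trans (csZ csP _ _))//.
    by rewrite cabsM mu1 mul1r cabs_real ger0_norm// subr_ge0.
  have [nu nu2] : exists nu : C, nu ^+ 2 = mu by exists (sqrtc mu); rewrite sqr_sqrtc.
  have nu1 : cabs nu = 1.
    apply/eqP; rewrite -(@eqrXn2 _ 2)// ?cabs_ge0// -cabsX nu2 mu1 expr1n//.
  have [f1 [g1 [hf1 hg1 d1]]] := IH nu nu1.
  have [f2 [g2 [hf2 hg2 d2]]] := IH (- nu) (etrans (cabsN nu) nu1).
  exists (2^-1 *: (f1 + f2)), (2^-1 *: (g1 + g2)); split.
  - rewrite expnS mul2n -addnn !exprD -nu2 expr2 mulrACA -scalerAl.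
    rewrite -[X in inv_of (1 - X)](_ : (nu * b%:C%C ^+ (2 ^ k)) *: y ^+ (2 ^ k) *
       ((nu * b%:C%C ^+ (2 ^ k)) *: y ^+ (2 ^ k)) = _); last first.
      by rewrite -scalerAl -scalerAr scalerA scalerAl.
    by apply: (inv_of_sqr hf1); move: hf2; rewrite !mulNr scaleNr opprK.
  - rewrite expnS mul2n -addnn !exprD -nu2 expr2 mulrACA -scalerAl.
    rewrite -[X in inv_of (1 - X)](_ : (nu * a%:C%C ^+ (2 ^ k)) *: y ^+ (2 ^ k) *
       ((nu * a%:C%C ^+ (2 ^ k)) *: y ^+ (2 ^ k)) = _); last first.
      by rewrite -scalerAl -scalerAr scalerA scalerAl.
    by apply: (inv_of_sqr hg1); move: hg2; rewrite !mulNr scaleNr opprK.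
  rewrite -scalerBr opprD addrACA (le_trans (csZ csP _ _))// cabsV.
  have -> : cabs (2 : C) = 2.
    by rewrite -[2 : C](rmorph_nat (real_complex R) 2) cabs_real ger0_norm.
  rewrite ler_pdivrMl// (le_trans (csD csP _ _))//.
  by move: d1 d2; move: (P _) (P _) => v w; lra.
have aux1 (s t : R) : t <= 1 + s -> s <= 5^-1 * t -> s <= 4^-1 by lra.
have aux2 (s t : R) : t <= 4^-1 + s -> s <= 4^-1 -> t <= 2^-1 by lra.
have aux3 (s t : R) : 1 < s -> s <= t -> t <= (1 + s) * 2^-1 -> False by lra.
have ap : a * p < 1 by rewrite -ltr_pdivlMr// div1r ltrBlDr ltrDl.
have bp : 1 < b * p by rewrite -ltr_pdivrMr// div1r ltrDl.
have ap0 : 0 <= a * p by rewrite mulr_ge0 ?ltW.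
have h5 : 0 < 5^-1 :> R by rewrite invr_gt0.
have [n hn] := expr_small 1 ap0 ap h5.
have nn : (n <= 2 ^ n)%N by rewrite ltnW// ltn_expl.
have [f [g [hf hg dfg]]] := claim n 1 cabs1.
move: (hn _ nn); rewrite mul1r => {hn}hn.
move: hf hg; rewrite !mul1r; set w := y ^+ (2 ^ n).
have Pw : P w = p ^+ (2 ^ n) by exact: csX_normal.
set z := _ *: w => -[hf1 hf2]; set v := _ *: w => -[hg1 hg2].
(* At this stage the inner power [v] is small, so [g] is near [1] and [f] lies within [1 / 2] of
   [1]. But [f] inverts [1 - z] with [P z > 1], and [z = (1 - z) (f - 1)] yields
   [P z <= (1 + P z) / 2], a contradiction. *)
have Pv : P v <= 5^-1.
  by rewrite csZE Pw cabsX cabs_real gtr0_norm// -exprMn.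
have Pz : 1 < P z.
  by rewrite csZE Pw cabsX cabs_real gtr0_norm// -exprMn exprn_egt1// -lt0n expn_gt0.
have gE : g = 1 + v * g by move: hg1; rewrite mulrBl mul1r => /(canRL (subrK _)).
have Pg : P g <= 1 + P v * P g.
  by rewrite {1}gE (le_trans (csD csP _ _))// lerD ?(cs1 csP)// (csM csP).
have Pg1 : P (g - 1) <= P v * P g.
  by rewrite {1}gE addrAC subrr add0r (csM csP).
have Pf1 : P (f - 1) <= 4^-1 + P v * P g.
  have -> : f - 1 = (f - g) + (g - 1) by rewrite addrA subrK.
  by rewrite (le_trans (csD csP _ _))// lerD.
have vg : P v * P g <= 4^-1.
  have g0 := cs_ge0 g; have : P v * P g <= 5^-1 * P g by rewrite ler_wpM2r.
  exact: aux1 Pg.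
pose e := 1 - z; have zE : z = e * (f - 1).
  by rewrite mulrBr mulr1 hf1 /e opprB addrC subrK.
have Pe : P e <= 1 + P z by rewrite (le_trans (csB _ _))// lerD2r (cs1 csP).
have : P z <= P e * P (f - 1) by rewrite {1}zE (csM csP).
have : P e * P (f - 1) <= (1 + P z) * 2^-1.
  apply: ler_pM; rewrite ?cs_ge0//.
  exact: aux2 Pf1 vg.
by move=> ub lb; exact: aux3 Pz lb ub.
Qed.

(* Compactness of the disc makes the resolvents of a normal element uniformly bounded inside
   the spectrum-free disc, and [normal_radius] then upgrades this to the sharp bound. *)
Lemma normal_resolvent (N : E -> R) (K0 : R) x l (delta : R) :
  banach_norm N -> 0 <= K0 -> (forall z, P z <= K0 * N z) -> normal x -> 0 < delta ->
  (forall mu, cabs (mu - l) < delta -> exists y, inv_of (x - mu%:A) y) ->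
  exists y, inv_of (x - l%:A) y /\ P y <= delta^-1.
Proof.
move=> bnN K00 PN nx d0 hinv.
have [|y hy] := hinv l; first by rewrite subrr cabs0.
exists y; split => //.
have ny : normal y by apply: normal_inv hy; exact: normal_shift.
rewrite leNgt; apply/negP => dP; set p := P y in dP.
have p0 : 0 < p by rewrite (lt_trans _ dP)// invr_gt0.
have pd : p^-1 < delta by rewrite -[delta]invrK ltf_pV2 ?posrE ?invr_gt0.
pose rho := (p^-1 + delta) / 2.
have p10 : 0 < p^-1 by rewrite invr_gt0.
have rho0 : 0 < rho by rewrite /rho; lra.
have rd : rho < delta by rewrite /rho; lra.
have rp : p^-1 < rho by rewrite /rho; lra.
have [||K hK] := @square_bound R (fun (z : C) (K : R) => cabs z <= rho ->
   exists f, inv_of (1 - z *: y) f /\ P f <= K) rho.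
- move=> z K1 K2 KK h /h[f [hf Pf]]; exists f; split => //; exact: le_trans KK.
(* The square sticks out of the disc; near its points at distance at least [delta] from the center
   the requirement is void. *)
- move=> z _ _; have [zd|zd] := ltP (cabs z) delta; last first.
    exists 0, (delta - rho); split; first by rewrite subr_gt0.
    move=> z' h1 h2; exfalso; have := cabsD (z - z') z'; rewrite subrK cabsB.
    by move: (cabs (z' - z)) (cabs z') (cabs z) zd h1 h2 => u v w; lra.
  have [|f0 hf0] := hinv (l + z); first by rewrite addrAC subrr add0r.
  have shift : x - (l + z)%:A = (x - l%:A) * (1 - z *: y).
    by rewrite mulrBr mulr1 -scalerAr (proj1 hy) scalerDl opprD addrA.
  have [f hf] : exists f, inv_of (1 - z *: y) f.
    exists (f0 * (x - l%:A)); have -> : 1 - z *: y = y * (x - (l + z)%:A).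
      by rewrite shift mulrA (proj2 hy) mul1r.
    by apply: inv_ofM hf0; exact: inv_ofC.
  have e0 : 0 < (N f * N y + 1)^-1 / 2.
    by rewrite divr_gt0// invr_gt0 ltr_wpDl// mulr_ge0 ?(bn_ge0 bnN).
  exists (K0 * (N 1 *+ 2 * N f)), ((N f * N y + 1)^-1 / 2); split => // z' hz' _.
  have [|g [hg Ng]] := @neumann _ _ _ bnN ((z' - z) *: (f * y)).
    rewrite (le_trans (bnZ bnN _ _))//.
    have fy : N (f * y) <= N f * N y + 1 by rewrite (le_trans (bnM bnN _ _))// lerDl.
    rewrite (le_trans (ler_pM (cabs_ge0 _) (bn_ge0 bnN _) (ltW hz') fy))//.
    by rewrite mulrAC mulVf ?mul1r// gt_eqF// ltr_wpDl// mulr_ge0 ?(bn_ge0 bnN).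
  exists (g * f); split.
    have -> : 1 - z' *: y = (1 - z *: y) * (1 - (z' - z) *: (f * y)).
      rewrite mulrBr mulr1 -scalerAr mulrA (proj1 hf) mul1r scalerBl opprB.
      by rewrite addrA subrK.
    exact: inv_ofM.
  rewrite (le_trans (PN _))// ler_wpM2l// (le_trans (bnM bnN _ _))//.
  by rewrite ler_wpM2r// (bn_ge0 bnN).
have := @normal_radius y rho K rho0 ny.
move=> h; have {h} : p * rho <= 1.
  apply: h => z hz; apply: hK => //.
    exact: le_trans (cabs_ge_Re _) hz.
  exact: le_trans (cabs_ge_Im _) hz.
by rewrite leNgt => /negP; apply; rewrite -ltr_pdivrMl// mulr1.
Qed.

End Normal.

(** * Families of l^p-norm at most M *)

Section FiniteSums.
Context {R : realType} {T : choiceType}.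
Implicit Types (f g : T -> R) (F : {fset T}).

Lemma fsum_ge0 f F : (forall k, 0 <= f k) -> 0 <= \sum_(k <- F) f k.
Proof. by move=> f0; apply: sumr_ge0. Qed.

Lemma fsum_sub f F F' : (forall k, 0 <= f k) -> (F `<=` F')%fset ->
  \sum_(k <- F) f k <= \sum_(k <- F') f k.
Proof.
move=> f0 sub; rewrite [leRHS](big_fsetID _ (mem F))/=.
have -> : [fset x | x in F' & x \in F]%fset = F.
  by apply/fsetP => x; rewrite !inE/=; case: (boolP (x \in F)) => h; rewrite ?andbF// (fsubsetP sub).
by rewrite lerDl; apply: sumr_ge0.
Qed.

Lemma fsum1 f k : \sum_(i <- [fset k]%fset) f i = f k.
Proof. by rewrite big_seq_fset1. Qed.

Definition sum_le f (B : R) := forall F, \sum_(k <- F) f k <= B.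

Lemma sum_le_entry f B k : sum_le f B -> f k <= B.
Proof. by move/(_ [fset k]%fset); rewrite fsum1. Qed.

Lemma sum_le_mono f g B : (forall k, f k <= g k) -> sum_le g B -> sum_le f B.
Proof. by move=> fg gB F; rewrite (le_trans _ (gB F))// ler_sum. Qed.

Lemma sum_leD f g A B : sum_le f A -> sum_le g B -> sum_le (fun k => f k + g k) (A + B).
Proof. by move=> fA gB F; rewrite big_split/= lerD. Qed.

Lemma sum_leZ c f B : 0 <= c -> sum_le f B -> sum_le (fun k => c * f k) (c * B).
Proof. by move=> c0 fB F; rewrite -mulr_sumr ler_wpM2l. Qed.

(* Vacuous when the nonnegative family [f] is not summable. *)
Definition below_sum (x : R) f := forall B, sum_le f B -> x <= B.

Lemma below_sum_approx x f t : 0 <= x -> (forall k, 0 <= f k) -> 0 < t -> t < 1 ->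
  below_sum x f -> exists F, t * x <= \sum_(k <- F) f k.
Proof.
move=> x0 f0 t0 t1 h; apply: contrapT => /forallNP H.
have : x <= t * x by apply: h => F; apply: ltW; rewrite ltNge; apply/negP; exact: H.
move: x0; rewrite le_eqVlt => /predU1P[x0|x0]; last first.
  by rewrite -[leLHS]mul1r ler_pM2r// leNgt t1.
by move=> _; apply: (H fset0); rewrite -x0 mulr0 big_seq_fset0.
Qed.

End FiniteSums.

Lemma sum_le_inj {R : realType} (T T' : choiceType) (e : T' -> T) (f : T -> R) B : injective e ->
  sum_le f B -> sum_le (fun k => f (e k)) B.
Proof.
move=> ie fB F; rewrite (le_trans _ (fB (e @` F)%fset))// big_imfset//=.
by move=> x y _ _ /ie.
Qed.

Lemma powR_mono {R : realType} (x y r : R) : 0 <= r -> 0 <= x -> x <= y -> x `^ r <= y `^ r.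
Proof.
by move=> r0 x0 xy; apply: ge0_ler_powR; rewrite ?nnegrE// (le_trans x0).
Qed.

Section LpBound.
Context {R : realType} (p : \bar R).
Hypothesis p1 : (1 <= p)%E.

(** A bound on all finite subfamilies makes sense before summability is known and passes to limits
    without any integral. *)
Definition lp_le {T : choiceType} (f : T -> R) (M : R) : Prop := 0 <= M /\
  if p is r%:E then sum_le (fun k => f k `^ r) (M `^ r) else forall k, f k <= M.

Lemma lpP (P : Prop) : (forall r, p = r%:E -> 1 <= r -> P) -> (p = +oo%E -> P) -> P.
Proof. by case: p p1 => [r r1 h _|_ _ h|//]; [exact: (h r)|exact: h]. Qed.

(** Young's inequality at [m], the weighted sum divided by [s]:
    [f m ^ (r - 1) <= f ^ r / r + m ^ r / q] is summed with the weights [c], and the terms in [m]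
    are collected using [1 - 1 / q = 1 / r]. *)
Lemma jensen_powR (T : choiceType) (F : {fset T}) (c f : T -> R) (s r : R) : 1 <= r -> 0 < s ->
  (forall k, 0 <= c k) -> (forall k, 0 <= f k) -> \sum_(k <- F) c k <= s ->
  s * ((\sum_(k <- F) c k * f k) / s) `^ r <= \sum_(k <- F) c k * f k `^ r.
Proof.
move=> r1 s0 c0 f0 cs; have r0 : 0 < r by rewrite (lt_le_trans ltr01).
have cf0 : 0 <= \sum_(k <- F) c k * f k by apply: fsum_ge0 => k; rewrite mulr_ge0.
set m := _ / s; have m0 : 0 <= m by rewrite divr_ge0// ltW.
have sm : \sum_(k <- F) c k * f k = s * m by rewrite mulrC divfK// gt_eqF.
have [<-|r1'] := eqVneq 1 r.
  by rewrite powRr1// -sm; apply: ler_sum => k _; rewrite powRr1.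
have r11 : 0 < r - 1 by rewrite subr_gt0 lt_neqAle r1' r1.
pose q := r / (r - 1); have q0 : 0 < q by rewrite divr_gt0.
have rq : r^-1 + q^-1 = 1 by rewrite /q invf_div; field; rewrite gt_eqF.
have mq : (m `^ (r - 1)) `^ q = m `^ r by rewrite -powRrM /q mulrC divfK// gt_eqF.
have young k : f k * m `^ (r - 1) <= f k `^ r / r + m `^ r / q.
  by rewrite -mq; apply: conjugate_powR => //; exact: powR_ge0.
have : \sum_(k <- F) c k * (f k * m `^ (r - 1)) <=
       \sum_(k <- F) c k * (f k `^ r / r + m `^ r / q).
  by apply: ler_sum => k _; rewrite ler_wpM2l.
have -> : \sum_(k <- F) c k * (f k * m `^ (r - 1)) = s * m `^ r.
  under eq_bigr do rewrite mulrA.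
  by rewrite -mulr_suml sm -mulrA mulr_powRB1.
have -> : \sum_(k <- F) c k * (f k `^ r / r + m `^ r / q) =
   (\sum_(k <- F) c k * f k `^ r) / r + (\sum_(k <- F) c k) * (m `^ r / q).
  by rewrite !mulr_suml -big_split/=; apply: eq_bigr => k _; rewrite mulrDr mulrA.
move=> h; have : s * m `^ r <= (\sum_(k <- F) c k * f k `^ r) / r + s * (m `^ r / q).
  by rewrite (le_trans h)// lerD2l ler_wpM2r// divr_ge0 ?powR_ge0// ltW.
have -> : q^-1 = 1 - r^-1 by rewrite -rq addrAC subrr add0r.
rewrite mulrBr mulr1 mulrBr addrCA lerDl subr_ge0 mulrA ler_pM2r ?invr_gt0//.
Qed.

Section OneIndex.
Context {T : choiceType}.
Implicit Types (f g : T -> R) (M : R).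

Lemma lp_ge0 f M : lp_le f M -> 0 <= M. Proof. by case. Qed.

Lemma lp_mono f g M : (forall k, 0 <= f k <= g k) -> lp_le g M -> lp_le f M.
Proof.
move=> fg [M0 gM]; split=> //; move: gM; apply: lpP => [r -> r1|->] h; last first.
  by move=> k; rewrite (le_trans _ (h k))//; case/andP: (fg k).
apply: sum_le_mono h => k; have /andP[f0 fgk] := fg k.
by apply: powR_mono => //; exact: le_trans r1.
Qed.

Lemma lp_weak f M M' : M <= M' -> lp_le f M -> lp_le f M'.
Proof.
move=> MM [M0 fM]; have M0' := le_trans M0 MM; split=> //.
move: fM; apply: lpP => [r -> r1|->] h k; last exact: le_trans MM.
by rewrite (le_trans (h k))//; apply: powR_mono => //; exact: le_trans r1.
Qed.

Lemma lp_entry f M k : (forall k, 0 <= f k) -> lp_le f M -> f k <= M.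
Proof.
move=> f0 [M0]; apply: lpP => [r -> r1|-> //] /sum_le_entry h.
have r0 : 0 < r by rewrite (lt_le_trans ltr01).
rewrite leNgt; apply/negP => /(gt0_ltr_powR r0); rewrite !nnegrE => /(_ M0 (f0 _)).
by rewrite ltNge h.
Qed.

Lemma lpZ c f M : 0 <= c -> (forall k, 0 <= f k) -> lp_le f M -> lp_le (fun k => c * f k) (c * M).
Proof.
move=> c0 f0 [M0 fM]; split; first by rewrite mulr_ge0.
move: fM; apply: lpP => [r -> r1|->] h; last by move=> k; rewrite ler_wpM2l.
move=> F; under eq_bigr do rewrite powRM//.
by rewrite powRM// -mulr_sumr ler_wpM2l ?powR_ge0.
Qed.

Lemma lp_inj (T' : choiceType) (e : T' -> T) f M : injective e ->
  lp_le f M -> lp_le (fun k => f (e k)) M.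
Proof.
move=> ie [M0 fM]; split=> //; move: fM; apply: lpP => [r -> r1|->] h; last by [].
exact: (sum_le_inj ie h).
Qed.

Lemma lp0 : lp_le (fun _ : T => 0) 0.
Proof.
split=> //; apply: lpP => [r -> r1|-> //] F.
rewrite powR0 ?gt_eqF ?(lt_le_trans ltr01)//.
by rewrite big1.
Qed.

Lemma lp_delta k0 : lp_le (fun k : T => (k == k0)%:R) 1.
Proof.
split=> //; apply: lpP => [r -> r1|->]; last by move=> k; case: eqP.
have r0 : r != 0 by rewrite gt_eqF// (lt_le_trans ltr01).
move=> F; rewrite powR1.
have E k : ((k == k0)%:R : R) `^ r = (k == k0)%:R.
  by case: eqP; rewrite ?powR1 ?powR0.
under eq_bigr do rewrite E.
have [kF|kF] := boolP (k0 \in F); last first.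
  by rewrite big_seq big1// => k kF'; case: eqP => // h; rewrite -h kF' in kF.
rewrite (big_fsetD1 k0)//= eqxx big_seq big1 ?addr0// => k.
by rewrite !inE => /andP[/negPf ->].
Qed.

Lemma powR_root (S M r : R) : 1 <= r -> 0 <= S -> 0 <= M ->
  (S <= M `^ r) = (S `^ r^-1 <= M).
Proof.
move=> r1 S0 M0; have r0 : 0 < r by rewrite (lt_le_trans ltr01).
have Sr : S = (S `^ r^-1) `^ r by rewrite -powRrM mulVf ?gt_eqF// powRr1.
rewrite {1}Sr; apply/idP/idP => [|h]; last first.
  by apply: powR_mono; rewrite ?powR_ge0// ltW.
apply: contraTT; rewrite -!ltNge => h.
by apply: (gt0_ltr_powR r0); rewrite ?nnegrE ?powR_ge0.
Qed.

Lemma lp_closed f M : 0 <= M -> (forall k, 0 <= f k) ->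
  (forall e, 0 < e -> lp_le f (M + e)) -> lp_le f M.
Proof.
move=> M0 f0 h; split=> //; move: h; apply: lpP => [r pr r1|pr] h; rewrite pr.
  move=> F; rewrite powR_root ?fsum_ge0// => [|k]; last exact: powR_ge0.
  apply/ler_addgt0Pl => e e0; rewrite addrC -powR_root ?fsum_ge0// => [|k|].
  - by have [_] := h e e0; rewrite pr; exact.
  - exact: powR_ge0.
  - by rewrite addr_ge0// ltW.
by move=> k; apply/ler_addgt0Pl => e e0; have [_] := h e e0; rewrite pr addrC.
Qed.

Lemma lp_closedZ f M : 0 <= M -> (forall k, 0 <= f k) ->
  (forall t, 0 < t -> t < 1 -> lp_le (fun k => t * f k) M) -> lp_le f M.
Proof.
move=> M0 f0 h; apply: lp_closed => // e e0.
pose t := (M + 1) / (M + 1 + e).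
have M1 : 0 < M + 1 by rewrite ltr_wpDl.
have M1e : 0 < M + 1 + e by rewrite addr_gt0.
have t0 : 0 < t by rewrite divr_gt0.
have t1 : t < 1 by rewrite ltr_pdivrMr// mul1r ltrDl.
have -> : f = (fun k => t^-1 * (t * f k)) by apply/funext => k; rewrite mulKf ?gt_eqF.
apply: (@lp_weak _ (t^-1 * M)).
  rewrite invf_div mulrAC ler_pdivrMr//.
  have -> : (M + e) * (M + 1) = (M + 1 + e) * M + e by ring.
  by rewrite lerDl ltW.
apply: lpZ (h t t0 t1); first by rewrite invr_ge0 ltW.
by move=> k; rewrite mulr_ge0// ltW.
Qed.

End OneIndex.

Section TwoIndices.
Context {I T : choiceType}.

(** A finite set of indices [k] is served by one finite set of indices [i], up to a factor [t < 1]
    which [lp_closedZ] removes. *)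
Lemma lp_fatou (g : I -> T -> R) (f : T -> R) M :
  (forall i k, 0 <= g i k) -> (forall k, 0 <= f k) ->
  (forall F : {fset I}, lp_le (fun k => \sum_(i <- F) g i k) M) ->
  (forall k, below_sum (f k) (fun i => g i k)) -> lp_le f M.
Proof.
move=> g0 f0 gM fg; have M0 : 0 <= M by have /lp_ge0 := gM fset0.
apply: lp_closedZ => // t t0 t1; split=> //; move: gM; apply: lpP => [r pr r1|pr] h; rewrite pr.
  move=> J; have [F hF] : exists F : {fset I}, forall k, k \in J -> t * f k <= \sum_(i <- F) g i k.
    have : forall s : seq T, exists F : {fset I}, forall k, k \in s -> t * f k <= \sum_(i <- F) g i k.
      elim=> [|k s [F hF]]; first by exists fset0.
      have [F' hF'] := below_sum_approx (f0 k) (fun i => g0 i k) t0 t1 (fg k).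
      exists (F `|` F')%fset => k'; rewrite inE => /predU1P[->|/hF h'].
        by rewrite (le_trans hF')// fsum_sub// fsubsetUr.
      by rewrite (le_trans h')// fsum_sub// fsubsetUl.
    exact.
  have [_] := h F; rewrite pr => /(_ J); apply: le_trans.
  rewrite big_seq [leRHS]big_seq; apply: ler_sum => k kJ.
  have tf : 0 <= t * f k by rewrite mulr_ge0// ltW.
  by apply: powR_mono => //; [rewrite (le_trans ler01)|exact: hF].
move=> k; rewrite (le_trans (y := f k))//; first by rewrite ler_piMl// ltW.
by apply: (fg k) => F; have [_] := h F; rewrite pr; exact.
Qed.

(** Schur's test. Jensen's inequality uses the bound on the sums over [i]; after exchanging the
    sums, the bound on those over [k] finishes. *)
Lemma lp_schur (F : {fset I}) (c : I -> T -> R) (f : I -> R) (s M : R) : 0 <= s ->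
  (forall i k, 0 <= c i k) -> (forall i, 0 <= f i) ->
  (forall k, \sum_(i <- F) c i k <= s) -> (forall i, sum_le (c i) s) ->
  lp_le f M -> lp_le (fun k => \sum_(i <- F) c i k * f i) (s * M).
Proof.
move=> s0 c0 f0 cs1 cs2 [M0 fM].
move: s0; rewrite le_eqVlt => /predU1P[s0|s0].
  rewrite -s0 mul0r; apply: lp_mono lp0 => k; rewrite big_seq big1 ?lexx// => i iF.
  suff -> : c i k = 0 by rewrite mul0r.
  by apply/eqP; rewrite eq_le c0 andbT s0 (sum_le_entry k (cs2 i)).
split; first by rewrite mulr_ge0// ltW.
move: fM; apply: lpP => [r pr r1|pr]; rewrite pr => fM; last first.
  move=> k; rewrite (le_trans (y := \sum_(i <- F) c i k * M))//.
    by apply: ler_sum => i _; rewrite ler_wpM2l.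
  by rewrite -mulr_suml ler_wpM2r.
move=> J; have r0 : 0 < r by rewrite (lt_le_trans ltr01).
have : \sum_(k <- J) s * ((\sum_(i <- F) c i k * f i) / s) `^ r <= s * M `^ r.
  rewrite (le_trans (y := \sum_(k <- J) \sum_(i <- F) c i k * f i `^ r))//.
    by apply: ler_sum => k _; apply: jensen_powR.
  rewrite exchange_big/= (le_trans (y := \sum_(i <- F) s * f i `^ r))//.
    by apply: ler_sum => i _; rewrite -mulr_suml ler_wpM2r ?powR_ge0// cs2.
  by rewrite -mulr_sumr ler_wpM2l ?(ltW s0)// fM.
rewrite -mulr_sumr ler_pM2l// => h.
have E k : (\sum_(i <- F) c i k * f i) `^ r =
    s `^ r * ((\sum_(i <- F) c i k * f i) / s) `^ r.
  rewrite -powRM ?(ltW s0) ?divr_ge0 ?(ltW s0) ?fsum_ge0// => [|i]; last by rewrite mulr_ge0.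
  by rewrite mulrC divfK// gt_eqF.
under eq_bigr do rewrite E.
by rewrite -mulr_sumr powRM ?(ltW s0)// ler_wpM2l ?powR_ge0.
Qed.

(** Jensen's inequality for each [k], after which every [g i] is summed on its own. *)
Lemma lp_minkowski (F : {fset I}) (a : I -> R) (g : I -> T -> R) (s M : R) : 0 <= s ->
  (forall i, 0 <= a i) -> (forall i k, 0 <= g i k) ->
  \sum_(i <- F) a i <= s -> 0 <= M -> (forall i, lp_le (g i) M) ->
  lp_le (fun k => \sum_(i <- F) a i * g i k) (s * M).
Proof.
move=> s0 a0 g0 as1 M0 gM.
move: s0; rewrite le_eqVlt => /predU1P[s0|s0].
  have a00 i : i \in F -> a i = 0.
    move=> iF; apply/eqP; rewrite eq_le a0 andbT s0 (le_trans _ as1)//.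
    by rewrite -fsum1 fsum_sub// fsub1set.
  rewrite -s0 mul0r; apply: lp_mono lp0 => k.
  by rewrite big_seq big1 ?lexx// => i iF; rewrite a00// mul0r.
split; first by rewrite mulr_ge0// ltW.
move: gM; apply: lpP => [r pr r1|pr] gM; rewrite pr; last first.
  move=> k; rewrite (le_trans (y := \sum_(i <- F) a i * M))//.
    by apply: ler_sum => i _; rewrite ler_wpM2l//; have [_] := gM i; rewrite pr.
  by rewrite -mulr_suml ler_wpM2r.
move=> J; have r0 : 0 < r by rewrite (lt_le_trans ltr01).
have : \sum_(k <- J) s * ((\sum_(i <- F) a i * g i k) / s) `^ r <= s * M `^ r.
  rewrite (le_trans (y := \sum_(k <- J) \sum_(i <- F) a i * g i k `^ r))//.
    by apply: ler_sum => k _; apply: jensen_powR.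
  rewrite exchange_big/= (le_trans (y := \sum_(i <- F) a i * M `^ r))//.
    apply: ler_sum => i _; rewrite -mulr_sumr ler_wpM2l//.
    by have [_] := gM i; rewrite pr; exact.
  by rewrite -mulr_suml ler_wpM2r ?powR_ge0.
rewrite -mulr_sumr ler_pM2l// => h.
have E k : (\sum_(i <- F) a i * g i k) `^ r =
    s `^ r * ((\sum_(i <- F) a i * g i k) / s) `^ r.
  rewrite -powRM ?(ltW s0) ?divr_ge0 ?(ltW s0) ?fsum_ge0// => [|i]; last by rewrite mulr_ge0.
  by rewrite mulrC divfK// gt_eqF.
under eq_bigr do rewrite E.
by rewrite -mulr_sumr powRM ?(ltW s0)// ler_wpM2l ?powR_ge0.
Qed.

End TwoIndices.

Lemma lpD (T : choiceType) (f g : T -> R) A B :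
  (forall k, 0 <= f k) -> (forall k, 0 <= g k) ->
  lp_le f A -> lp_le g B -> lp_le (fun k => f k + g k) (A + B).
Proof.
move=> f0 g0 fA gB; have [A0 B0] := (lp_ge0 fA, lp_ge0 gB).
(* Minkowski's inequality for two families scaled to norm at most one; [e] keeps the scaling factors
   from vanishing. *)
have key e : 0 < e -> lp_le (fun k => f k + g k) ((A + e) + (B + e)).
  move=> e0; have Ae : 0 < A + e by rewrite ltr_wpDl.
  have Be : 0 < B + e by rewrite ltr_wpDl.
  pose a (b : bool) := if b then A + e else B + e.
  pose h (b : bool) k := if b then f k / (A + e) else g k / (B + e).
  have -> : (fun k => f k + g k) = (fun k => \sum_(b <- [fset true; false]%fset) a b * h b k).
    apply/funext => k; rewrite big_fsetU1/= ?inE// fsum1 /a /h.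
    by rewrite !(mulrC _ (_ / _)) !divfK ?gt_eqF.
  rewrite -[X in lp_le _ X]mulr1; apply: lp_minkowski => //.
  - by rewrite addr_ge0 ?ltW.
  - by case; rewrite ltW.
  - by case=> k; rewrite divr_ge0// ltW.
  - by rewrite big_fsetU1/= ?inE// fsum1.
  - case; rewrite /h.
      have -> : (fun k => f k / (A + e)) = (fun k => (A + e)^-1 * f k).
        by apply/funext => k; rewrite mulrC.
      rewrite -(mulVf (lt0r_neq0 Ae)); apply: lpZ => //; first by rewrite invr_ge0 ltW.
      by apply: lp_weak fA; rewrite lerDl ltW.
    have -> : (fun k => g k / (B + e)) = (fun k => (B + e)^-1 * g k).
      by apply/funext => k; rewrite mulrC.
    rewrite -(mulVf (lt0r_neq0 Be)); apply: lpZ => //; first by rewrite invr_ge0 ltW.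
    by apply: lp_weak gB; rewrite lerDl ltW.
apply: lp_closed => [|k|e e0]; [exact: addr_ge0|exact: addr_ge0|].
by have := key (e / 2) (divr_gt0 e0 (ltr0n _ 2)); rewrite addrACA -splitr.
Qed.

(* The reciprocal of the conjugate exponent of [p]. *)
Definition dual_exp : R := if p is r%:E then 1 - r^-1 else 1.

(** Hölder's inequality on a finite set, obtained from Jensen's with all weights equal to [1]. *)
Lemma lp_card (T : choiceType) (f : T -> R) M (F : {fset T}) : (forall k, 0 <= f k) ->
  lp_le f M -> \sum_(k <- F) f k <= #|` F|%:R `^ dual_exp * M.
Proof.
move=> f0 [M0 fM].
have [->|F0] := eqVneq F fset0.
  by rewrite big_seq_fset0 mulr_ge0// powR_ge0.
have c0 : 0 < #|` F|%:R :> R by rewrite ltr0n cardfs_gt0.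
have sum1 (x : R) : \sum_(k <- F) x = #|` F|%:R * x.
  by rewrite big_const_seq count_predT iter_addr_0 mulr_natl.
move: fM; rewrite /dual_exp; apply: lpP => [r -> r1|->] h; last first.
  by rewrite powRr1 ?(ltW c0)// -sum1; apply: ler_sum.
have r0 : 0 < r by rewrite (lt_le_trans ltr01).
set n := #|` F|%:R in c0 sum1 *.
have : n * ((\sum_(k <- F) 1 * f k) / n) `^ r <= M `^ r.
  rewrite (le_trans (@jensen_powR _ F (fun=> 1) f n r r1 c0 _ f0 _))//.
    by rewrite sum1 mulr1.
  by under eq_bigr do rewrite mul1r; exact: h.
under eq_bigr do rewrite mul1r.
set S := \sum_(k <- F) _; have S0 : 0 <= S by exact: fsum_ge0.
have n0 := ltW c0.
rewrite powR_root ?mulr_ge0 ?powR_ge0// powRM ?powR_ge0// -powRrM mulfV ?gt_eqF// powRr1 ?divr_ge0//.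
have -> : n `^ (1 - r^-1) = n / n `^ r^-1.
  by rewrite powRB ?powRr1//; apply/implyP => _; rewrite gt_eqF.
have nr : 0 < n `^ r^-1 by rewrite powR_gt0.
rewrite mulrA ler_pdivrMr// => H; rewrite mulrAC ler_pdivlMr//.
by rewrite mulrC (le_trans H)// mulrC.
Qed.

End LpBound.

(** * Weights on the lattice *)

Lemma leq_expl m n e : (m <= n)%N -> (m ^ e <= n ^ e)%N.
Proof. by case: e => // e; rewrite leq_exp2r. Qed.

Section Lattice.
Context {R : realType} {d : nat}.
Local Notation L := (lattice d).
Implicit Types k x y : L.

Definition coord (k : L) (l : 'I_d) : int := (k : 'rV[int]_d) 0 l.

Lemma coordD x y l : coord (x + y) l = coord x l + coord y l. Proof. exact: mxE. Qed.
Lemma coordN x l : coord (- x) l = - coord x l. Proof. exact: mxE. Qed.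
Lemma coord0 l : coord 0 l = 0. Proof. exact: mxE. Qed.
Lemma coord_inj x y : coord x =1 coord y -> x = y.
Proof. by move=> h; apply/rowP => l; exact: h. Qed.

Local Notation norm := (@enorm R d).

Lemma enormE k : norm k = Num.sqrt (\sum_(l < d) (coord k l)%:~R ^+ 2).
Proof. by []. Qed.

Lemma enorm_ge0 k : 0 <= norm k. Proof. exact: sqrtr_ge0. Qed.

Lemma enorm_sqr k : norm k ^+ 2 = \sum_(l < d) (coord k l)%:~R ^+ 2.
Proof. by rewrite sqr_sqrtr// sumr_ge0// => l _; rewrite sqr_ge0. Qed.

Lemma enorm_mono x y : (forall l, `|coord x l| <= `|coord y l|) -> norm x <= norm y.
Proof.
move=> h; apply: ler_wsqrtr; apply: ler_sum => l _.
rewrite -[leLHS]real_normK ?num_real// -[leRHS]real_normK ?num_real// -!intr_norm.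
by apply: lerXn2r; rewrite ?nnegrE ?ler0z ?normr_ge0// ler_int; exact: h.
Qed.

Lemma enormN k : norm (- k) = norm k.
Proof. by apply/eqP; rewrite eq_le !enorm_mono// => l; rewrite coordN normrN. Qed.

Lemma enormB x y : norm (x - y) = norm (y - x).
Proof. by rewrite -enormN opprB. Qed.

Lemma enorm0 : norm 0 = 0.
Proof. by rewrite enormE big1 ?sqrtr0// => l _; rewrite coord0 expr0n. Qed.

Lemma enorm_coord k l : `|(coord k l)%:~R| <= norm k.
Proof.
rewrite -[leLHS]sqrtr_sqr; apply: ler_wsqrtr.
by rewrite (bigD1 l)//= lerDl sumr_ge0// => j _; rewrite sqr_ge0.
Qed.

Lemma enorm_eq0 k : norm k <= 0 -> k = 0.
Proof.
move=> k0; apply: coord_inj => l; rewrite coord0; apply/eqP.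
have := le_trans (enorm_coord k l) k0; rewrite normr_le0 intr_eq0//.
Qed.

(* A weak form of the triangle inequality, which is enough for the weights. *)
Lemma enormD_max x y : norm (x + y) <= 2 * Num.max (norm x) (norm y).
Proof.
have m0 : 0 <= Num.max (norm x) (norm y) by rewrite le_max enorm_ge0.
rewrite -ler_sqr ?nnegrE ?enorm_ge0 ?mulr_ge0// exprMn.
rewrite (le_trans (y := (norm x ^+ 2 + norm y ^+ 2) *+ 2))//.
  rewrite !enorm_sqr -big_split/= -sumrMnl; apply: ler_sum => l _; rewrite coordD intrD.
  rewrite -subr_ge0 (_ : _ - _ = ((coord x l)%:~R - (coord y l)%:~R) ^+ 2); first exact: sqr_ge0.
  by ring.
have hx : norm x ^+ 2 <= Num.max (norm x) (norm y) ^+ 2.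
  by rewrite ler_sqr ?nnegrE ?enorm_ge0// le_max lexx.
have hy : norm y ^+ 2 <= Num.max (norm x) (norm y) ^+ 2.
  by rewrite ler_sqr ?nnegrE ?enorm_ge0// le_max lexx orbT.
by move: hx hy; move: (norm x ^+ 2) (norm y ^+ 2) (_ ^+ 2) => a b c; lra.
Qed.

Lemma enorm_ball_card (F : {fset L}) n : (forall k, k \in F -> norm k <= n%:R) ->
  (#|` F| <= (n.*2.+1) ^ d)%N.
Proof.
move=> hF; pose phi k := [ffun l => inord (absz (coord k l + n%:Z)%R) : 'I_(n.*2.+1)].
have cn k l : k \in F -> (`|coord k l| <= n)%N.
  move=> kF; have := le_trans (enorm_coord k l) (hF k kF).
  by rewrite -intr_norm -[n%:R]/(n%:Z%:~R) ler_int lez_nat.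
have inj : {in F &, injective phi}.
  move=> x y xF yF /ffunP h; apply: coord_inj => l; have := h l; rewrite !ffunE.
  have cx := cn x l xF; have cy := cn y l yF.
  move=> /(congr1 val); rewrite /= !inordK; move: cx cy; clear; lia.
rewrite -[X in (_ <= X ^ _)%N]card_ord -[X in (_ <= _ ^ X)%N]card_ord -card_ffun.
have un : uniq (map phi F) by rewrite map_inj_in_uniq ?fset_uniq.
by rewrite -(size_map phi) -(card_uniqP un) max_card.
Qed.

Definition wt (alpha : R) (k : L) : R := (1 + norm k) `^ alpha.

Lemma wt_gt0 alpha k : 0 < wt alpha k.
Proof. by rewrite powR_gt0// ltr_pwDl// enorm_ge0. Qed.

Lemma wt_ge0 alpha k : 0 <= wt alpha k. Proof. exact: powR_ge0. Qed.

Lemma wt0 alpha : wt alpha 0 = 1. Proof. by rewrite /wt enorm0 addr0 powR1. Qed.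

Lemma wt_ge1 alpha k : 0 <= alpha -> 1 <= wt alpha k.
Proof.
move=> a0; have -> : 1 = 1 `^ alpha :> R by rewrite powR1.
by apply: powR_mono => //; rewrite lerDl enorm_ge0.
Qed.

Lemma wt_double alpha x y : 0 <= alpha -> norm x <= 2 * norm y ->
  wt alpha x <= 2 `^ alpha * wt alpha y.
Proof.
move=> a0 h; rewrite -powRM ?addr_ge0 ?enorm_ge0//; apply: powR_mono => //.
  by rewrite addr_ge0 ?enorm_ge0.
by rewrite mulrDr mulr1 lerD// ler1n.
Qed.

Lemma wtD alpha x y : 0 <= alpha -> wt alpha (x + y) <= 2 `^ alpha * (wt alpha x + wt alpha y).
Proof.
move=> a0; have := enormD_max x y; have p0 : 0 <= 2 `^ alpha :> R := powR_ge0 _ _.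
have [_ h|_ h] := leP (norm x) (norm y).
  rewrite (le_trans (wt_double a0 h))// ler_wpM2l// lerDr wt_ge0//.
by rewrite (le_trans (wt_double a0 h))// ler_wpM2l// lerDl wt_ge0.
Qed.

Section Tail.
Context (p : \bar R) (p1 : (1 <= p)%E) (alpha : R).
Hypothesis alpha_gt : d%:R * dual_exp p < alpha.

Let theta := dual_exp p.

Lemma dual_exp_ge0 : 0 <= theta.
Proof.
rewrite /theta /dual_exp; case: p p1 => // r r1.
by rewrite subr_ge0 invf_le1// (lt_le_trans ltr01).
Qed.

Let alpha0 : 0 < alpha.
Proof. by rewrite (le_lt_trans _ alpha_gt)// mulr_ge0// dual_exp_ge0. Qed.

Let mu : R := 2 `^ (d%:R * theta).
Let om : R := 2 `^ alpha.
(** Growth of the dyadic shells, as seen by Hölder's inequality, against growth of the weight. The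
    condition on [alpha] says that this ratio is below [1]. *)
Let tau := mu / om.

Let mu1 : 1 <= mu.
Proof.
have -> : 1 = 1 `^ (d%:R * theta) :> R by rewrite powR1.
by apply: powR_mono; rewrite ?ler1n// mulr_ge0// dual_exp_ge0.
Qed.

Let om0 : 0 < om. Proof. by rewrite powR_gt0. Qed.

Let tau0 : 0 < tau. Proof. by rewrite divr_gt0// (lt_le_trans ltr01). Qed.

Let tau1 : tau < 1.
Proof.
rewrite ltr_pdivrMr// mul1r /mu /om /powR !gt_eqF//.
by rewrite ltr_expR ltr_pM2r// ln_gt0// ltr1n.
Qed.

(** A shell has at most [2 ^ (d (m + 3))] points, which costs [mu ^ (m + 3)] in Hölder's inequality,
    and the weight there gains [om ^ m]. *)
Let shell_sum (h f : L -> R) M m (S : {fset L}) : (forall k, 0 <= h k) ->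
  (forall k, h k * wt alpha k <= f k) -> lp_le p f M ->
  (forall k, k \in S -> 2 ^+ m <= 1 + norm k < 2 ^+ m.+1) ->
  \sum_(k <- S) h k <= mu ^+ 3 * tau ^+ m * M.
Proof.
move=> h0 hf fM hS; have M0 := lp_ge0 fM.
have f0 k : 0 <= f k by rewrite (le_trans _ (hf k))// mulr_ge0// wt_ge0.
have omm : 0 < om ^+ m by rewrite exprn_gt0.
have s1 : \sum_(k <- S) h k <= (\sum_(k <- S) f k) / om ^+ m.
  rewrite mulr_suml big_seq [leRHS]big_seq; apply: ler_sum => k kS.
  rewrite ler_pdivlMr// (le_trans _ (hf k))// ler_wpM2l//.
  have /andP[h1 _] := hS k kS.
  have -> : om ^+ m = (2 ^+ m) `^ alpha.
    by rewrite -(powR_mulrn m (ltW om0)) -powRrM mulrC powRrM powR_mulrn.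
  by apply: powR_mono => //; exact: ltW.
rewrite (le_trans s1)// ler_pdivrMr//.
have cS : (#|` S| <= (2 ^ m.+3) ^ d)%N.
  rewrite (leq_trans (@enorm_ball_card S (2 ^ m.+1) _))//.
    move=> k kS; have /andP[_ /ltW h1] := hS k kS.
    by rewrite natrX (le_trans _ h1)// lerDr.
  apply: leq_expl => //; rewrite !expnS -!mul2n; have : (0 < 2 ^ m)%N by rewrite expn_gt0.
  by move: (2 ^ m)%N; clear; lia.
rewrite (le_trans (lp_card p1 S f0 fM))//.
have -> : mu ^+ 3 * tau ^+ m * M * om ^+ m = mu ^+ m.+3 * M.
  by rewrite /tau expr_div_n -[m.+3]addn3 exprD; field; rewrite gt_eqF.
rewrite ler_wpM2r// (le_trans (y := ((2 ^ m.+3) ^ d)%N%:R `^ theta))//.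
  by apply: powR_mono; rewrite ?dual_exp_ge0// ler_nat.
by rewrite !natrX -exprM -(powR_mulrn (_ * d)%N) // -(powR_mulrn m.+3 (powR_ge0 _ _)) -!powRrM natrM
  -mulrA mulrC.
Qed.

(** Where [1 + |k| < 2 ^ n] each term is bounded by [m0]; further out the shells form a geometric
    series. Raising [n] makes the share of the weighted norm [M] small, at the price of a large
    factor on the uniform bound [m0]. *)
Lemma tail_sum : exists c D t, [/\ 0 < c, 1 <= D, 0 < t, t < 1 &
  forall (h f : L -> R) m0 M, (forall k, 0 <= h k <= m0) ->
    (forall k, h k * wt alpha k <= f k) -> lp_le p f M ->
    forall n, sum_le h (c * (D ^+ n * m0 + t ^+ n * M))].
Proof.
have t1 : 0 < 1 - tau by rewrite subr_gt0.
pose c := 3 ^+ d + mu ^+ 3 / (1 - tau).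
have c1 : 3 ^+ d <= c by rewrite lerDl divr_ge0 ?exprn_ge0 ?(le_trans ler01 mu1) ?ltW.
have c2 : mu ^+ 3 / (1 - tau) <= c by rewrite lerDr exprn_ge0.
exists c, (2 ^+ d), tau; split=> //.
- by rewrite (lt_le_trans _ c1)// exprn_gt0.
- by rewrite exprn_ege1// ler1n.
move=> h f m0 M hm hf fM n F.
have h0 k : 0 <= h k by case/andP: (hm k).
have m00 : 0 <= m0 by have /andP[a b] := hm 0; exact: le_trans b.
have M0 := lp_ge0 fM.
pose ball j := [fset k in F | (1 + norm k < 2 ^+ j)%R]%fset.
have inball j k : (k \in ball j) = (k \in F) && (1 + norm k < 2 ^+ j) by rewrite !inE.
have ball_n : \sum_(k <- ball n) h k <= 3 ^+ d * (2 ^+ d) ^+ n * m0.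
  rewrite (le_trans (y := \sum_(k <- ball n) m0))//.
    by apply: ler_sum => k _; case/andP: (hm k).
  rewrite big_const_seq count_predT iter_addr_0 -[leLHS]mulr_natl; apply: ler_wpM2r => //.
  have : (#|` ball n| <= (3 * 2 ^ n) ^ d)%N.
    rewrite (leq_trans (@enorm_ball_card _ (2 ^ n) _))// => [k|].
      by rewrite inball natrX => /andP[_ /ltW]; apply: le_trans; rewrite lerDr.
    by apply: leq_expl; rewrite -mul2n; have := expn_gt0 2 n; move: (2 ^ n)%N; clear; lia.
  by rewrite -(ler_nat R) => /le_trans; apply; rewrite natrX natrM natrX exprMn exprAC.
have step j : \sum_(k <- ball (n + j)%N) h k <=
    3 ^+ d * (2 ^+ d) ^+ n * m0 + mu ^+ 3 * M * (tau ^+ n * ((1 - tau ^+ j) / (1 - tau))).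
  elim: j => [|j IH]; first by rewrite addn0 expr0 subrr mul0r !mulr0 addr0.
  rewrite (big_fsetID _ (mem (ball (n + j)%N)))/=.
  have -> : [fset x | x in ball (n + j.+1)%N & x \in ball (n + j)%N]%fset = ball (n + j)%N.
    apply/fsetP => x; rewrite !inE/=; case: (x \in F) => //=; rewrite -/(norm x).
    case: (ltP (1 + norm x) (2 ^+ (n + j))) => [h1|]; rewrite ?andbF// andbT.
    by rewrite (lt_le_trans h1)// ler_weXn2l ?ler1n// leq_add2l.
  have sh : \sum_(k <- [fset x | x in ball (n + j.+1)%N & x \notin ball (n + j)%N]%fset) h k <=
      mu ^+ 3 * tau ^+ (n + j) * M.
    apply: (shell_sum h0 hf fM) => k; rewrite !inE/= => /andP[/andP[-> h1]] /=.
    by rewrite -leNgt -addnS h1 andbT.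
  rewrite (le_trans (lerD IH sh))// -addrA lerD2l.
  have -> : mu ^+ 3 * tau ^+ (n + j) * M = mu ^+ 3 * M * (tau ^+ n * tau ^+ j).
    by rewrite exprD; ring.
  rewrite -mulrDr ler_wpM2l ?mulr_ge0 ?exprn_ge0 ?(le_trans ler01 mu1)//.
  rewrite -mulrDr ler_wpM2l ?exprn_ge0 ?(ltW tau0)// exprS le_eqVlt; apply/orP; left.
  by apply/eqP; field; rewrite gt_eqF.
have [J hJ] : exists J, forall k, k \in F -> 1 + norm k < 2 ^+ (n + J).
  pose B := 1 + \sum_(k <- F) norm k.
  exists (Num.bound `|B|) => k kF; rewrite (le_lt_trans (y := B))//.
    rewrite lerD2l -fsum1 fsum_sub ?fsub1set// => *; exact: enorm_ge0.
  rewrite (le_lt_trans (ler_norm _))// (lt_trans (archi_boundP (normr_ge0 _)))//.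
  by rewrite -natrX ltr_nat (leq_trans (ltn_expl _ (isT : 1 < 2)%N))// leq_pexp2l// leq_addl.
have -> : F = ball (n + J)%N.
  by apply/fsetP => k; rewrite inball; case: (boolP (k \in F)) => //= /hJ ->.
rewrite (le_trans (step J))// mulrDr lerD//.
  by rewrite -mulrA ler_wpM2r// mulr_ge0// !exprn_ge0.
have -> : mu ^+ 3 * M * (tau ^+ n * ((1 - tau ^+ J) / (1 - tau))) =
    mu ^+ 3 / (1 - tau) * (tau ^+ n * M) * (1 - tau ^+ J) by ring.
have tM : 0 <= tau ^+ n * M by rewrite mulr_ge0// exprn_ge0// ltW.
rewrite (le_trans (y := mu ^+ 3 / (1 - tau) * (tau ^+ n * M)))//.
  rewrite ler_piMr//; first by rewrite mulr_ge0// divr_ge0 ?exprn_ge0 ?(le_trans ler01 mu1) ?ltW.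
  by rewrite gerBl exprn_ge0// ltW.
by rewrite ler_wpM2r.
Qed.

End Tail.

End Lattice.

Section BelowSum.
Context {R : realType} {T : choiceType}.
Implicit Types (f g : T -> R).

Lemma below_sumZ x c f : 0 < c -> below_sum x f -> below_sum (c * x) (fun k => c * f k).
Proof.
move=> c0 h B hB; rewrite -ler_pdivlMl//; apply: h => F.
by rewrite ler_pdivlMl// mulr_sumr.
Qed.

Lemma below_sum_mono x f g : (forall k, f k <= g k) -> below_sum x f -> below_sum x g.
Proof. by move=> fg h B hB; apply: h; exact: sum_le_mono hB. Qed.

(** On an unbounded family the supremum is only a default value, so bounds [sum_le f B] accompany
    its use. *)
Definition nsum f : R := sup [set \sum_(k <- F) f k | F in [set: {fset T}]].

Lemma nsum_ub f B : sum_le f B -> sum_le f (nsum f).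
Proof.
move=> fB F; apply: sup_upper_bound; last by exists F.
split; first by exists (\sum_(k <- fset0) f k), fset0.
by exists B => _ [G _ <-]; exact: fB.
Qed.

Lemma nsum_le f B : sum_le f B -> nsum f <= B.
Proof.
move=> fB; apply: ge_sup; first by exists (\sum_(k <- fset0) f k), fset0.
by move=> _ [G _ <-]; exact: fB.
Qed.

Lemma nsum_below f : below_sum (nsum f) f.
Proof. by move=> B; exact: nsum_le. Qed.

Lemma nsum_ge0 f B : (forall k, 0 <= f k) -> sum_le f B -> 0 <= nsum f.
Proof. by move=> f0 /nsum_ub/(_ fset0); rewrite big_seq_fset0. Qed.

End BelowSum.

Lemma sum_le_half {R : realType} : sum_le (fun n : nat => (2 ^+ n)^-1 : R) 2.
Proof.
move=> F; have [N hN] : exists N, forall n, n \in F -> (n < N)%N.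
  exists (\sum_(n <- F) n).+1 => n nF; rewrite ltnS (big_fsetD1 n)//= leq_addr//.
have h N' : \sum_(n < N') (2 ^+ n)^-1 = 2 - (2 ^+ N')^-1 *+ 2 :> R.
  elim: N' => [|N' IH]; first by rewrite big_ord0 expr0 invr1 subrr.
  by rewrite big_ord_recr/= IH exprS; field; rewrite expf_neq0.
have p0 n : 0 <= (2 ^+ n)^-1 :> R by rewrite invr_ge0 exprn_ge0.
rewrite (le_trans (y := \sum_(n < N) (2 ^+ n)^-1))//; last by rewrite h gerBl mulrn_wge0.
rewrite -(big_mkord xpredT (fun n => (2 ^+ n)^-1 : R)) [leRHS](bigID (mem F))/=.
rewrite (_ : \sum_(0 <= i < N | i \in F) _ = \sum_(k <- F) (2 ^+ k)^-1); last first.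
  rewrite -big_filter; apply: perm_big; apply: uniq_perm.
  - by rewrite filter_uniq ?iota_uniq.
  - exact: fset_uniq.
  - move=> n; rewrite mem_filter mem_index_iota /=.
    by case: (boolP (n \in F)) => [/hN ->|/negPf h']; rewrite ?andbT//; rewrite /= ?h'.
by rewrite lerDl sumr_ge0.
Qed.

(** * Halving lattice points *)

Section Half.
Context {R : realType} {d : nat}.
Local Notation L := (lattice d).
Local Notation norm := (@enorm R d).

(** Truncation toward zero: doubling the result must not increase the absolute value, also for
    negative integers. *)
Definition halfz (z : int) : int :=
  if (0 <= z)%R then ((absz z)./2)%:Z else - ((absz z)./2)%:Z.

Lemma halfzP z : `|halfz z + halfz z| <= `|z| /\ `|z - halfz z *+ 2| <= 1.
Proof.
have [n zn] : exists n : nat, z = n%:Z /\ halfz z = (n./2)%:Z \/ z = - n%:Z /\ halfz z = - (n./2)%:Z.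
  exists (absz z); rewrite /halfz; case: leP => z0; [left|right]; split=> //; lia.
by case: zn => -[-> ->]; lia.
Qed.

Definition half (k : L) : L := \row_l halfz (coord k l).

Lemma coord_half k l : coord (half k) l = halfz (coord k l). Proof. exact: mxE. Qed.

Lemma enorm_half k : 2 * norm (half k) <= norm k.
Proof.
have -> : 2 * norm (half k) = norm (half k + half k).
  rewrite -[2 in LHS](@ger0_norm R)// -sqrtr_sqr -sqrtrM ?sqr_ge0// mulr_sumr.
  by congr Num.sqrt; apply: eq_bigr => l _; rewrite -/(coord _ l) -/(coord _ l) coordD intrD; ring.
by apply: enorm_mono => l; rewrite coordD coord_half; case: (halfzP (coord k l)).
Qed.

Lemma half_fiber_card (F : {fset L}) k0 : (forall k, k \in F -> half k = k0) ->
  (#|` F| <= 3 ^ d)%N.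
Proof.
move=> hF; pose phi (k : L) := [ffun l => inord (absz (coord k l - coord k0 l *+ 2 + 1)%R) : 'I_3].
have cn k l : k \in F -> `|coord k l - coord k0 l *+ 2| <= 1.
  by move=> /hF <-; rewrite coord_half; case: (halfzP (coord k l)).
have inj : {in F &, injective phi}.
  move=> x y xF yF /ffunP h; apply: coord_inj => l; have := h l; rewrite !ffunE.
  have cx := cn x l xF; have cy := cn y l yF.
  by move=> /(congr1 val); rewrite /= !inordK; move: cx cy; clear; lia.
rewrite -[3%N in leqRHS]card_ord -[X in (_ <= _ ^ X)%N]card_ord -card_ffun.
have un : uniq (map phi F) by rewrite map_inj_in_uniq ?fset_uniq.
by rewrite -(size_map phi) -(card_uniqP un) max_card.
Qed.

Lemma sum_pred_card (T : choiceType) (F : {fset T}) (P : pred T) :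
  \sum_(k <- F) (P k)%:R = #|` [fset k in F | P k]%fset|%:R :> R.
Proof.
rewrite (big_fsetID _ P)/= [X in _ + X]big_seq [X in _ + X]big1 ?addr0; last first.
  by move=> k; rewrite !inE/= => /andP[_ /negPf ->].
rewrite big_seq (eq_bigr (fun=> 1)); last by move=> k; rewrite !inE/= => /andP[_ ->].
by rewrite -big_seq big_const_seq count_predT iter_addr_0.
Qed.

(** [half] is at most [3 ^ d] to one, and composition with it is a kernel to which Schur's test
    applies. *)
Lemma lp_half (p : \bar R) (p1 : (1 <= p)%E) (f : L -> R) M : (forall k, 0 <= f k) ->
  lp_le p f M -> lp_le p (fun k => f (half k)) (3 ^+ d * M).
Proof.
move=> f0 fM; apply: (@lp_fatou _ _ p1 _ _ (fun i k => (i == half k)%:R * f i)) => //.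
- by move=> i k; rewrite mulr_ge0.
- move=> F; apply: (lp_schur p1) => //.
  + move=> k; rewrite sum_pred_card -natrX ler_nat (leq_trans (n := 1))//; last first.
      by rewrite expn_gt0.
    rewrite -(cardfs1 (half k)) fsubset_leq_card//; apply/fsubsetP => i.
    by rewrite !inE/= => /andP[_ /eqP ->].
  + move=> i G; rewrite sum_pred_card -natrX ler_nat (@half_fiber_card _ i)// => k.
    by rewrite !inE/= => /andP[_ /eqP ->].
- by move=> k B /(_ [fset half k]%fset); rewrite fsum1 eqxx mul1r.
Qed.

End Half.

(** * The weighted matrix norms *)

Section MatrixNorm.
Context {R : realType} {d : nat} (K : algebra_kind) (p : \bar R) (p1 : (1 <= p)%E)
  (alpha : R) (alpha_gt : d%:R * dual_exp p < alpha).
Local Notation L := (lattice d).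
Local Notation norm := (@enorm R d).
Local Notation w := (wt alpha).
Implicit Types A B : L -> L -> R.

(* The three norms are suprema over an index [b] of the l^p-norm of
   [k |-> sup_(ij in profile b k) |a_ij| w (i - j)]: one profile for each row ([b.1]) and
   each column for the Schur norm, a single one (whatever [b]) for the other two. *)
Definition profile (b : bool * L) (k : L) : set (L * L) :=
  match K with
  | GrochenigSchur => if b.1 then [set (b.2, k)] else [set (k, b.2)]
  | BaskakovGohbergSjostrand => [set ij | ij.1 - ij.2 = k]
  | Beurling => [set ij | norm k <= norm (ij.1 - ij.2)]
  end.

(** A real dominating family [f] replaces the possibly infinite suprema over the profiles; such
    families can be added, scaled and convolved. *)
Definition mat_le A (M : R) : Prop := 0 <= M /\ forall b, exists f,
  [/\ forall k, 0 <= f k, lp_le p f M &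
      forall k ij, profile b k ij -> A ij.1 ij.2 * w (ij.1 - ij.2) <= f k].

Lemma alpha_gt0 : 0 < alpha.
Proof. by rewrite (le_lt_trans _ alpha_gt)// mulr_ge0// dual_exp_ge0. Qed.

Lemma mat_mono A B M : (forall i j, A i j <= B i j) -> mat_le B M -> mat_le A M.
Proof.
move=> AB [M0 h]; split=> // b; have [f [f0 fM fB]] := h b; exists f; split => // k ij /fB.
by apply: le_trans; rewrite ler_wpM2r// wt_ge0.
Qed.

Lemma mat_weak A M M' : M <= M' -> mat_le A M -> mat_le A M'.
Proof.
move=> MM [M0 h]; split=> [|b]; first exact: le_trans MM.
by have [f [f0 fM fB]] := h b; exists f; split => //; exact: lp_weak fM.
Qed.

Lemma matD A B M M' : mat_le A M -> mat_le B M' -> mat_le (fun i j => A i j + B i j) (M + M').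
Proof.
move=> [M0 h] [M0' h']; split=> [|b]; first exact: addr_ge0.
have [f [f0 fM fB]] := h b; have [g [g0 gM gB]] := h' b.
exists (fun k => f k + g k); split=> [k||k ij ijk]; first exact: addr_ge0.
  exact: lpD.
by rewrite mulrDl lerD// ?fB// gB.
Qed.

Lemma matZ c A M : 0 <= c -> mat_le A M -> mat_le (fun i j => c * A i j) (c * M).
Proof.
move=> c0 [M0 h]; split=> [|b]; first exact: mulr_ge0.
have [f [f0 fM fB]] := h b.
exists (fun k => c * f k); split=> [k||k ij ijk]; first exact: mulr_ge0.
  exact: lpZ.
by rewrite -mulrA ler_wpM2l// fB.
Qed.

Lemma mat_row A M i : mat_le A M -> exists f,
  [/\ forall k, 0 <= f k, lp_le p f M & forall j, A i j * w (i - j) <= f (i - j)].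
Proof.
move=> [M0 h]; have [f [f0 fM fB]] := h (true, i); move: fB; rewrite /profile; case: K => fB.
- exists (fun k => f (i - k)); split => // [|j].
    by apply: lp_inj fM => // x y /= /addrI/oppr_inj.
  by rewrite subKr; apply: (fB _ (i, j)).
- by exists f; split => // j; apply: (fB _ (i, j)).
- by exists f; split => // j; apply: (fB _ (i, j)) => /=.
Qed.

Lemma mat_tr A M : mat_le A M -> mat_le (fun i j => A j i) M.
Proof.
move=> [M0 h]; split=> // b.
have wN (x y : L) : w (x - y) = w (y - x) by rewrite /wt enormB.
case KK : K; rewrite /profile in h *; rewrite KK in h *.
- have [f [f0 fM fB]] := h (~~ b.1, b.2); exists f; split=> // k [i j] ijk /=.
  rewrite wN; apply: (fB k (j, i)) => /=.
  by move: ijk; case: b.1 => /= -[-> ->].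
- have [f [f0 fM fB]] := h b; exists (fun k => f (- k)); split => // [|k [i j] /= ijk].
    by apply: lp_inj fM => //; exact: oppr_inj.
  by rewrite wN; apply: (fB (- k) (j, i)) => /=; rewrite -ijk opprB.
- have [f [f0 fM fB]] := h b; exists f; split=> // k [i j] /= ijk.
  by rewrite wN; apply: (fB k (j, i)) => /=; rewrite enormB.
Qed.

Lemma mat_col A M j : mat_le A M -> exists f,
  [/\ forall k, 0 <= f k, lp_le p f M & forall i, A i j * w (i - j) <= f (i - j)].
Proof.
move=> AM; have [f [f0 fM fB]] := mat_row j (mat_tr AM); exists (fun k => f (- k)); split => // [|i].
  by apply: lp_inj fM => //; exact: oppr_inj.
rewrite opprB; have := fB i; by rewrite {1}/wt enormB.
Qed.

Lemma mat_entry A M i j : (forall i j, 0 <= A i j) -> mat_le A M -> A i j <= M.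
Proof.
move=> A0 /(mat_row i)[f [f0 fM fB]]; rewrite (le_trans _ (lp_entry p1 (i - j) f0 fM))//.
rewrite (le_trans _ (fB j))// ler_peMr//.
exact: wt_ge1 (ltW alpha_gt0).
Qed.

Lemma mat_one : mat_le (fun i j => (i == j)%:R) 1.
Proof.
split=> // b.
have d0 (k0 : L) : forall k : L, 0 <= (k == k0)%:R :> R by [].
have D (i j : L) (v : R) : 0 <= v -> (i == j -> 1 <= v) -> (i == j)%:R * w (i - j) <= v.
  case: eqP => [->|]; last by rewrite mul0r.
  by rewrite mul1r subrr wt0 => _; exact.
case KK : K; rewrite /profile KK.
- exists (fun k => (k == b.2)%:R); split => //; first exact: lp_delta.
  move=> k [i j] /=; case: b.1 => /= -[-> ->]; apply: D => //.
    by rewrite eq_sym => ->.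
  by move=> ->.
- exists (fun k => (k == 0)%:R); split => //; first exact: lp_delta.
  by move=> k [i j] /= <-; apply: D => // /eqP ->; rewrite subrr eqxx.
- exists (fun k => (k == 0)%:R); split => //; first exact: lp_delta.
  move=> k [i j] /= h; apply: D => // /eqP ij; move: h; rewrite ij subrr enorm0 => /enorm_eq0 ->.
  by rewrite eqxx.
Qed.

(** Minkowski's inequality with the weights [1 / 2 ^ n], of total at most [2], for the families
    [2 ^ n f n], which are all bounded by [M]. *)
Lemma mat_series (U : nat -> L -> L -> R) B M : 0 <= M -> (forall n i j, 0 <= U n i j) ->
  (forall i j, 0 <= B i j) -> (forall n, mat_le (U n) (M / 2 ^+ n)) ->
  (forall i j, below_sum (B i j) (fun n => U n i j)) -> mat_le B (M *+ 2).
Proof.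
move=> M0 U0 B0 UM BU; split=> [|b]; first exact: mulrn_wge0.
have /choice[f hf] : forall n, exists f : L -> R, [/\ forall k, 0 <= f k, lp_le p f (M / 2 ^+ n) &
    forall k ij, profile b k ij -> U n ij.1 ij.2 * w (ij.1 - ij.2) <= f k].
  by move=> n; have [_ /(_ b)] := UM n.
have f0 n k : 0 <= f n k by case: (hf n).
have fM k : sum_le (fun n => f n k) (M * 2).
  apply: (@sum_le_mono _ _ _ (fun n => M * (2 ^+ n)^-1)) => [n|].
    by have [_ h _] := hf n; exact: lp_entry h.
  by apply: sum_leZ => //; exact: sum_le_half.
have p2 n : 0 < (2 ^+ n : R) by rewrite exprn_gt0.
exists (fun k => nsum (fun n => f n k)); split=> [k||k ij ijk].
- exact: nsum_ge0.
- apply: (@lp_fatou _ _ p1 _ _ f) => // [k|F|k]; last exact: nsum_below.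
    exact: nsum_ge0.
  have -> : (fun k => \sum_(i <- F) f i k) =
      (fun k => \sum_(i <- F) (2 ^+ i)^-1 * (2 ^+ i * f i k)).
    by apply/funext => k; apply: eq_bigr => n _; rewrite mulKf// gt_eqF.
  have -> : M *+ 2 = 2 * M by rewrite mulr_natl.
  apply: (@lp_minkowski _ _ p1 _ _ F (fun n => (2 ^+ n)^-1) (fun n k => 2 ^+ n * f n k)) => [//|n|n k||//|n].
  + by rewrite invr_ge0 ltW.
  + by rewrite mulr_ge0// ltW.
  + exact: sum_le_half.
  + have [_ h _] := hf n.
    have -> : M = 2 ^+ n * (M / 2 ^+ n) by rewrite mulrC divfK// gt_eqF.
    by apply: lpZ => //; exact: ltW.
rewrite -ler_pdivlMr ?wt_gt0//; apply: BU => F; rewrite ler_pdivlMr ?wt_gt0// mulr_suml.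
apply: (le_trans _ (nsum_ub (fM k) F)); apply: ler_sum => n _.
by have [_ _ h] := hf n; exact: h.
Qed.

End MatrixNorm.

(** * Norms of products *)

Section MatrixProduct.
Context {R : realType} {d : nat} (K : algebra_kind) (p : \bar R) (p1 : (1 <= p)%E)
  (alpha : R) (alpha_gt : d%:R * dual_exp p < alpha).
Local Notation L := (lattice d).
Local Notation norm := (@enorm R d).
Local Notation w := (wt alpha).
Implicit Types A B : L -> L -> R.

Let alpha0 : 0 <= alpha. Proof. exact: ltW (alpha_gt0 p1 alpha_gt). Qed.

Context (m0 M s m0' M' s' : R) (A A' B : L -> L -> R).
Hypothesis A_bd : forall i j, 0 <= A i j <= m0.
Hypothesis A'_bd : forall i j, 0 <= A' i j <= m0'.
Hypothesis B_ge0 : forall i j, 0 <= B i j.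
Hypothesis A_le : mat_le K p alpha A M.
Hypothesis A'_le : mat_le K p alpha A' M'.
Hypothesis B_le : forall i j, below_sum (B i j) (fun l => A i l * A' l j).
Hypothesis s_sum : forall h f : L -> R, (forall k, 0 <= h k <= m0) ->
  (forall k, h k * w k <= f k) -> lp_le p f M -> sum_le h s.
Hypothesis s'_sum : forall h f : L -> R, (forall k, 0 <= h k <= m0') ->
  (forall k, h k * w k <= f k) -> lp_le p f M' -> sum_le h s'.

Let A0 i j : 0 <= A i j. Proof. by case/andP: (A_bd i j). Qed.
Let A'0 i j : 0 <= A' i j. Proof. by case/andP: (A'_bd i j). Qed.

Lemma row_sum_le (C : L -> L -> R) (m N t : R) : (forall i j, 0 <= C i j <= m) ->
  mat_le K p alpha C N ->
  (forall h f : L -> R, (forall k, 0 <= h k <= m) ->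
     (forall k, h k * w k <= f k) -> lp_le p f N -> sum_le h t) ->
  (forall i, sum_le (C i) t) /\ (forall j, sum_le (C^~ j) t).
Proof.
move=> Cb CN ts; split=> [i|j].
  have [f [f0 fM fC]] := mat_row p1 i CN.
  have := @sum_le_inj _ _ _ (fun j => i - j) (fun k => C i (i - k)) t.
  under [X in _ -> _ -> sum_le X _]eq_fun do rewrite subKr.
  apply; first by move=> x y /= /addrI/oppr_inj.
  apply: (ts _ f) => [k|k|]; [exact: Cb| |exact: fM].
  by have := fC (i - k); rewrite subKr.
have [f [f0 fM fC]] := mat_col p1 j CN.
have := @sum_le_inj _ _ _ (fun i => i - j) (fun k => C (k + j) j) t.
under [X in _ -> _ -> sum_le X _]eq_fun do rewrite subrK.
apply; first by move=> x y /= /addIr.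
apply: (ts _ f) => [k|k|]; [exact: Cb| |exact: fM].
by have := fC (k + j); rewrite addrK.
Qed.

Let As := row_sum_le A_bd A_le s_sum.
Let A's := row_sum_le A'_bd A'_le s'_sum.

Let M0 : 0 <= M. Proof. by case: A_le. Qed.
Let M0' : 0 <= M'. Proof. by case: A'_le. Qed.
Let s0 : 0 <= s.
Proof. by rewrite (le_trans (A0 0 0))//; exact: (sum_le_entry 0 (As.1 0)). Qed.
Let s0' : 0 <= s'.
Proof. by rewrite (le_trans (A'0 0 0))//; exact: (sum_le_entry 0 (A's.1 0)). Qed.

Let P := 2 `^ alpha : R.
Let P0 : 0 <= P. Proof. exact: powR_ge0. Qed.

(** The weight of a sum is spread over its two summands, so that in each term one factor keeps its
    weight and the other acts as an unweighted summable kernel. *)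
Let product_weight i j :
  below_sum (B i j * w (i - j)) (fun l =>
    P * (A' l j * (A i l * w (i - l)) + A i l * (A' l j * w (l - j)))).
Proof.
have := below_sumZ (wt_gt0 alpha (i - j)) (@B_le i j); rewrite mulrC.
apply: below_sum_mono => l.
have -> : P * (A' l j * (A i l * w (i - l)) + A i l * (A' l j * w (l - j))) =
  P * (w (i - l) + w (l - j)) * (A i l * A' l j).
  by move: P (w (i - l)) (w (l - j)) (A i l) (A' l j); clear=> *; ring.
rewrite ler_wpM2r ?mulr_ge0//.
by have := wtD (i - l) (l - j) alpha0; rewrite addrA subrK.
Qed.

(** For a row, the first term is the kernel [A'] acting on a row of [A], a case of Schur's test. The
    second combines rows of [A'] with coefficients from [A], a case of Minkowski's inequality. For a
    column the two roles are exchanged. *)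
Let bound_schur : K = GrochenigSchur -> mat_le K p alpha B (P * (s' * M + s * M')).
Proof.
move=> KK; split; first by rewrite mulr_ge0// addr_ge0// mulr_ge0.
move=> [b n]; exists (fun k => if b then B n k * w (n - k) else B k n * w (k - n)).
rewrite /profile KK; split=> [k||k [i j] /=]; first by case: b; rewrite mulr_ge0 ?wt_ge0.
  case: b.
  - have [_ /(_ (true, n))[f [f0 fM fA]]] := A_le.
    have /choice[f' hf'] : forall l, exists f' : L -> R, [/\ forall k, 0 <= f' k, lp_le p f' M' &
        forall k, A' l k * w (l - k) <= f' k].
      move=> l; have [_ /(_ (true, l))[f' [f'0 fM' fA']]] := A'_le; exists f'; split => // k.
      by apply: (fA' k (l, k)); rewrite /profile KK.
    have f'0 l k : 0 <= f' l k by case: (hf' l).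
    apply: (@lp_fatou _ _ p1 _ _ (fun l k => P * (A' l k * f l + A n l * f' l k))) => [l k|k|F|k].
    + by rewrite mulr_ge0// addr_ge0// mulr_ge0.
    + by rewrite mulr_ge0 ?wt_ge0.
    + under eq_fun do rewrite -mulr_sumr big_split/=.
      apply: (lpZ p1) => // [k|]; first by rewrite addr_ge0// fsum_ge0// => l; rewrite mulr_ge0.
      apply: (lpD p1) => [k|k||]; try by apply: fsum_ge0 => l; rewrite mulr_ge0.
        by apply: (lp_schur p1) => //; [move=> k; exact: A's.2|exact: A's.1].
      apply: (lp_minkowski p1) => //; first exact: As.1.
      by move=> l; case: (hf' l).
    + apply: (below_sum_mono _ (@product_weight n k)) => l; rewrite ler_wpM2l// lerD// ler_wpM2l//.
        by apply: (fA l (n, l)); rewrite /profile KK.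
      by case: (hf' l).
  - have [_ /(_ (false, n))[f' [f'0 fM' fA']]] := A'_le.
    have /choice[f hf] : forall l, exists f : L -> R, [/\ forall k, 0 <= f k, lp_le p f M &
        forall k, A k l * w (k - l) <= f k].
      move=> l; have [_ /(_ (false, l))[f [f0 fM fA]]] := A_le; exists f; split => // k.
      by apply: (fA k (k, l)); rewrite /profile KK.
    have f0 l k : 0 <= f l k by case: (hf l).
    apply: (@lp_fatou _ _ p1 _ _ (fun l k => P * (A' l n * f l k + A k l * f' l))) => [l k|k|F|k].
    + by rewrite mulr_ge0// addr_ge0// mulr_ge0.
    + by rewrite mulr_ge0 ?wt_ge0.
    + under eq_fun do rewrite -mulr_sumr big_split/=.
      apply: (lpZ p1) => // [k|]; first by rewrite addr_ge0// fsum_ge0// => l; rewrite mulr_ge0.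
      apply: (lpD p1) => [k|k||]; try by apply: fsum_ge0 => l; rewrite mulr_ge0.
        apply: (lp_minkowski p1) => //; first exact: A's.2.
        by move=> l; case: (hf l).
      apply: (@lp_schur _ _ p1 _ _ F (fun l k => A k l)) => // [k|l]; [exact: As.1|exact: As.2].
    + apply: (below_sum_mono _ (@product_weight k n)) => l; rewrite ler_wpM2l// lerD// ler_wpM2l//.
        by case: (hf l).
      by apply: (fA' l (l, n)); rewrite /profile KK.
by case: b => /= -[-> ->].
Qed.

Let bound_bgs : K = BaskakovGohbergSjostrand -> mat_le K p alpha B (P * (s' * M + s * M')).
Proof.
move=> KK; split; first by rewrite mulr_ge0// addr_ge0// mulr_ge0.
move=> b; have [_ /(_ b)[f [f0 fM fA]]] := A_le.
have [_ /(_ b)[f' [f'0 fM' fA']]] := A'_le.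
(* The minimum respects both the uniform and the weighted bound, so [s_sum] applies to it; the
   product is then dominated by a convolution of functions on the lattice. *)
pose g k := Num.min (f k / w k) m0; pose g' k := Num.min (f' k / w k) m0'.
have m00 : 0 <= m0 by case/andP: (A_bd 0 0) => [a c]; exact: le_trans c.
have m00' : 0 <= m0' by case/andP: (A'_bd 0 0) => [a c]; exact: le_trans c.
have g0 k : 0 <= g k by rewrite le_min m00 divr_ge0// wt_ge0.
have g0' k : 0 <= g' k by rewrite le_min m00' divr_ge0// wt_ge0.
have gs : sum_le g s.
  apply: (s_sum (f := f)) => // k; first by rewrite g0 ge_min lexx orbT.
  by rewrite -ler_pdivlMr ?wt_gt0// ge_min lexx.
have gs' : sum_le g' s'.
  apply: (s'_sum (f := f')) => // k; first by rewrite g0' ge_min lexx orbT.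
  by rewrite -ler_pdivlMr ?wt_gt0// ge_min lexx.
have Ag i j : A i j <= g (i - j).
  rewrite le_min ler_pdivlMr ?wt_gt0//; case/andP: (A_bd i j) => _ ->; rewrite andbT.
  by apply: (fA _ (i, j)); rewrite /profile KK.
have Ag' i j : A' i j <= g' (i - j).
  rewrite le_min ler_pdivlMr ?wt_gt0//; case/andP: (A'_bd i j) => _ ->; rewrite andbT.
  by apply: (fA' _ (i, j)); rewrite /profile KK.
pose G l k := P * (g' (k - l) * f l + g l * f' (k - l)).
have G0 l k : 0 <= G l k by rewrite mulr_ge0// addr_ge0// mulr_ge0.
have shift_inj (k : L) : injective (fun l => k - l) by move=> x y /= /addrI/oppr_inj.
have shift_inj' (l : L) : injective (fun k => k - l) by move=> x y /= /addIr.
have Gs k : sum_le (G^~ k) (P * (M * s' + M' * s)).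
  apply: sum_leZ => //; apply: sum_leD.
    apply: (sum_le_mono (g := fun l => M * g' (k - l))) => [l|].
      by rewrite mulrC ler_wpM2r//; exact: lp_entry fM.
    apply: (sum_leZ M0); exact: (@sum_le_inj _ _ _ (fun l => k - l) g' s' (@shift_inj k) gs').
  apply: (sum_le_mono (g := fun l => M' * g l)) => [l|]; last by apply: (sum_leZ M0').
  by rewrite mulrC ler_wpM2r//; exact: lp_entry fM'.
exists (fun k => nsum (G^~ k)); split=> [k||k [i j]]; first exact: nsum_ge0.
  apply: (lp_fatou p1 G0) => [k|F|k]; [exact: nsum_ge0| |exact: nsum_below].
  under eq_fun do rewrite -mulr_sumr big_split/=.
  apply: (lpZ p1) => // [k|]; first by rewrite addr_ge0// fsum_ge0// => l; rewrite mulr_ge0.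
  apply: (lpD p1) => [k|k||]; try by apply: fsum_ge0 => l; rewrite mulr_ge0.
    apply: (@lp_schur _ _ p1 _ _ F (fun l k => g' (k - l)) f s' M s0' (fun l k => g0' _) f0 _ _ fM) => [k|l].
      exact: (@sum_le_inj _ _ _ (fun l => k - l) g' s' (@shift_inj k) gs').
    exact: (@sum_le_inj _ _ _ (fun k => k - l) g' s' (@shift_inj' l) gs').
  apply: (@lp_minkowski _ _ p1 _ _ F g (fun l k => f' (k - l)) s M' s0 g0 (fun l k => f'0 _) (gs F) M0') => l.
  exact: (@lp_inj _ _ p1 _ _ (fun k => k - l) f' M' (@shift_inj' l) fM').
rewrite /profile KK /= => <-.
rewrite -ler_pdivlMr ?wt_gt0//; apply: B_le.
apply: (sum_le_mono (g := fun l => G (i - l) (i - j) / w (i - j))) => [l|].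
  rewrite ler_pdivlMr ?wt_gt0//.
  rewrite /G (_ : i - j - (i - l) = l - j); last by rewrite opprB addrC addrA subrK.
  rewrite (le_trans (y := P * (w (i - l) + w (l - j)) * (A i l * A' l j)))//.
    rewrite mulrC ler_wpM2r ?mulr_ge0//.
    by have := wtD (i - l) (l - j) alpha0; rewrite addrA subrK.
  have -> : P * (w (i - l) + w (l - j)) * (A i l * A' l j) =
     P * (A' l j * (A i l * w (i - l)) + A i l * (A' l j * w (l - j))).
    by move: P (w (i - l)) (w (l - j)) (A i l) (A' l j); clear=> *; ring.
  rewrite ler_wpM2l// lerD//; apply: ler_pM; rewrite ?mulr_ge0 ?wt_ge0//.
    by apply: (fA _ (i, l)); rewrite /profile KK.
  by apply: (fA' _ (l, j)); rewrite /profile KK.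
move=> F; rewrite -mulr_suml ler_wpM2r ?invr_ge0 ?wt_ge0//.
have := @sum_le_inj _ _ _ (fun l => i - l) (G^~ (i - j)) (nsum (G^~ (i - j))) (@shift_inj i).
by apply; exact: nsum_ub (Gs _).
Qed.

(** If [|k| <= |i - j|], then [i - l] or [l - j] has norm at least [|k| / 2], hence at least that of
    [half k]. The entry at that place is bounded by the majorant at [half k], and the other one is
    summed over [l]. *)
Let bound_beurling : K = Beurling -> mat_le K p alpha B (P * (3 ^+ d * (s' * M + s * M'))).
Proof.
move=> KK; split; first by rewrite !mulr_ge0// ?exprn_ge0// addr_ge0// mulr_ge0.
move=> b; have [_ /(_ b)[f [f0 fM fA]]] := A_le.
have [_ /(_ b)[f' [f'0 fM' fA']]] := A'_le.
exists (fun k => P * (s' * f (half k) + s * f' (half k))); split=> [k||k [i j]].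
- by rewrite mulr_ge0// addr_ge0// mulr_ge0.
- have -> : 3 ^+ d * (s' * M + s * M') = s' * (3 ^+ d * M) + s * (3 ^+ d * M').
    by move: (3 ^+ d : R) s s' M M'; clear=> *; ring.
  apply: (lpZ p1) => // [k|]; first by rewrite addr_ge0// mulr_ge0.
  by apply: (lpD p1) => [k|k||]; rewrite ?mulr_ge0//; apply: (lpZ p1) => //; exact: lp_half.
rewrite /profile KK /= => kij; rewrite -ler_pdivlMr ?wt_gt0//; apply: B_le.
have key l : A i l * A' l j * w (i - j) <= P * (f (half k) * A' l j + f' (half k) * A i l).
  have := enormD_max (i - l) (l - j) (R := R); rewrite addrA subrK.
  have hk := enorm_half k (R := R).
  have near (x : L) : norm (i - j) <= 2 * norm x -> norm (half k) <= norm x.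
    move=> h; rewrite -(ler_pM2l (ltr0n R 2)); exact: le_trans (le_trans hk kij) h.
  have [_ h|_ h] := leP (norm (i - l)) (norm (l - j)).
    have h1 : A' l j * w (l - j) <= f' (half k) by apply: (fA' _ (l, j)); rewrite /profile KK /= near.
    rewrite (le_trans (y := P * (f' (half k) * A i l)))//; last first.
      by rewrite ler_wpM2l// lerDr mulr_ge0.
    rewrite (le_trans (y := A i l * A' l j * (P * w (l - j))))//.
      by rewrite ler_wpM2l ?mulr_ge0//; exact: wt_double.
    have -> : A i l * A' l j * (P * w (l - j)) = P * (A' l j * w (l - j) * A i l).
      by move: P (w (l - j)) (A i l) (A' l j); clear=> *; ring.
    by rewrite ler_wpM2l// ler_wpM2r.
  have h1 : A i l * w (i - l) <= f (half k) by apply: (fA _ (i, l)); rewrite /profile KK /= near.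
  rewrite (le_trans (y := P * (f (half k) * A' l j)))//; last first.
    by rewrite ler_wpM2l// lerDl mulr_ge0.
  rewrite (le_trans (y := A i l * A' l j * (P * w (i - l))))//.
    by rewrite ler_wpM2l ?mulr_ge0//; exact: wt_double.
  have -> : A i l * A' l j * (P * w (i - l)) = P * (A i l * w (i - l) * A' l j).
    by move: P (w (i - l)) (A i l) (A' l j); clear=> *; ring.
  by rewrite ler_wpM2l// ler_wpM2r.
move=> F; rewrite ler_pdivlMr ?wt_gt0// mulr_suml.
rewrite (le_trans (ler_sum _ (fun l _ => key l)))//.
rewrite -mulr_sumr ler_wpM2l// big_split/= -!mulr_sumr lerD//.
  by rewrite mulrC ler_wpM2r//; exact: A's.2.
by rewrite mulrC ler_wpM2r//; exact: As.1.
Qed.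

(** The bounds [s] and [s'] on the row and column sums are left open: [tail_sum] supplies them, with
    [n = 0] for the algebra property and with every [n] for the estimate of squares. *)
Lemma mat_mul : mat_le K p alpha B (2 `^ alpha * 3 ^+ d * (s' * M + s * M')).
Proof.
have sM : 0 <= s' * M + s * M' by rewrite addr_ge0// mulr_ge0.
have d3 : 1 <= 3 ^+ d :> R by rewrite exprn_ege1// ler1n.
have le3 : P * (s' * M + s * M') <= 2 `^ alpha * 3 ^+ d * (s' * M + s * M').
  by rewrite ler_wpM2r// ler_peMr.
case KK : K.
- by rewrite -KK; apply: (mat_weak p1 le3); exact: bound_schur.
- by rewrite -KK; apply: (mat_weak p1 le3); exact: bound_bgs.
- by rewrite -KK -mulrA; exact: bound_beurling.
Qed.

End MatrixProduct.

(** * Summation over the lattice *)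

Section CountingIntegral.
Context {R : realType} {d : nat}.
Local Notation L := (lattice d).
Local Notation mu := (@counting L R).

Lemma integral_point (k0 : L) (a : \bar R) :
  (\int[mu]_k (if k == k0 then a else 0) = a)%E.
Proof.
have -> : (fun k => if k == k0 then a else 0%E) = (cst a \_ [set k0] : L -> \bar R).
  apply/funext => k; rewrite /patch; case: eqP => [->|h]; first by rewrite mem_set.
  by rewrite memNset.
rewrite -integral_mkcond integral_cst//.
by rewrite /= /counting/= asboolT ?fset_set1 ?cardfs1 ?mule1//; exact: finite_set1.
Qed.

(** An enumeration of the lattice splits [f] into functions carried by single points; monotone
    convergence turns the integral into a series over the codes, which is then reindexed. *)
Lemma counting_esum (f : L -> \bar R) : (forall k, 0 <= f k)%E ->
  (\int[mu]_k f k = \esum_(k in setT) f k)%E.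
Proof.
move=> f0; pose g n (k : L) := if choice.pickle k == n then f k else 0%E.
pose h n : \bar R := if choice.pickle_inv n is Some k then f k else 0%E.
have g0 n k : (0 <= g n k)%E by rewrite /g; case: ifP.
have h0 n : (0 <= h n)%E by rewrite /h; case: (choice.pickle_inv n).
have gE n : (\int[mu]_k g n k = h n)%E.
  rewrite /h; case pE : (choice.pickle_inv n) => [k0|].
    rewrite -[RHS](integral_point k0); apply: eq_integral => k _; rewrite /g.
    have [->|kk0] := eqVneq k k0.
      by have := @choice.pickle_invK L n; rewrite /ocancel pE /= => ->; rewrite eqxx.
    case: eqP => // kn; move: kk0; rewrite -kn choice.pickleK_inv in pE.
    by case: pE => ->; rewrite eqxx.
  rewrite -[RHS](integral0 mu setT); apply: eq_integral => k _; rewrite /g.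
  by case: eqP => // kn; rewrite -kn choice.pickleK_inv in pE.
transitivity (\int[mu]_k \sum_(n <oo) g n k)%E.
  apply: eq_integral => k _; rewrite (@nneseries_split _ _ 0 (choice.pickle k).+1)// add0n.
  rewrite big_nat_recr//= big_nat big1 ?add0e => [|n /andP[_ nk]]; last first.
    by rewrite /g gtn_eqF.
  rewrite {1}/g eqxx eseries0 ?adde0// => n nk _; rewrite /g ltn_eqF//.
rewrite integral_nneseries//.
under eq_eseriesr do rewrite gE.
rewrite nneseries_esumT//.
have -> : (\esum_(n in setT) h n = \esum_(n in range (@choice.pickle L)) h n)%E.
  rewrite [RHS]esum_mkcond; apply: eq_esum => n _; case: ifPn => // nr.
  rewrite /h; case pE : (choice.pickle_inv n) => [k|//].
  have := @choice.pickle_invK L n; rewrite /ocancel pE /= => kn.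
  by case/negP: nr; rewrite inE; exists k.
rewrite (@reindex_esum R L nat setT (range (@choice.pickle L)) (@choice.pickle L) h).
  by apply: eq_esum => k _; rewrite /h choice.pickleK_inv.
by apply: inj_bij => x y _ _ /(pcan_inj (@choice.pickleK_inv L)).
Qed.

Lemma esum_nsum (f : L -> R) B : (forall k, 0 <= f k) -> sum_le f B ->
  (\esum_(k in setT) (f k)%:E = (nsum f)%:E)%E.
Proof.
move=> f0 fB; apply/eqP; rewrite eq_le; apply/andP; split.
  apply: ge_ereal_sup => _ [F [finF _] <-].
  by rewrite fsbig_finite//= sumEFin lee_fin; exact: (nsum_ub fB).
have [->|ninf] := eqVneq (\esum_(k in setT) (f k)%:E)%E +oo%E; first exact: leey.
have e0 : (0 <= \esum_(k in setT) (f k)%:E)%E by apply: esum_ge0 => k _; rewrite lee_fin.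
rewrite -[leRHS]fineK ?lee_fin; last by rewrite ge0_fin_numE// ltey.
apply: nsum_le => F; rewrite -lee_fin fineK; last by rewrite ge0_fin_numE// ltey.
apply: ereal_sup_ubound; exists [set` F]; first by split => //; exact: finite_fset.
by rewrite fsbig_finite//= set_fsetK sumEFin.
Qed.

Definition rsum (f : L -> R) : R := \int[mu]_k f k.

Lemma rsum_nsum (f : L -> R) B : (forall k, 0 <= f k) -> sum_le f B -> rsum f = nsum f.
Proof.
move=> f0 fB; rewrite /rsum /Rintegral counting_esum; last by move=> k; rewrite lee_fin.
by rewrite (esum_nsum f0 fB).
Qed.

Definition rsummable (f : L -> R) := exists B, sum_le (fun k => `|f k|) B.

Lemma rsummable_integrable f : rsummable f -> mu.-integrable setT (EFin \o f).
Proof.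
move=> [B fB]; apply/integrableP; split=> //.
rewrite counting_esum//; under eq_esum do rewrite /=.
by rewrite (@esum_nsum (fun k => `|f k|) B)// ltry.
Qed.

Lemma rsumD f g : rsummable f -> rsummable g -> rsum (fun k => f k + g k) = rsum f + rsum g.
Proof. by move=> hf hg; apply: RintegralD => //; exact: rsummable_integrable. Qed.

Lemma rsumB f g : rsummable f -> rsummable g -> rsum (fun k => f k - g k) = rsum f - rsum g.
Proof. by move=> hf hg; apply: RintegralB => //; exact: rsummable_integrable. Qed.

Lemma rsumZ c f : rsummable f -> rsum (fun k => c * f k) = c * rsum f.
Proof. by move=> hf; apply: RintegralZl => //; exact: rsummable_integrable. Qed.

Lemma rsum_le f g : rsummable f -> rsummable g -> (forall k, f k <= g k) -> rsum f <= rsum g.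
Proof. by move=> hf hg fg; apply: le_Rintegral => //; exact: rsummable_integrable. Qed.

Lemma rsummable_nonneg f B : (forall k, 0 <= f k) -> sum_le f B -> rsummable f.
Proof. by move=> f0 fB; exists B => F; under eq_bigr do rewrite ger0_norm//. Qed.

Lemma nsumD (f g : L -> R) A B : (forall k, 0 <= f k) -> (forall k, 0 <= g k) ->
  sum_le f A -> sum_le g B -> nsum (fun k => f k + g k) = nsum f + nsum g.
Proof.
move=> f0 g0 fA gB; rewrite -(rsum_nsum f0 fA) -(rsum_nsum g0 gB) -rsumD.
- by rewrite (@rsum_nsum (fun k => f k + g k) (A + B))// => [k|]; [exact: addr_ge0|exact: sum_leD].
- exact: rsummable_nonneg fA.
- exact: rsummable_nonneg gB.
Qed.

Lemma nsum_sum (I : choiceType) (F : {fset I}) (f : I -> L -> R) B :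
  (forall i k, 0 <= f i k) -> (forall i, sum_le (f i) B) ->
  \sum_(i <- F) nsum (f i) = nsum (fun k => \sum_(i <- F) f i k).
Proof.
move=> f0 fB; have key (s : seq I) : \sum_(i <- s) nsum (f i) = nsum (fun k => \sum_(i <- s) f i k)
    /\ exists C, sum_le (fun k => \sum_(i <- s) f i k) C.
  elim: s => [|i s [IH [C hC]]].
    split; last by exists 0 => F'; rewrite big1// => k _; rewrite big_nil.
    have z : sum_le (fun k : L => \sum_(i <- [::]) f i k) 0.
      by move=> F'; rewrite big1// => k _; rewrite big_nil.
    rewrite big_nil; apply/eqP; rewrite eq_le (nsum_le z) andbT.
    by apply: (nsum_ge0 _ z) => k; rewrite big_nil.
  rewrite big_cons IH -(nsumD _ _ (fB i) hC)//; last by move=> k; apply: sumr_ge0.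
  split; first by congr nsum; apply/funext => k; rewrite big_cons.
  by exists (B + C); under eq_fun do rewrite big_cons; apply: sum_leD.
by case: (key F).
Qed.

Definition rsummable2 (f : L -> L -> R) := exists B, forall F G : {fset L},
  \sum_(k <- F) \sum_(l <- G) `|f k l| <= B.

Lemma rsummable2_row f k : rsummable2 f -> rsummable (f k).
Proof. by move=> [B h]; exists B => F; have := h [fset k]%fset F; rewrite big_seq_fset1. Qed.

Lemma rsummable2_tr f : rsummable2 f -> rsummable2 (fun k l => f l k).
Proof. by move=> [B h]; exists B => F G; rewrite exchange_big. Qed.

Lemma nsum_rows (f : L -> L -> R) B : (forall k l, 0 <= f k l) ->
  (forall F G : {fset L}, \sum_(k <- F) \sum_(l <- G) f k l <= B) ->
  sum_le (fun k => nsum (f k)) B.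
Proof.
move=> f0 h F; rewrite (@nsum_sum _ _ f B)// => [|k G]; last first.
  by have := h [fset k]%fset G; rewrite big_seq_fset1.
by apply: nsum_le => G; rewrite exchange_big.
Qed.

Lemma nsum_exchange (f : L -> L -> R) B : (forall k l, 0 <= f k l) ->
  (forall F G : {fset L}, \sum_(k <- F) \sum_(l <- G) f k l <= B) ->
  nsum (fun k => nsum (f k)) = nsum (fun l => nsum (f^~ l)).
Proof.
have le (g : L -> L -> R) : (forall k l, 0 <= g k l) ->
    (forall F G : {fset L}, \sum_(k <- F) \sum_(l <- G) g k l <= B) ->
    nsum (fun k => nsum (g k)) <= nsum (fun l => nsum (g^~ l)).
  move=> g0 h; have row k : sum_le (g k) B.
    by move=> G; have := h [fset k]%fset G; rewrite big_seq_fset1.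
  have col l : sum_le (g^~ l) B.
    by move=> G; have := h G [fset l]%fset; under eq_bigr do rewrite big_seq_fset1.
  have cols : sum_le (fun l => nsum (g^~ l)) B.
    by apply: nsum_rows => // F G; rewrite exchange_big.
  apply: (@nsum_le _ _ (fun k => nsum (g k))) => F; rewrite (nsum_sum _ _ row)//.
  apply: nsum_le => G; apply: (le_trans _ (nsum_ub cols G)); apply: ler_sum => l _.
  exact: (nsum_ub (col l)).
move=> f0 h; apply/eqP; rewrite eq_le !le// => F G.
by rewrite exchange_big.
Qed.

Definition posp (x : R) := Num.max x 0.

Lemma posp_ge0 x : 0 <= posp x. Proof. by rewrite le_max lexx orbT. Qed.
Lemma posp_le x : posp x <= `|x|. Proof. by rewrite ge_max ler_norm normr_ge0. Qed.
Lemma pospB x : x = posp x - posp (- x).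
Proof. by rewrite /posp; case: (ltP x 0) => h; case: ltP => h'; lra. Qed.

Lemma rsum_posp f : rsummable f ->
  rsum f = nsum (fun k => posp (f k)) - nsum (fun k => posp (- f k)).
Proof.
move=> [B fB].
have h1 : sum_le (fun k => posp (f k)) B by apply: sum_le_mono fB => k; exact: posp_le.
have h2 : sum_le (fun k => posp (- f k)) B.
  by apply: sum_le_mono fB => k; rewrite -normrN posp_le.
rewrite -(rsum_nsum _ h1) => [|k]; last exact: posp_ge0.
rewrite -(rsum_nsum _ h2) => [|k]; last exact: posp_ge0.
rewrite -rsumB.
- by congr rsum; apply/funext => k; exact: pospB.
- by apply: rsummable_nonneg h1 => k; exact: posp_ge0.
- by apply: rsummable_nonneg h2 => k; exact: posp_ge0.
Qed.

(** Fubini's theorem from Tonelli's, applied to the positive and negative parts. *)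
Lemma rsum_exchange (f : L -> L -> R) : rsummable2 f ->
  rsum (fun k => rsum (f k)) = rsum (fun l => rsum (f^~ l)).
Proof.
move=> f2.
have key (g : L -> L -> R) : rsummable2 g -> exists2 B,
    (forall F G : {fset L}, \sum_(k <- F) \sum_(l <- G) posp (g k l) <= B) &
    rsummable (fun k => nsum (fun l => posp (g k l))).
  move=> [B h]; have h' (F G : {fset L}) : \sum_(k <- F) \sum_(l <- G) posp (g k l) <= B.
    rewrite (le_trans _ (h F G))//; apply: ler_sum => k _; apply: ler_sum => l _.
    exact: posp_le.
  exists B => //; apply: (@rsummable_nonneg _ B) => [k|].
    apply: (@nsum_ge0 _ _ _ B) => [l|G]; first exact: posp_ge0.
    by have := h' [fset k]%fset G; rewrite big_seq_fset1.
  by apply: nsum_rows => // k l; exact: posp_ge0.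
have N2 (g : L -> L -> R) : rsummable2 g -> rsummable2 (fun k l => - g k l).
  by move=> [B h]; exists B => F G; under eq_bigr do under eq_bigr do rewrite normrN.
have side (g : L -> L -> R) : rsummable2 g -> rsum (fun k => rsum (g k)) =
    nsum (fun k => nsum (fun l => posp (g k l))) - nsum (fun k => nsum (fun l => posp (- g k l))).
  move=> g2; have [B hB s1] := key g g2; have [C hC s2] := key _ (N2 _ g2).
  have -> : (fun k => rsum (g k)) =
      (fun k => nsum (fun l => posp (g k l)) - nsum (fun l => posp (- g k l))).
    by apply/funext => k; apply: rsum_posp; exact: rsummable2_row.
  have pp (u : L -> L -> R) D : (forall F G : {fset L}, \sum_(k <- F) \sum_(l <- G) posp (u k l) <= D) ->
      rsum (fun k => nsum (fun l => posp (u k l))) = nsum (fun k => nsum (fun l => posp (u k l))).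
    move=> h; apply: (@rsum_nsum _ D) => [k|].
      apply: (@nsum_ge0 _ _ _ D) => [l|G]; first exact: posp_ge0.
      by have := h [fset k]%fset G; rewrite big_seq_fset1.
    by apply: nsum_rows => // k l; exact: posp_ge0.
  by rewrite rsumB// (pp _ B)// (pp (fun k l => - g k l) C).
rewrite (side f f2) (side (fun k l => f l k) (rsummable2_tr f2)).
have [B hB _] := key f f2; have [C hC _] := key _ (N2 _ f2).
by congr (_ - _); [apply: (nsum_exchange (B := B))|apply: (nsum_exchange (B := C))] => // k l; exact: posp_ge0.
Qed.

End CountingIntegral.

Section ComplexSums.
Context {R : realType} {d : nat}.
Local Notation L := (lattice d).
Local Notation C := R[i].
Implicit Types (f g : L -> C) (z c : C).

Lemma csumE f : csum f = (rsum (fun k => complex.Re (f k)) +i* rsum (fun k => complex.Im (f k)))%C.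
Proof. by []. Qed.

Lemma eq_csum f g : f =1 g -> csum f = csum g.
Proof. by move=> /funext ->. Qed.

Definition csummable f := exists B, sum_le (fun k => cabs (f k)) B.

Lemma csummable_mono f g : (forall k, cabs (f k) <= cabs (g k)) -> csummable g -> csummable f.
Proof. by move=> fg [B gB]; exists B; exact: sum_le_mono gB. Qed.

Lemma csummableZ c f : csummable f -> csummable (fun k => c * f k).
Proof.
move=> [B fB]; exists (cabs c * B).
by apply: sum_le_mono (sum_leZ (cabs_ge0 c) fB) => k; rewrite cabsM.
Qed.

Lemma csummableN f : csummable f -> csummable (fun k => - f k).
Proof. by apply: csummable_mono => k; rewrite cabsN. Qed.

Lemma csummable_Re f : csummable f -> rsummable (fun k => complex.Re (f k)).
Proof. by move=> [B fB]; exists B; apply: sum_le_mono fB => k; exact: cabs_ge_Re. Qed.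

Lemma csummable_Im f : csummable f -> rsummable (fun k => complex.Im (f k)).
Proof. by move=> [B fB]; exists B; apply: sum_le_mono fB => k; exact: cabs_ge_Im. Qed.

Lemma csumD f g : csummable f -> csummable g -> csum (fun k => f k + g k) = csum f + csum g.
Proof.
move=> hf hg; have [f1 f2] := (csummable_Re hf, csummable_Im hf).
have [g1 g2] := (csummable_Re hg, csummable_Im hg).
rewrite !csumE; apply/eqP; rewrite eq_complex /= -!rsumD//.
by apply/andP; split; apply/eqP; congr rsum; apply/funext => k; case: (f k); case: (g k).
Qed.

Lemma csumZ c f : csummable f -> csum (fun k => c * f k) = c * csum f.
Proof.
move=> hf; have [f1 f2] := (csummable_Re hf, csummable_Im hf).
case: c => a b; rewrite !csumE; apply/eqP; rewrite eq_complex /=.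
have rZ x (h : L -> R) : rsummable h -> rsummable (fun k => x * h k).
  move=> [B hB]; exists (`|x| * B).
  by apply: sum_le_mono (sum_leZ (normr_ge0 x) hB) => k; rewrite normrM.
rewrite -(rsumZ a f1) -(rsumZ b f2) -(rsumZ a f2) -(rsumZ b f1).
rewrite -(rsumB (rZ a _ f1) (rZ b _ f2)) -(rsumD (rZ a _ f2) (rZ b _ f1)).
by apply/andP; split; apply/eqP; congr rsum; apply/funext => k; case: (f k).
Qed.

Lemma csumB f g : csummable f -> csummable g -> csum (fun k => f k - g k) = csum f - csum g.
Proof.
move=> hf hg; rewrite csumD//; last exact: csummableN.
congr (_ + _); rewrite -[RHS]mulN1r -csumZ//.
by apply: eq_csum => k; rewrite mulN1r.
Qed.

Lemma csum_conj f : csummable f -> csum (fun k => conjc (f k)) = conjc (csum f).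
Proof.
move=> hf; rewrite !csumE; apply/eqP; rewrite eq_complex /=; apply/andP; split; apply/eqP.
  by congr rsum; apply/funext => k; case: (f k).
rewrite -mulN1r -rsumZ; last exact: csummable_Im.
by congr rsum; apply/funext => k; case: (f k) => a b; rewrite mulN1r.
Qed.

Lemma csum_real (h : L -> R) B : (forall k, 0 <= h k) -> sum_le h B ->
  csum (fun k => (h k)%:C%C) = (nsum h)%:C%C.
Proof.
move=> h0 hB; rewrite csumE /= (rsum_nsum h0 hB); congr Complex.
have z : sum_le (fun k : L => 0 : R) 0 by move=> F; rewrite big1.
by rewrite (rsum_nsum _ z)//; apply/eqP; rewrite eq_le (nsum_le z) (nsum_ge0 _ z).
Qed.

Lemma mul_conjc z : z * conjc z = (cabs z ^+ 2)%:C%C.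
Proof.
case: z => a b; rewrite /cabs /= sqr_sqrtr ?addr_ge0 ?sqr_ge0//.
by apply/eqP; rewrite eq_complex /=; apply/andP; split; apply/eqP; ring.
Qed.

(** A factor [om] of modulus one makes the sum real and nonnegative, so only real parts need
    comparing. *)
Lemma csum_below f : below_sum (cabs (csum f)) (fun k => cabs (f k)).
Proof.
move=> B fB; have hf : csummable f by exists B.
have [->|S0] := eqVneq (csum f) 0.
  by rewrite cabs0; have := fB fset0; rewrite big_seq_fset0.
have S1 : 0 < cabs (csum f) by rewrite cabs_gt0.
pose om := conjc (csum f) / (cabs (csum f))%:C%C.
have om1 : cabs om = 1.
  by rewrite cabsM cabsV cabs_conj cabs_real ger0_norm ?cabs_ge0// divff// gt_eqF.
have omS : om * csum f = (cabs (csum f))%:C%C.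
  have S2 : (cabs (csum f))%:C%C != 0 :> C.
    by apply: contra_neq (lt0r_neq0 S1) => -[].
  by rewrite /om mulrAC [_ * csum f]mulrC mul_conjc expr2 (rmorphM (real_complex R)) mulfK.
have -> : cabs (csum f) = rsum (fun k => complex.Re (om * f k)).
  by have := csumZ om hf; rewrite omS csumE => -[-> _].
have h1 := csummable_Re (csummableZ om hf).
have h2 : rsummable (fun k => cabs (f k)).
  by apply: (@rsummable_nonneg _ _ _ B) => // k; exact: cabs_ge0.
rewrite (le_trans (rsum_le h1 h2 _))//.
  by move=> k; rewrite (le_trans (ler_norm _))// (le_trans (cabs_ge_Re _))// cabsM om1 mul1r.
rewrite (@rsum_nsum _ _ _ B)//; last by move=> k; exact: cabs_ge0.
exact: nsum_le.
Qed.

Lemma csum_delta i f : csum (fun k => (i == k)%:R * f k) = f i.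
Proof.
have -> : (fun k => (i == k)%:R * f k) = (fun k => f i * ((i == k)%:R : R)%:C%C).
  by apply/funext => k; case: eqP => [->|_]; rewrite ?mul1r ?mulr1 ?mul0r ?mulr0.
have d0 k : 0 <= (i == k)%:R :> R by [].
have d1 : sum_le (fun k => (i == k)%:R : R) 1.
  have [_] := @lp_delta R 1%:E (lexx _) L i; rewrite powR1.
  apply: sum_le_mono => k; by rewrite eq_sym; case: eqP => _; rewrite ?powR1 ?powR0 ?oner_eq0.
have -> : csum (fun k => f i * ((i == k)%:R : R)%:C%C) = f i * csum (fun k => ((i == k)%:R : R)%:C%C).
  by apply: csumZ; exists 1; apply: sum_le_mono d1 => k; rewrite cabs_real ger0_norm.
rewrite (csum_real d0 d1); have -> : nsum (fun k => (i == k)%:R) = 1 :> R.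
  apply/eqP; rewrite eq_le (nsum_le d1)/=.
  by have := nsum_ub d1 [fset i]%fset; rewrite fsum1 eqxx.
by rewrite mulr1.
Qed.

Lemma csum_exchange (f : L -> L -> C) :
  (exists B, forall F G : {fset L}, \sum_(k <- F) \sum_(l <- G) cabs (f k l) <= B) ->
  csum (fun k => csum (f k)) = csum (fun l => csum (f^~ l)).
Proof.
move=> [B h]; rewrite !csumE /=.
have r1 : rsummable2 (fun k l => complex.Re (f k l)).
  exists B => F G; rewrite (le_trans _ (h F G))//.
  by apply: ler_sum => k _; apply: ler_sum => l _; exact: cabs_ge_Re.
have r2 : rsummable2 (fun k l => complex.Im (f k l)).
  exists B => F G; rewrite (le_trans _ (h F G))//.
  by apply: ler_sum => k _; apply: ler_sum => l _; exact: cabs_ge_Im.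
by rewrite (rsum_exchange r1) (rsum_exchange r2).
Qed.

Lemma csum_assoc (x y : L -> C) (A : L -> L -> C) :
  (exists B, forall F G : {fset L},
     \sum_(k <- F) \sum_(l <- G) cabs (x k) * cabs (A k l) * cabs (y l) <= B) ->
  csum (fun l => csum (fun k => x k * A k l) * y l) =
  csum (fun k => x k * csum (fun l => A k l * y l)).
Proof.
move=> [B h].
(* The bound makes a column summable only where [y] does not vanish; elsewhere the product is [0]
   whatever default the integral takes. The rows and [x] are treated alike. *)
have col l : csummable (fun k => x k * A k l) \/ y l = 0.
  have [|y0] := eqVneq (y l) 0; [by right|left].
  have y1 : 0 < cabs (y l) by rewrite cabs_gt0.
  exists (B / cabs (y l)) => F; rewrite ler_pdivlMr// mulr_suml.
  have := h F [fset l]%fset; under eq_bigr do rewrite big_seq_fset1.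
  by apply: le_trans; apply: ler_sum => k _; rewrite cabsM.
have row k : csummable (fun l => A k l * y l) \/ x k = 0.
  have [|x0] := eqVneq (x k) 0; [by right|left].
  have x1 : 0 < cabs (x k) by rewrite cabs_gt0.
  exists (B / cabs (x k)) => F; rewrite ler_pdivlMr// mulr_suml.
  have := h [fset k]%fset F; rewrite big_seq_fset1.
  by apply: le_trans; apply: ler_sum => l _; rewrite cabsM mulrC mulrA.
have -> : (fun l => csum (fun k => x k * A k l) * y l) =
    (fun l => csum (fun k => x k * A k l * y l)).
  apply/funext => l; case: (col l) => [hl|->].
    by rewrite mulrC -csumZ//; apply: eq_csum => k; rewrite mulrC.
  rewrite mulr0 -[LHS](@csum_delta 0 (fun=> 0)); apply: eq_csum => k; by rewrite !mulr0.
have -> : (fun k => x k * csum (fun l => A k l * y l)) =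
    (fun k => csum (fun l => x k * A k l * y l)).
  apply/funext => k; case: (row k) => [hl|->].
    by rewrite -csumZ//; apply: eq_csum => l; rewrite mulrA.
  rewrite mul0r -[LHS](@csum_delta 0 (fun=> 0)); apply: eq_csum => l; by rewrite !mul0r mulr0.
rewrite (@csum_exchange (fun l k => x k * A k l * y l))//.
exists B => F G; rewrite exchange_big/= (le_trans _ (h G F))//.
by apply: ler_sum => k _; apply: ler_sum => l _; rewrite !cabsM.
Qed.

End ComplexSums.

(** * Integral norms for the counting measure *)

Lemma poweR_mono {R : realType} (x y : \bar R) (r : R) : 0 <= r -> (0 <= x)%E -> (x <= y)%E ->
  (x `^ r <= y `^ r)%E.
Proof.
move=> r0 x0 xy; apply: gt0_ler_poweR => //; rewrite in_itv/= ?x0 ?(le_trans x0 xy) ?leey//.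
Qed.

Section LnormBridge.
Context {R : realType} {d : nat} (p : \bar R) (p1 : (1 <= p)%E).
Local Notation L := (lattice d).
Local Notation mu := (@counting L R).

(** Only the empty set is negligible for the counting measure, so essential suprema are suprema. *)
Lemma counting_ae (Q : L -> Prop) : (\forall x \ae mu, Q x) -> forall x, Q x.
Proof.
move=> [N [_ N0 QN]] x; apply: contrapT => nQ.
have : (mu [set x] <= mu N)%E by apply: le_measure => //; rewrite ?inE// => _ ->; exact: QN.
rewrite N0 /= /counting/= asboolT ?fset_set1 ?cardfs1; last exact: finite_set1.
by rewrite lee_fin ler10.
Qed.

Lemma counting_gt0 : (0 < mu [set: L])%E.
Proof.
rewrite (@lt_le_trans _ _ (mu [set 0]))//; last by apply: le_measure => //; rewrite inE.
by rewrite /= /counting/= asboolT ?fset_set1 ?cardfs1 ?lte_fin//; exact: finite_set1.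
Qed.

Lemma lnorm_le (f : L -> R) M : 0 <= M -> (forall k, 0 <= f k) ->
  (lnorm p (EFin \o f) <= M%:E)%E <-> lp_le p f M.
Proof.
move=> M0 f0; rewrite /lnorm unlock /lp_le; move: p1; case: p => [r|_|//]; last first.
  rewrite counting_gt0; split=> [|[_ h]].
    move=> /ess_supP/counting_ae h; split=> // k; have := h k.
    by rewrite /= ger0_norm// lee_fin.
  by apply/ess_supP; apply: nearW => k; rewrite /= ger0_norm// lee_fin.
rewrite lee_fin => r1; have r0 : 0 < r by rewrite (lt_le_trans ltr01).
have -> : (\int[mu]_k `|(EFin \o f) k| `^ r = \esum_(k in setT) (f k `^ r)%:E)%E.
  rewrite counting_esum => [|k]; last exact: poweR_ge0.
  by apply: eq_esum => k _; rewrite /= ger0_norm// poweR_EFin.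
have fr0 k : 0 <= f k `^ r := powR_ge0 _ _.
split=> [h|[_ fM]]; last first.
  rewrite (esum_nsum fr0 fM) poweR_EFin lee_fin -powR_root//; last exact: nsum_ge0 fM.
  exact: nsum_le.
split=> //; set S := esum _ _ in h.
have S0 : (0 <= S)%E by apply: esum_ge0 => k _; rewrite lee_fin.
have Sfin : S \is a fin_num.
  rewrite ge0_fin_numE// ltey; apply/eqP => Sy; move: h.
  by rewrite Sy poweRyr ?invr_eq0 ?gt_eqF.
move: h; rewrite -(fineK Sfin) poweR_EFin lee_fin -powR_root ?fine_ge0// => h F.
rewrite (le_trans _ h)// -lee_fin fineK//.
apply: ereal_sup_ubound; exists [set` F]; first by split => //; exact: finite_fset.
by rewrite fsbig_finite//= set_fsetK sumEFin.
Qed.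

(** Needed for extended values: a finite norm forces the suprema inside the matrix norms to be
    finite. *)
Lemma lnorm_ge (g : L -> \bar R) k : (forall k, 0 <= g k)%E -> (g k <= lnorm p g)%E.
Proof.
move=> g0; rewrite /lnorm unlock; move: p1; case: p => [r|_|//]; last first.
  rewrite counting_gt0; have /counting_ae/(_ k) := ess_sup_ge mu (abse \o g).
  by rewrite /= gee0_abs.
rewrite lee_fin => r1; have r0 : 0 < r by rewrite (lt_le_trans ltr01).
rewrite counting_esum => [|j]; last exact: poweR_ge0.
have -> : (g k = (g k `^ r) `^ r^-1)%E by rewrite -poweRrM divff ?gt_eqF// poweRe1.
have S0 j : (0 <= `|g j| `^ r)%E by exact: poweR_ge0.
apply: poweR_mono; [by rewrite invr_ge0 ltW|exact: poweR_ge0|].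
rewrite -{1}(gee0_abs (g0 k)).
apply: ereal_sup_ubound; exists [set k]; first by split => //; exact: finite_set1.
by rewrite fsbig_set1.
Qed.

Lemma lnorm_mono (f g : L -> \bar R) : (forall k, 0 <= f k <= g k)%E ->
  (lnorm p f <= lnorm p g)%E.
Proof.
move=> fg; have f0 k : (0 <= f k)%E by case/andP: (fg k).
have g0 k : (0 <= g k)%E by case/andP: (fg k) => a b; exact: le_trans b.
have fg' k : (f k <= g k)%E by case/andP: (fg k).
rewrite /lnorm unlock; move: p1; case: p => [r|_|//]; last first.
  rewrite counting_gt0; apply: le_ess_sup; apply: nearW => k.
  by rewrite /= !gee0_abs.
rewrite lee_fin => r1; have r0 : 0 < r by rewrite (lt_le_trans ltr01).
rewrite !counting_esum => [|j|j]; try exact: poweR_ge0.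
apply: poweR_mono; first by rewrite invr_ge0 ltW.
  by apply: esum_ge0 => k _; exact: poweR_ge0.
apply: le_esum => k _; apply: poweR_mono; [exact: ltW|exact: abse_ge0|].
by rewrite !gee0_abs.
Qed.

End LnormBridge.

Section AlgNormBridge.
Context {R : realType} {d : nat} (K : algebra_kind) (p : \bar R) (p1 : (1 <= p)%E) (alpha : R).
Local Notation L := (lattice d).
Local Notation norm := (@enorm R d).
Implicit Types A : imatrix R d.

Definition absm A : L -> L -> R := fun i j => cabs (A i j).

(** When the norm is finite the suprema themselves serve as [f]. Nonempty sets [S k] keep them from
    being [-oo]. *)
Let sup_profile_le (S : L -> set (L * L)) A (M : R) : 0 <= M -> (forall k, S k !=set0) ->
  (lnorm p (fun k => ereal_sup [set wentry alpha A ij.1 ij.2 | ij in S k]) <= M%:E)%E <->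
  exists f, [/\ forall k, 0 <= f k, lp_le p f M &
    forall k ij, S k ij -> absm A ij.1 ij.2 * wt alpha (ij.1 - ij.2) <= f k].
Proof.
move=> M0 Sn; set g := fun k => _; have ent0 i j : (0 <= wentry alpha A i j)%E.
  by rewrite lee_fin mulr_ge0 ?cabs_ge0 ?powR_ge0.
have g0 k : (0 <= g k)%E.
  have [ij Sij] := Sn k; apply: le_trans (ent0 ij.1 ij.2) _.
  by apply: ereal_sup_ubound; exists ij.
split=> [h|[f [f0 fM fA]]]; last first.
  rewrite (le_trans (lnorm_mono p1 (g := EFin \o f) _))//; last exact/(lnorm_le p1 M0 f0).
  by move=> k; rewrite g0/=; apply: ge_ereal_sup => _ [ij Sij <-]; rewrite lee_fin fA.
have gfin k : g k \is a fin_num.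
  by rewrite ge0_fin_numE// (le_lt_trans (le_trans (lnorm_ge p1 k g0) h))// ltry.
have gE : g = EFin \o (fine \o g) by apply/funext => k /=; rewrite fineK.
exists (fine \o g); split=> [k||k ij Sij].
- by rewrite fine_ge0.
- by apply/(lnorm_le p1 M0); [move=> k; rewrite fine_ge0|rewrite -gE].
- rewrite -lee_fin fineK//; apply: ereal_sup_ubound; by exists ij.
Qed.

Lemma alg_normP A (M : R) : 0 <= M ->
  (alg_norm K p alpha A <= M%:E)%E <-> mat_le K p alpha (absm A) M.
Proof.
move=> M0; rewrite /mat_le /profile; case: K => /=.
- rewrite /schur_norm ge_max; split.
    move=> /andP[h1 h2]; split=> // -[[] n].
      exists (fun j => absm A n j * wt alpha (n - j)); split => [k||k ij ->//].
        by rewrite mulr_ge0 ?cabs_ge0 ?wt_ge0.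
      apply/(lnorm_le p1 M0) => [k|]; first by rewrite mulr_ge0 ?cabs_ge0 ?wt_ge0.
      by apply: le_trans h1; apply: ereal_sup_ubound; exists n.
    exists (fun i => absm A i n * wt alpha (i - n)); split => [k||k ij ->//].
      by rewrite mulr_ge0 ?cabs_ge0 ?wt_ge0.
    apply/(lnorm_le p1 M0) => [k|]; first by rewrite mulr_ge0 ?cabs_ge0 ?wt_ge0.
    by apply: le_trans h2; apply: ereal_sup_ubound; exists n.
  move=> [_ h]; apply/andP; split; apply: ge_ereal_sup => _ [n _ <-].
    have [f [f0 fM fA]] := h (true, n).
    have n0 k : 0 <= absm A n k * wt alpha (n - k) by rewrite mulr_ge0 ?cabs_ge0 ?wt_ge0.
    apply/(@lnorm_le _ _ _ p1 (fun k => absm A n k * wt alpha (n - k)) _ M0 n0).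
    by apply: (lp_mono p1) fM => k; rewrite n0 (fA k (n, k)).
  have [f [f0 fM fA]] := h (false, n).
  have n0 k : 0 <= absm A k n * wt alpha (k - n) by rewrite mulr_ge0 ?cabs_ge0 ?wt_ge0.
  apply/(@lnorm_le _ _ _ p1 (fun k => absm A k n * wt alpha (k - n)) _ M0 n0).
  by apply: (lp_mono p1) fM => k; rewrite n0 (fA k (k, n)).
- have Sn (k : L) : [set ij : L * L | ij.1 - ij.2 = k] !=set0.
    by exists (k, 0) => /=; rewrite subr0.
  split=> [/(sup_profile_le _ M0 Sn) h|[_ /(_ (true, 0)) h]]; last exact/(sup_profile_le _ M0 Sn).
  by split.
- have Sn (k : L) : [set ij : L * L | norm k <= norm (ij.1 - ij.2)] !=set0.
    by exists (k, 0) => /=; rewrite subr0.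
  split=> [/(sup_profile_le _ M0 Sn) h|[_ /(_ (true, 0)) h]]; last exact/(sup_profile_le _ M0 Sn).
  by split.
Qed.

Lemma lnorm_ge0 (f : L -> \bar R) : (0 <= lnorm p f)%E.
Proof. exact: Lnorm_ge0. Qed.

Lemma alg_norm_ge0 A : (0 <= alg_norm K p alpha A)%E.
Proof.
case: K; rewrite /= ?lnorm_ge0// /schur_norm le_max; apply/orP; left.
apply: le_trans (lnorm_ge0 (fun j => wentry alpha A 0 j)) _.
by apply: ereal_sup_ubound; exists 0.
Qed.

Lemma algP A : alg K p alpha A <-> mat_le K p alpha (absm A) (fine (alg_norm K p alpha A)).
Proof.
have h0 := alg_norm_ge0 A.
split=> [h|[_ h]].
  by apply/alg_normP; rewrite ?fine_ge0// fineK// ge0_fin_numE.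
have /alg_normP : mat_le K p alpha (absm A) (fine (alg_norm K p alpha A)).
  by split => //; exact: fine_ge0.
by move=> /(_ (fine_ge0 h0)) /le_lt_trans; apply; exact: ltry.
Qed.

Lemma alg_of_mat_le A M : mat_le K p alpha (absm A) M ->
  alg K p alpha A /\ fine (alg_norm K p alpha A) <= M.
Proof.
move=> h; have M0 : 0 <= M by case: h.
have hA := (alg_normP A M0).2 h.
have fin : alg_norm K p alpha A \is a fin_num.
  by rewrite ge0_fin_numE ?alg_norm_ge0// (le_lt_trans hA)// ltry.
split; first by rewrite /alg /= -ge0_fin_numE ?alg_norm_ge0.
by rewrite -lee_fin fineK.
Qed.

End AlgNormBridge.

Lemma dual_exp_lt {R : realType} d (p : \bar R) (alpha : R) : (1 <= p)%E ->
  (d%:R%:E - d%:R%:E / p < alpha%:E)%E -> d%:R * dual_exp p < alpha.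
Proof.
case: p => [r|_|//]; rewrite /dual_exp.
  rewrite lee_fin => r1; have r0 : r != 0 by rewrite gt_eqF// (lt_le_trans ltr01).
  by rewrite inver (negPf r0) -EFinM -EFinB lte_fin mulrBr mulr1.
by rewrite invey mule0 sube0 lte_fin mulr1.
Qed.

(** * The algebra of matrices *)

Section MatrixBounds.
Context {R : realType} {d : nat} (K : algebra_kind) (p : \bar R) (p1 : (1 <= p)%E)
  (alpha : R) (alpha_gt : d%:R * dual_exp p < alpha).
Local Notation L := (lattice d).
Implicit Types A B : L -> L -> R.

Lemma mat_sums : exists2 c, 0 < c & forall A M, (forall i j, 0 <= A i j) ->
  mat_le K p alpha A M ->
  (forall i, sum_le (A i) (c * M)) /\ (forall j, sum_le (A^~ j) (c * M)).
Proof.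
have [c [D [t [c0 D1 t0 t1 ts]]]] := @tail_sum R d p p1 alpha alpha_gt.
exists (c *+ 2); first by rewrite pmulrn_lgt0.
move=> A M A0 AM; have Ab i j : 0 <= A i j <= M.
  by rewrite A0 (mat_entry p1 alpha_gt i j A0 AM).
have E : c *+ 2 * M = c * (D ^+ 0 * M + t ^+ 0 * M) by rewrite !expr0; ring.
by rewrite E; apply: (row_sum_le p1 Ab AM) => h f hM hf fM; exact: ts hM hf fM 0%N.
Qed.

Lemma mat_mul_bound : exists2 c, 0 < c & forall A A' B M M',
  (forall i j, 0 <= A i j) -> (forall i j, 0 <= A' i j) -> (forall i j, 0 <= B i j) ->
  mat_le K p alpha A M -> mat_le K p alpha A' M' ->
  (forall i j, below_sum (B i j) (fun l => A i l * A' l j)) -> mat_le K p alpha B (c * M * M').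
Proof.
have [c [D [t [c0 D1 t0 t1 ts]]]] := @tail_sum R d p p1 alpha alpha_gt.
exists (2 `^ alpha * 3 ^+ d * (c *+ 4)).
  by rewrite !mulr_gt0 ?powR_gt0 ?exprn_gt0 ?pmulrn_lgt0.
move=> A A' B M M' A0 A'0 B0 AM A'M BA.
have Ab i j : 0 <= A i j <= M by rewrite A0 (mat_entry p1 alpha_gt i j A0 AM).
have A'b i j : 0 <= A' i j <= M' by rewrite A'0 (mat_entry p1 alpha_gt i j A'0 A'M).
have := mat_mul p1 alpha_gt Ab A'b B0 AM A'M BA
  (fun h f hM hf fM => ts h f M M hM hf fM 0%N) (fun h f hM hf fM => ts h f M' M' hM hf fM 0%N).
by rewrite !expr0; congr (mat_le _ _ _ _ _); ring.
Qed.

Lemma mat_sqr_bound : exists c D t, [/\ 0 < c, 1 <= D, 0 < t, t < 1 & forall A B m0 M,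
  (forall i j, 0 <= A i j <= m0) -> (forall i j, 0 <= B i j) ->
  mat_le K p alpha A M ->
  (forall i j, below_sum (B i j) (fun l => A i l * A l j)) ->
  forall n, mat_le K p alpha B (c * M * (D ^+ n * m0 + t ^+ n * M))].
Proof.
have [c [D [t [c0 D1 t0 t1 ts]]]] := @tail_sum R d p p1 alpha alpha_gt.
exists (2 `^ alpha * 3 ^+ d * (c *+ 2)), D, t; split => //.
  by rewrite !mulr_gt0 ?powR_gt0 ?exprn_gt0 ?pmulrn_lgt0.
move=> A B m0 M Ab B0 AM BA n.
have := mat_mul p1 alpha_gt Ab Ab B0 AM AM BA
  (fun h f hM hf fM => ts h f m0 M hM hf fM n) (fun h f hM hf fM => ts h f m0 M hM hf fM n).
by congr (mat_le _ _ _ _ _); ring.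
Qed.

End MatrixBounds.

Section Absm.
Context {R : realType} {d : nat}.
Implicit Types (A B : imatrix R d).

Lemma absm_ge0 A i j : 0 <= absm A i j. Proof. exact: cabs_ge0. Qed.

Lemma absm_mul A B i j : below_sum (absm (imx_mul A B) i j) (fun l => absm A i l * absm B l j).
Proof.
have := @csum_below R d (fun l => A i l * B l j).
by apply: below_sum_mono => l; rewrite cabsM.
Qed.

End Absm.

(* The hypothesis [h] is a parameter of the type so that the algebra instances can use it. *)
Record malg {R : realType} {d : nat} (K : algebra_kind) (p : \bar R) (alpha : R)
    (h : (1 <= p)%E /\ d%:R * dual_exp p < alpha) := MAlg {
  mval : imatrix R d;
  mvalP : exists M, mat_le K p alpha (absm mval) M }.

Section MatrixAlgebra.
Context {R : realType} {d : nat} {K : algebra_kind} {p : \bar R} {alpha : R}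
  {h : (1 <= p)%E /\ d%:R * dual_exp p < alpha}.
Local Notation L := (lattice d).
Local Notation C := R[i].
Local Notation E := (malg K h).
Let p1 := h.1.
Let alpha_gt := h.2.
Implicit Types x y z : E.

Lemma mval_inj x y : mval x = mval y -> x = y.
Proof.
case: x y => [A hA] [B hB] /= AB; rewrite AB in hA *; congr MAlg; exact: Prop_irrelevance.
Qed.

Fact mzero_subproof : exists M, mat_le K p alpha (absm (fun _ _ : L => 0 : C)) M.
Proof.
exists (0 * 1); apply: (mat_mono _ (matZ p1 (lexx 0) (mat_one K p1 alpha))) => i j.
by rewrite mul0r /absm cabs0.
Qed.
Definition mzero : E := MAlg h mzero_subproof.

Fact mone_subproof : exists M, mat_le K p alpha (absm (fun i j : L => (i == j)%:R : C)) M.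
Proof.
exists 1; apply: (mat_mono _ (mat_one K p1 alpha)) => i j.
by rewrite /absm; case: eqP; rewrite ?cabs1 ?cabs0.
Qed.
Definition mone : E := MAlg h mone_subproof.

Fact mopp_subproof x : exists M, mat_le K p alpha (absm (fun i j => - mval x i j)) M.
Proof.
have [M xM] := mvalP x; exists M; apply: (mat_mono _ xM) => i j.
by rewrite /absm cabsN.
Qed.
Definition mopp x : E := MAlg h (mopp_subproof x).

Fact madd_subproof x y : exists M, mat_le K p alpha (absm (fun i j => mval x i j + mval y i j)) M.
Proof.
have [M xM] := mvalP x; have [M' yM] := mvalP y.
exists (M + M'); apply: (mat_mono _ (matD p1 xM yM)) => i j; exact: cabsD.
Qed.
Definition madd x y : E := MAlg h (madd_subproof x y).

Fact mscale_subproof (c : C) x : exists M, mat_le K p alpha (absm (fun i j => c * mval x i j)) M.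
Proof.
have [M xM] := mvalP x; exists (cabs c * M).
by apply: (mat_mono _ (matZ p1 (cabs_ge0 c) xM)) => i j; rewrite /absm cabsM.
Qed.
Definition mscale (c : C) x : E := MAlg h (mscale_subproof c x).

Fact mmul_subproof x y : exists M, mat_le K p alpha (absm (imx_mul (mval x) (mval y))) M.
Proof.
have [M xM] := mvalP x; have [M' yM] := mvalP y.
have [c c0 hc] := @mat_mul_bound R d K p p1 alpha alpha_gt.
exists (c * M * M'); apply: (hc _ _ _ _ _ _ _ _ xM yM) => *; try exact: absm_ge0.
exact: absm_mul.
Qed.
Definition mmul x y : E := MAlg h (mmul_subproof x y).

Lemma malg_ext x y : (forall i j, mval x i j = mval y i j) -> x = y.
Proof. by move=> e; apply: mval_inj; apply/funext => i; apply/funext => j. Qed.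

Lemma malg_row x : exists s, (forall i, sum_le (absm (mval x) i) s) /\
  (forall j, sum_le (fun i => absm (mval x) i j) s).
Proof.
have [M xM] := mvalP x; have [c c0 hc] := @mat_sums R d K p p1 alpha alpha_gt.
by exists (c * M); apply: hc xM => *; exact: absm_ge0.
Qed.

Lemma malg_row_summable x i : csummable (mval x i).
Proof. by have [s [h1 _]] := malg_row x; exists s; exact: h1. Qed.

Lemma malg_assoc_bound (u v : L -> C) x su mv : sum_le (fun k => cabs (u k)) su ->
  (forall l, cabs (v l) <= mv) ->
  exists B, forall F G : {fset L},
     \sum_(k <- F) \sum_(l <- G) cabs (u k) * cabs (mval x k l) * cabs (v l) <= B.
Proof.
move=> us vm; have [s [h1 _]] := malg_row x; exists (su * (s * mv)) => F G.
have mv0 : 0 <= mv by rewrite (le_trans (cabs_ge0 (v 0))).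
have s0 : 0 <= s by have := h1 0 fset0; rewrite big_seq_fset0.
rewrite (le_trans (y := \sum_(k <- F) cabs (u k) * (s * mv)))//; last first.
  by rewrite -mulr_suml ler_wpM2r ?mulr_ge0// us.
apply: ler_sum => k _; under eq_bigr do rewrite -mulrA.
rewrite -mulr_sumr ler_wpM2l ?cabs_ge0//.
rewrite (le_trans (y := \sum_(l <- G) cabs (mval x k l) * mv))//.
  by apply: ler_sum => l _; rewrite ler_wpM2l ?cabs_ge0.
by rewrite -mulr_suml ler_wpM2r// h1.
Qed.

HB.instance Definition _ := gen_eqMixin E.
HB.instance Definition _ := gen_choiceMixin E.

Fact maddA : associative madd.
Proof. by move=> x y z; apply: malg_ext => i j /=; rewrite addrA. Qed.
Fact maddC : commutative madd.
Proof. by move=> x y; apply: malg_ext => i j /=; rewrite addrC. Qed.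
Fact madd0 : left_id mzero madd.
Proof. by move=> x; apply: malg_ext => i j /=; rewrite add0r. Qed.
Fact maddN : left_inverse mzero mopp madd.
Proof. by move=> x; apply: malg_ext => i j /=; rewrite addNr. Qed.

HB.instance Definition _ := GRing.isZmodule.Build E maddA maddC madd0 maddN.

Fact mmulA : associative mmul.
Proof.
move=> x y z; apply: malg_ext => i j /=; rewrite /imx_mul; apply/esym; apply: csum_assoc.
have [s [h1 _]] := malg_row x; have [s' [_ h2]] := malg_row z.
apply: (malg_assoc_bound y (h1 i)) => l; exact: (sum_le_entry (f := fun l => cabs (mval z l j)) l (h2 j)).
Qed.
Fact mmul1l : left_id mone mmul.
Proof. by move=> x; apply: malg_ext => i j /=; exact: csum_delta. Qed.
Fact mmul1r : right_id mone mmul.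
Proof.
move=> x; apply: malg_ext => i j /=; rewrite -[RHS](csum_delta j (mval x i)).
by apply: eq_csum => k; rewrite mulrC eq_sym.
Qed.
Lemma mmul_summable x y i j : csummable (fun k => mval x i k * mval y k j).
Proof.
have [s [_ h2]] := malg_row y.
have [B hB] := csummableZ (s%:C)%C (malg_row_summable x i); exists B.
apply: sum_le_mono hB => k; have := sum_le_entry k (h2 j).
by rewrite !cabsM mulrC => hk; rewrite ler_wpM2r ?cabs_ge0// cabs_real (le_trans hk)// ler_norm.
Qed.
Fact mmulDl : left_distributive mmul madd.
Proof.
move=> x y z; apply: malg_ext => i j /=; rewrite /imx_mul /= -csumD; try exact: mmul_summable.
by apply: eq_csum => k; rewrite mulrDl.
Qed.
Fact mmulDr : right_distributive mmul madd.
Proof.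
move=> x y z; apply: malg_ext => i j /=; rewrite /imx_mul /= -csumD; try exact: mmul_summable.
by apply: eq_csum => k; rewrite mulrDr.
Qed.
Fact mone_neq0 : mone != mzero :> E.
Proof.
apply/eqP => /(congr1 (fun x : E => mval x 0 0)) /= /eqP; rewrite eqxx.
by rewrite oner_eq0.
Qed.

HB.instance Definition _ := GRing.Zmodule_isNzRing.Build E
  mmulA mmul1l mmul1r mmulDl mmulDr mone_neq0.

Fact mscaleA a b x : mscale a (mscale b x) = mscale (a * b) x.
Proof. by apply: malg_ext => i j /=; rewrite mulrA. Qed.
Fact mscale1 : left_id 1 mscale.
Proof. by move=> x; apply: malg_ext => i j /=; rewrite mul1r. Qed.
Fact mscaleDr : right_distributive mscale madd.
Proof. by move=> a x y; apply: malg_ext => i j /=; rewrite mulrDr. Qed.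
Fact mscaleDl x : {morph mscale^~ x : a b / a + b >-> madd a b}.
Proof. by move=> a b; apply: malg_ext => i j /=; rewrite mulrDl. Qed.

HB.instance Definition _ := GRing.Zmodule_isLmodule.Build C E
  mscaleA mscale1 mscaleDr mscaleDl.

Fact mscaleAl (a : C) x y : a *: (x * y) = a *: x * y.
Proof.
apply: malg_ext => i j /=; rewrite /imx_mul /= -csumZ; last exact: mmul_summable.
by apply: eq_csum => k; rewrite mulrA.
Qed.

HB.instance Definition _ := GRing.Lmodule_isLalgebra.Build C E mscaleAl.

Fact mscaleAr (a : C) x y : a *: (x * y) = x * (a *: y).
Proof.
apply: malg_ext => i j /=; rewrite /imx_mul /= -csumZ; last exact: mmul_summable.
by apply: eq_csum => k; rewrite mulrCA.
Qed.

HB.instance Definition _ := GRing.Lalgebra_isAlgebra.Build C E mscaleAr.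

End MatrixAlgebra.

(** * Completeness, the rescaled norm and the adjoint *)

Section GeometricSeries.
Context {R : realType}.

Lemma sum_le_ord (f : nat -> R) B n : sum_le f B -> \sum_(k < n) f k <= B.
Proof.
move=> fB; have := fB [fset k in iota 0 n]%fset; congr (_ <= _).
rewrite -(big_mkord xpredT f) /index_iota subn0; apply: perm_big; apply: uniq_perm.
- exact: fset_uniq.
- exact: iota_uniq.
- by move=> k; rewrite !inE.
Qed.

(* The partial sums, shifted down or up by [2 M / 2^n], bracket the limit. *)
Lemma geometric_series_real (r : nat -> R) M : (forall n, `|r n| <= M / 2 ^+ n) ->
  exists s, forall n, `|s - \sum_(k < n) r k| <= M *+ 2 / 2 ^+ n.
Proof.
move=> rM; pose S n := \sum_(k < n) r k; pose e n := M *+ 2 / 2 ^+ n.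
have eS n : e n = e n.+1 + M / 2 ^+ n by rewrite /e exprS; field; rewrite expf_neq0.
have e0 n : 0 <= e n.
  by have := le_trans (normr_ge0 _) (rM n); rewrite /e mulrnAl => ?; rewrite mulrn_wge0.
have Sr n : S n.+1 = S n + r n by rewrite /S big_ord_recr.
have up m n : S m - e m <= S (m + n)%N - e (m + n)%N.
  elim: n => [|n IH]; first by rewrite addn0.
  rewrite addnS (le_trans IH)// Sr (eS (m + n)%N).
  have := rM (m + n)%N; rewrite ler_norml => /andP[h _]; move: h; clear; lra.
have dn m n : S (m + n)%N + e (m + n)%N <= S m + e m.
  elim: n => [|n IH]; first by rewrite addn0.
  rewrite addnS (le_trans _ IH)// Sr (eS (m + n)%N).
  have := rM (m + n)%N; rewrite ler_norml => /andP[_ h]; move: h; clear; lra.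
have le_ud m n : S m - e m <= S n + e n.
  have := up m n; have := dn n m; rewrite addnC; have := e0 (m + n)%N; clear; lra.
pose D := [set S n - e n | n in setT].
exists (sup D) => n; rewrite ler_distl; apply/andP; split.
  by apply: ub_le_sup; [exists (S 0%N + e 0%N) => _ [m _ <-]; exact: le_ud|exists n].
by apply: ge_sup => [|_ [m _ <-]]; [exists (S 0%N - e 0%N); exists 0%N|exact: le_ud].
Qed.

(** The remainder is expressed by [below_sum], the form in which [mat_series] turns estimates of
    entries into estimates of norms. *)
Lemma geometric_series (r : nat -> R[i]) M : (forall n, cabs (r n) <= M / 2 ^+ n) ->
  exists s, forall n, below_sum (cabs (s - \sum_(k < n) r k)) (fun m => cabs (r (n + m)%N)).
Proof.
move=> rM.
have [a ha] := @geometric_series_real (fun n => complex.Re (r n)) M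
  (fun n => le_trans (cabs_ge_Re _) (rM n)).
have [b hb] := @geometric_series_real (fun n => complex.Im (r n)) M
  (fun n => le_trans (cabs_ge_Im _) (rM n)).
have lim n : cabs ((a +i* b)%C - \sum_(k < n) r k) <= M *+ 4 / 2 ^+ n.
  apply: le_trans (cabs_ReIm _) _.
  have -> : M *+ 4 / 2 ^+ n = M *+ 2 / 2 ^+ n + M *+ 2 / 2 ^+ n by rewrite -mulrDl -mulrnDr.
  apply: lerD; [have := ha n|have := hb n]; congr (`|_| <= _).
  by rewrite [RHS]raddfB [in RHS]raddf_sum.
  by rewrite [RHS]raddfB [in RHS]raddf_sum.
exists (a +i* b)%C => n B rB; rewrite leNgt; apply/negP => lt.
have lt' : 0 < cabs ((a +i* b)%C - \sum_(k < n) r k) - B by rewrite subr_gt0.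
have [m hm] := half_pow_small (M *+ 8) lt'.
have := cabsD ((a +i* b)%C - \sum_(k < n + m) r k) (\sum_(k < m) r (n + k)%N).
rewrite big_split_ord /= opprD addrA subrK => h1.
have h2 : cabs (\sum_(k < m) r (n + k)%N) <= B.
  apply: le_trans (cabs_sum _ _ _) _.
  exact: (@sum_le_ord (fun k => cabs (r (n + k)%N))).
have h3 : cabs ((a +i* b)%C - (\sum_(k < n) r k + \sum_(k < m) r (n + k)%N)) *+ 2 <= M *+ 8 / 2 ^+ m.
  have := lim (n + m)%N; rewrite big_split_ord /= => h4.
  have M0 : 0 <= M by have := le_trans (cabs_ge0 _) (rM 0%N); rewrite expr0 divr1.
  rewrite (_ : M *+ 8 / _ = M *+ 4 / 2 ^+ m *+ 2); last by rewrite -mulrnAl -mulrnA.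
  rewrite ler_pMn2r//; apply: le_trans h4 _.
  rewrite ler_wpM2l ?mulrn_wge0// lef_pV2 ?posrE ?exprn_gt0//.
  by rewrite ler_eXn2l ?leq_addl// ltr1n.
move: h1 h2 h3 hm lt; rewrite opprD addrA; clear; lra.
Qed.

End GeometricSeries.

Section MatrixNorm.
Context {R : realType} {d : nat} {K : algebra_kind} {p : \bar R} {alpha : R}
  {h : (1 <= p)%E /\ d%:R * dual_exp p < alpha}.
Local Notation L := (lattice d).
Local Notation C := R[i].
Local Notation E := (malg K h).
Let p1 := h.1.
Let alpha_gt := h.2.
Implicit Types x y z : E.

Lemma mvalD x y i j : mval (x + y) i j = mval x i j + mval y i j. Proof. by []. Qed.
Lemma mvalB x y i j : mval (x - y) i j = mval x i j - mval y i j. Proof. by []. Qed.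
Lemma mvalZ (c : C) x i j : mval (c *: x) i j = c * mval x i j. Proof. by []. Qed.
Lemma mval_sum (I : Type) (r : seq I) (F : I -> E) i j :
  mval (\sum_(k <- r) F k) i j = \sum_(k <- r) mval (F k) i j.
Proof. by elim/big_ind2: _ => // x a y b <- <-. Qed.

Definition anorm x : R := fine (alg_norm K p alpha (mval x)).

Lemma anorm_mat x : mat_le K p alpha (absm (mval x)) (anorm x).
Proof. by apply/algP => //; have [M /(alg_of_mat_le p1)[]] := mvalP x. Qed.

Lemma anorm_le x M : mat_le K p alpha (absm (mval x)) M -> anorm x <= M.
Proof. by move=> /(alg_of_mat_le p1)[]. Qed.

Lemma anorm_ge0 x : 0 <= anorm x.
Proof. by apply: fine_ge0; exact: alg_norm_ge0. Qed.

Lemma anorm_entry x i j : cabs (mval x i j) <= anorm x.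
Proof. exact: (mat_entry p1 alpha_gt i j (absm_ge0 _) (anorm_mat x)). Qed.

Lemma anorm_complete (u : nat -> E) M : (forall n, anorm (u n) <= M / 2 ^+ n) ->
  exists x, forall n, anorm (x - \sum_(k < n) u k) <= M *+ 2 / 2 ^+ n.
Proof.
move=> uM.
have M0 : 0 <= M by have := le_trans (anorm_ge0 _) (uM 0%N); rewrite expr0 divr1.
have ser i j : exists s, forall n, below_sum (cabs (s - \sum_(k < n) mval (u k) i j))
    (fun m => cabs (mval (u (n + m)%N) i j)).
  apply: (@geometric_series R (fun n => mval (u n) i j) M) => n.
  exact: le_trans (anorm_entry _ _ _) (uM n).
have ser' i : exists s, forall j n, below_sum (cabs (s j - \sum_(k < n) mval (u k) i j))
    (fun m => cabs (mval (u (n + m)%N) i j)).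
  by have [s hs] := choice (ser i); exists s.
have [s hs] := choice ser'.
have tail n : mat_le K p alpha (fun i j => cabs (s i j - \sum_(k < n) mval (u k) i j))
    (M *+ 2 / 2 ^+ n).
  rewrite mulrnAl; apply: (mat_series p1 (U := fun m => absm (mval (u (n + m)%N)))) => //.
  - by rewrite divr_ge0 ?exprn_ge0.
  - by move=> m i j; exact: absm_ge0.
  - by move=> i j; exact: cabs_ge0.
  - move=> m; apply: mat_weak (anorm_mat _) => //.
    by rewrite -mulrA -invfM -exprD uM.
have sP : exists B, mat_le K p alpha (absm s) B.
  exists (M *+ 2 / 2 ^+ 0); apply: mat_mono (tail 0%N) => i j.
  by rewrite big_ord0 subr0.
exists (MAlg h sP) => n; apply: anorm_le; apply: mat_mono (tail n) => i j.
by rewrite /absm mvalB mval_sum.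
Qed.

Definition anorm_const : R := sval (cid2 (@mat_mul_bound R d K p p1 alpha alpha_gt)).

Lemma anorm_const_gt0 : 0 < anorm_const.
Proof. by rewrite /anorm_const; case: cid2. Qed.

Lemma anormM x y : anorm (x * y) <= anorm_const * anorm x * anorm y.
Proof.
apply: anorm_le; rewrite /anorm_const; case: cid2 => c c0 hc /=.
apply: (hc _ _ _ _ _ _ _ _ (anorm_mat x) (anorm_mat y)) => *; try exact: absm_ge0.
exact: absm_mul.
Qed.

(* Rescaled because [anorm] is submultiplicative only up to a constant. *)
Definition mnorm x : R := anorm_const * anorm x.

Lemma mnorm_banach : banach_norm mnorm.
Proof.
have c0 := anorm_const_gt0; split.
- move=> x y; rewrite -mulrDr ler_pM2l//; apply: anorm_le.
  by apply: mat_mono (matD p1 (anorm_mat x) (anorm_mat y)) => i j; exact: cabsD.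
- move=> c x; rewrite mulrCA ler_pM2l//; apply: anorm_le.
  by apply: mat_mono (matZ p1 (cabs_ge0 c) (anorm_mat x)) => i j; rewrite /absm mvalZ cabsM.
- move=> x y; rewrite mulrACA -mulrA ler_pM2l// mulrA; exact: anormM.
- move=> x; rewrite pmulr_rle0// => x0; apply: malg_ext => i j; apply/eqP.
  by rewrite -[mval 0 i j]/(0 : C) -cabs_eq0 eq_le cabs_ge0 (le_trans (anorm_entry _ _ _)).
- move=> u M uM; have [|x hx] := @anorm_complete u (M / anorm_const).
    by move=> n; rewrite mulrAC ler_pdivlMr// mulrC uM.
  exists x => n; rewrite /mnorm mulrC -ler_pdivlMr//.
  by have := hx n; congr (_ <= _); rewrite -mulrnAl mulrAC.
Qed.

Lemma mnorm_sqr : exists c D t, [/\ 1 <= c, 1 <= D, 0 < t, t < 1 & forall x m0,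
  (forall i j, cabs (mval x i j) <= m0) ->
  forall n, mnorm (x * x) <= c * mnorm x * (D ^+ n * m0 + t ^+ n * mnorm x)].
Proof.
have [c [D [t [c0 D1 t0 t1 H]]]] := @mat_sqr_bound R d K p p1 alpha alpha_gt.
have k0 := anorm_const_gt0.
(* The summand [c] serves the term in [m0]. The quotient offsets the extra factor that rescaling
   puts on the term in the norm of [x], and the [1] makes the constant at least [1]. *)
exists (1 + c + c / anorm_const), D, t; split => //.
  by rewrite -addrA lerDl addr_ge0 ?divr_ge0 ?ltW.
move=> x m0 xm n; have m00 : 0 <= m0 := le_trans (cabs_ge0 _) (xm 0 0).
have h1 : anorm (x * x) <= c * anorm x * (D ^+ n * m0 + t ^+ n * anorm x).
  apply: anorm_le; apply: (H _ _ _ _ _ _ (anorm_mat x)).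
  - by move=> i j; rewrite absm_ge0 xm.
  - by move=> i j; exact: absm_ge0.
  - exact: absm_mul.
have a0 := anorm_ge0 x.
have P1 : 0 <= D ^+ n * m0 by rewrite mulr_ge0// exprn_ge0// (le_trans _ D1).
have P2 : 0 <= t ^+ n * anorm x by rewrite mulr_ge0// exprn_ge0// ltW.
rewrite /mnorm (mulrCA (t ^+ n)).
set a := anorm_const in k0 *; set P := _ * m0 in P1 h1 *; set Q := t ^+ n * _ in P2 h1 *.
rewrite (le_trans (y := a * (c * anorm x * (P + Q))))// ?ler_pM2l//.
have -> : (1 + c + c / a) * (a * anorm x) * (P + a * Q) =
   a * (c * anorm x * (P + Q)) + (a * anorm x * P + a * (1 + c) * anorm x * (a * Q) +
   c * anorm x * P) .
  by field; rewrite gt_eqF.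
have [k0' c0'] := (ltW k0, ltW c0); rewrite lerDl.
by clearbody a P Q; repeat first [done | apply: addr_ge0 | apply: mulr_ge0].
Qed.

Fact mstar_subproof x : exists M, mat_le K p alpha (absm (fun i j => conjc (mval x j i))) M.
Proof.
have [M xM] := mvalP x; exists M; apply: mat_mono (mat_tr p1 xM) => i j.
by rewrite /absm cabs_conj.
Qed.
Definition mstar x : E := MAlg h (mstar_subproof x).

Lemma mstarB x y : mstar (x - y) = mstar x - mstar y.
Proof. by apply: malg_ext => i j; rewrite /= rmorphB. Qed.
Lemma mstarZ (c : C) x : mstar (c *: x) = c^*%C *: mstar x.
Proof. by apply: malg_ext => i j; rewrite /= rmorphM. Qed.
Lemma mstarM x y : mstar (x * y) = mstar y * mstar x.
Proof.
apply: malg_ext => i j; apply: etrans (esym (csum_conj (mmul_summable x y j i))) _.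
by apply: eq_csum => k; rewrite rmorphM mulrC.
Qed.
Lemma mstarK x : mstar (mstar x) = x.
Proof. by apply: malg_ext => i j /=; rewrite conjcK. Qed.

Lemma anorm_star x : anorm (mstar x) <= anorm x.
Proof.
apply: anorm_le; apply: mat_mono (mat_tr p1 (anorm_mat x)) => i j.
by rewrite /absm cabs_conj.
Qed.

End MatrixNorm.

(** * Operators on l^2 *)

Section SquareSummable.
Context {R : realType} {d : nat}.
Local Notation L := (lattice d).
Local Notation C := R[i].
Implicit Types u v w : L -> C.

Definition nrm v : R := fine (norm2 v).

Let p1 : (1 <= 2%:E :> \bar R)%E. Proof. by rewrite lee_fin ler1n. Qed.

Lemma lp2P (f : L -> R) M : (forall k, 0 <= f k) -> 0 <= M ->
  lp_le 2%:E f M <-> sum_le (fun k => f k ^+ 2) (M ^+ 2).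
Proof.
move=> f0 M0; rewrite /lp_le -(powR_mulrn 2 M0).
have -> : (fun k => f k ^+ 2) = (fun k => f k `^ 2%:R).
  by apply/funext => k; rewrite powR_mulrn.
by split=> [[]|].
Qed.

Lemma norm2_leP v M : 0 <= M ->
  (norm2 v <= M%:E)%E <-> sum_le (fun k => cabs (v k) ^+ 2) (M ^+ 2).
Proof.
move=> M0; have v0 k := cabs_ge0 (v k).
by rewrite -(lp2P v0 M0); exact: (lnorm_le p1 M0 v0).
Qed.

Lemma nrm_ge0 v : 0 <= nrm v.
Proof. exact/fine_ge0/lnorm_ge0. Qed.

Lemma norm2E v : l2 v -> norm2 v = (nrm v)%:E.
Proof. by move=> lv; rewrite fineK// ge0_fin_numE// lnorm_ge0. Qed.

Lemma nrm_sum v : l2 v -> sum_le (fun k => cabs (v k) ^+ 2) (nrm v ^+ 2).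
Proof. by move=> lv; apply/norm2_leP; rewrite ?nrm_ge0// norm2E. Qed.

Lemma l2_sum v M : 0 <= M -> sum_le (fun k => cabs (v k) ^+ 2) (M ^+ 2) -> l2 v /\ nrm v <= M.
Proof.
move=> M0 /(norm2_leP v M0) vM; have lv : l2 v by rewrite /l2 (le_lt_trans vM)// ltry.
by split=> //; rewrite -lee_fin -norm2E.
Qed.

Lemma nrm_lp v : l2 v -> lp_le 2%:E (fun k => cabs (v k)) (nrm v).
Proof. by move=> lv; apply/lp2P => [k||]; rewrite ?cabs_ge0 ?nrm_ge0//; exact: nrm_sum. Qed.

Lemma l2_lp v M : lp_le 2%:E (fun k => cabs (v k)) M -> l2 v /\ nrm v <= M.
Proof.
by move=> h; have M0 := lp_ge0 h; apply: l2_sum => //; apply/lp2P => // k; exact: cabs_ge0.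
Qed.

Lemma nrm_entry v k : l2 v -> cabs (v k) <= nrm v.
Proof. by move=> /nrm_lp h; apply: (lp_entry p1 _ _ h) => l; exact: cabs_ge0. Qed.

Lemma nrm_sqr v : l2 v -> nsum (fun k => cabs (v k) ^+ 2) = nrm v ^+ 2.
Proof.
move=> lv; have hs := nrm_sum lv; have v0 k : 0 <= cabs (v k) ^+ 2 by rewrite exprn_ge0 ?cabs_ge0.
have n0 := nsum_ge0 v0 hs.
apply/le_anti/andP; split; first exact: nsum_le hs.
rewrite -(sqr_sqrtr n0) ler_sqr ?nnegrE ?nrm_ge0 ?sqrtr_ge0//.
have [] // := @l2_sum v (Num.sqrt (nsum (fun k => cabs (v k) ^+ 2))).
by rewrite sqr_sqrtr//; exact: nsum_ub hs.
Qed.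

Lemma l2D v w : l2 v -> l2 w -> l2 (fun k => v k + w k) /\ nrm (fun k => v k + w k) <= nrm v + nrm w.
Proof.
move=> lv lw; apply: l2_lp.
apply: (lp_mono p1 (g := fun k => cabs (v k) + cabs (w k))) => [k|].
  by rewrite cabs_ge0 cabsD.
by apply: (lpD p1) (nrm_lp lv) (nrm_lp lw) => k; exact: cabs_ge0.
Qed.

Lemma l2Z (c : C) v : l2 v -> l2 (fun k => c * v k) /\ nrm (fun k => c * v k) <= cabs c * nrm v.
Proof.
move=> lv; apply: l2_lp.
apply: (lp_mono p1 (g := fun k => cabs c * cabs (v k))) => [k|].
  by rewrite cabs_ge0 cabsM lexx.
by apply: (lpZ p1 (cabs_ge0 c)) (nrm_lp lv) => k; exact: cabs_ge0.
Qed.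

Lemma cauchy_schwarz_sum v w : l2 v -> l2 w -> sum_le (fun k => cabs (v k * w k)) (nrm v * nrm w).
Proof.
move=> lv lw F; have [w0|w0] := eqVneq (nrm w) 0.
  rewrite big1 ?mulr_ge0 ?nrm_ge0// => k _.
  have -> : w k = 0 by apply/eqP; rewrite -cabs_eq0 eq_le cabs_ge0 andbT -w0 nrm_entry.
  by rewrite mulr0 cabs0.
have [v0|v0] := eqVneq (nrm v) 0.
  rewrite big1 ?mulr_ge0 ?nrm_ge0// => k _.
  have -> : v k = 0 by apply/eqP; rewrite -cabs_eq0 eq_le cabs_ge0 andbT -v0 nrm_entry.
  by rewrite mul0r cabs0.
have {w0}w0 : 0 < nrm w by rewrite lt_def w0 nrm_ge0.
have {v0}v0 : 0 < nrm v by rewrite lt_def v0 nrm_ge0.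
have vS := nrm_sum lv F; have wS := nrm_sum lw F.
set a := nrm v in v0 vS *; set b := nrm w in w0 wS *.
rewrite -(ler_pM2l (mulr_gt0 v0 w0)) -(ler_pMn2r (n := 2))//.
have -> : a * b * (a * b) *+ 2 = b ^+ 2 * a ^+ 2 + a ^+ 2 * b ^+ 2 by ring.
apply: (@le_trans _ _ (\sum_(k <- F) (b ^+ 2 * cabs (v k) ^+ 2 + a ^+ 2 * cabs (w k) ^+ 2))).
  rewrite mulr_sumr -sumrMnl; apply: ler_sum => k _; rewrite cabsM.
  have := sqr_ge0 (b * cabs (v k) - a * cabs (w k)).
  by rewrite -subr_ge0; congr (_ <= _); ring.
by rewrite big_split /= -!mulr_sumr lerD// ler_wpM2l ?sqr_ge0.
Qed.

Lemma dot2_summable v w : l2 v -> l2 w -> csummable (fun k => v k * conjc (w k)).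
Proof.
move=> lv lw; exists (nrm v * nrm w); have := cauchy_schwarz_sum lv lw.
by apply: sum_le_mono => k; rewrite !cabsM cabs_conj.
Qed.

Lemma cauchy_schwarz v w : l2 v -> l2 w -> cabs (dot2 v w) <= nrm v * nrm w.
Proof.
move=> lv lw; apply: csum_below; have := cauchy_schwarz_sum lv lw.
by apply: sum_le_mono => k; rewrite !cabsM cabs_conj.
Qed.

Lemma dot2_nrm v : l2 v -> dot2 v v = ((nrm v ^+ 2)%:C)%C.
Proof.
move=> lv; rewrite -nrm_sqr// -(csum_real (B := nrm v ^+ 2)) => [|k|]; last exact: nrm_sum.
- by apply: eq_csum => k; exact: mul_conjc.
- by rewrite exprn_ge0 ?cabs_ge0.
Qed.

Lemma dot2C v w : l2 v -> l2 w -> dot2 w v = conjc (dot2 v w).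
Proof.
move=> lv lw; rewrite /dot2 -csum_conj; last exact: dot2_summable.
by apply: eq_csum => k; rewrite rmorphM /= conjcK mulrC.
Qed.

Definition basis (j : L) : L -> C := fun k => (j == k)%:R.

Lemma basis_l2 j : l2 (basis j) /\ nrm (basis j) <= 1.
Proof.
apply: l2_lp; apply: (lp_mono p1 _ (lp_delta p1 j)) => k.
by rewrite cabs_ge0 /basis eq_sym; case: eqP; rewrite ?cabs0 ?cabs1/=.
Qed.

Lemma dot2_basis v j : dot2 v (basis j) = v j.
Proof.
rewrite -[RHS](csum_delta j v); apply: eq_csum => k.
by rewrite /basis rmorph_nat mulrC.
Qed.

End SquareSummable.

Section OperatorNorm.
Context {R : realType} {d : nat} {K : algebra_kind} {p : \bar R} {alpha : R}
  {h : (1 <= p)%E /\ d%:R * dual_exp p < alpha}.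
Local Notation L := (lattice d).
Local Notation C := R[i].
Local Notation E := (malg K h).
Implicit Types (x y z : E) (u v w : L -> C).

Definition mop x v : L -> C := imx_op (mval x) v.

Lemma mop_summable x v i : l2 v -> csummable (fun j => mval x i j * v j).
Proof.
move=> lv; have [B hB] := csummableZ ((nrm v)%:C)%C (malg_row_summable x i); exists B.
apply: sum_le_mono hB => j.
by rewrite !cabsM cabs_real ger0_norm ?nrm_ge0// mulrC ler_wpM2r ?cabs_ge0// nrm_entry.
Qed.

(** Schur's test with exponent 2, since the row and column sums are controlled by the matrix
    norm. *)
Lemma mop_bounded : exists2 c, 0 <= c &
  forall x v, l2 v -> l2 (mop x v) /\ nrm (mop x v) <= c * anorm x * nrm v.
Proof.
have p2 : (1 <= 2%:E :> \bar R)%E by rewrite lee_fin ler1n.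
have [c c0 hc] := @mat_sums R d K p h.1 alpha h.2; exists c; first exact: ltW.
move=> x v lv; have [h1 h2] := hc _ _ (absm_ge0 _) (anorm_mat x).
have s0 : 0 <= c * anorm x by rewrite mulr_ge0 ?anorm_ge0// ltW.
apply: l2_lp.
apply: (@lp_fatou _ _ p2 _ _ (fun j i => absm (mval x) i j * cabs (v j))).
- by move=> j i; rewrite mulr_ge0 ?cabs_ge0.
- by move=> k; exact: cabs_ge0.
- move=> F; apply: (lp_schur p2 s0 _ _ _ _ (nrm_lp lv)).
  + by move=> j i; exact: absm_ge0.
  + by move=> j; exact: cabs_ge0.
  + by move=> i; exact: h1.
  + exact: h2.
- move=> i; have := @csum_below R d (fun j => mval x i j * v j).
  by apply: below_sum_mono => j; rewrite cabsM.
Qed.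

Lemma mop_l2 x v : l2 v -> l2 (mop x v).
Proof. by move=> lv; have [c _ /(_ x v lv)[]] := mop_bounded. Qed.

Lemma mopM x y v : l2 v -> mop (x * y) v = mop x (mop y v).
Proof.
move=> lv; apply/funext => i.
have [s [h1 _]] := malg_row x.
apply: csum_assoc; apply: (malg_assoc_bound y (h1 i)) => l; exact: nrm_entry lv.
Qed.

Lemma mop1 v : mop 1 v = v.
Proof. by apply/funext => i; exact: csum_delta. Qed.

Lemma mopD x y v : l2 v -> mop (x + y) v = (fun k => mop x v k + mop y v k).
Proof.
move=> lv; apply/funext => i; rewrite /mop /imx_op -csumD; try exact: mop_summable.
by apply: eq_csum => j; rewrite mvalD mulrDl.
Qed.

Lemma mopB x y v : l2 v -> mop (x - y) v = (fun k => mop x v k - mop y v k).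
Proof.
move=> lv; apply/funext => i; rewrite /mop /imx_op -csumB; try exact: mop_summable.
by apply: eq_csum => j; rewrite mvalB mulrBl.
Qed.

Lemma mopZ (c : C) x v : l2 v -> mop (c *: x) v = (fun k => c * mop x v k).
Proof.
move=> lv; apply/funext => i; rewrite /mop /imx_op -csumZ; try exact: mop_summable.
by apply: eq_csum => j; rewrite mvalZ mulrA.
Qed.

Lemma mop_linear (c : C) x v w : l2 v -> l2 w ->
  mop x (fun k => c * v k + w k) = (fun k => c * mop x v k + mop x w k).
Proof.
move=> lv lw; apply/funext => i; have [lc _] := l2Z c lv.
rewrite /mop /imx_op -csumZ -?csumD; try exact: mop_summable.
  by apply: eq_csum => j; rewrite mulrDr mulrCA.
by apply: csummable_mono (mop_summable x i lc) => j; rewrite mulrCA.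
Qed.

Lemma mop_basis x i j : mop x (basis j) i = mval x i j.
Proof.
rewrite -[RHS](csum_delta j (mval x i)); apply: eq_csum => k.
by rewrite /basis mulrC.
Qed.

Lemma mop_ext x y : (forall v, l2 v -> mop x v = mop y v) -> x = y.
Proof.
by move=> xy; apply: malg_ext => i j; rewrite -!mop_basis xy//; have [] := @basis_l2 R d j.
Qed.

Lemma mop_adjoint x v w : l2 v -> l2 w -> dot2 (mop x v) w = dot2 v (mop (mstar x) w).
Proof.
move=> lv lw; have [s [h1 h2]] := malg_row x.
have s0 : 0 <= s by have := h1 0 fset0; rewrite big_seq_fset0.
transitivity (csum (fun k => v k * csum (fun l => mval x l k * conjc (w l)))); last first.
  apply: eq_csum => k; congr (_ * _); rewrite /mop /imx_op -csum_conj; last exact: mop_summable.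
  by apply: eq_csum => l; rewrite rmorphM /= conjcK.
transitivity (csum (fun l => csum (fun k => v k * mval x l k) * conjc (w l))).
  by apply: eq_csum => l; congr (_ * _); apply: eq_csum => k; rewrite mulrC.
apply: (@csum_assoc R d v (fun l => conjc (w l)) (fun k l => mval x l k)).
(* Bounding [|v k| |w l|] by the sum of the two squares separates the vectors, and the row and
   column sums of [x] are at most [s]. *)
exists (s * nrm v ^+ 2 + s * nrm w ^+ 2) => F G.
apply: (@le_trans _ _ (\sum_(k <- F) \sum_(l <- G)
  (absm (mval x) l k * cabs (v k) ^+ 2 + absm (mval x) l k * cabs (w l) ^+ 2))).
  apply: ler_sum => k _; apply: ler_sum => l _; rewrite cabs_conj /absm.
  have := cabs_ge0 (mval x l k); have := cabs_ge0 (v k); have := cabs_ge0 (w l).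
  move: (cabs _) (cabs _) (cabs _) => a b c a0 b0 c0.
  rewrite -mulrDr (mulrC b) -mulrA ler_wpM2l//; nra.
under eq_bigr do rewrite big_split /=.
rewrite big_split /=; apply: lerD.
  rewrite (le_trans (y := \sum_(k <- F) s * cabs (v k) ^+ 2))//.
    by apply: ler_sum => k _; rewrite -mulr_suml ler_wpM2r ?exprn_ge0 ?cabs_ge0// h2.
  by rewrite -mulr_sumr ler_wpM2l//; exact: nrm_sum.
rewrite exchange_big /= (le_trans (y := \sum_(l <- G) s * cabs (w l) ^+ 2))//.
  by apply: ler_sum => k _; rewrite -mulr_suml ler_wpM2r ?exprn_ge0 ?cabs_ge0// h1.
by rewrite -mulr_sumr ler_wpM2l//; exact: nrm_sum.
Qed.

Definition opbounds x : set R :=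
  [set c | 0 <= c /\ forall v, l2 v -> nrm (mop x v) <= c * nrm v].

Definition opn x : R := inf (opbounds x).

Lemma opn_le x c : 0 <= c -> (forall v, l2 v -> nrm (mop x v) <= c * nrm v) -> opn x <= c.
Proof. by move=> c0 hc; apply: ge_inf; [exists 0 => ? []|]. Qed.

Lemma opbounds_nonempty x : opbounds x !=set0.
Proof.
have [c c0 hc] := mop_bounded; exists (c * anorm x); split.
  by rewrite mulr_ge0 ?anorm_ge0.
by move=> v /(hc x)[].
Qed.

Lemma opn_ge0 x : 0 <= opn x.
Proof. by apply: lb_le_inf; [exact: opbounds_nonempty|move=> ? []]. Qed.

Lemma opn_ub x v : l2 v -> nrm (mop x v) <= opn x * nrm v.
Proof.
move=> lv; have [v0|v0] := eqVneq (nrm v) 0.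
  by have [c [_ hc]] := opbounds_nonempty x; rewrite v0 mulr0 -(mulr0 c) -v0 hc.
have {v0}v0 : 0 < nrm v by rewrite lt_def v0 nrm_ge0.
rewrite -ler_pdivrMr//; apply: lb_le_inf; first exact: opbounds_nonempty.
by move=> c [_ hc]; rewrite ler_pdivrMr// hc.
Qed.

(** The link between the two norms: the operator norm can take the place of the uniform bound [m0]
    in [mnorm_sqr]. *)
Lemma opn_entry x i j : cabs (mval x i j) <= opn x.
Proof.
have [lb b1] := @basis_l2 R d j.
rewrite -mop_basis (le_trans (nrm_entry _ (mop_l2 x lb)))// (le_trans (opn_ub x lb))//.
by rewrite -[leRHS]mulr1 ler_wpM2l ?opn_ge0.
Qed.

Lemma opn_anorm : exists2 c, 0 <= c & forall x, opn x <= c * anorm x.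
Proof.
have [c c0 hc] := mop_bounded; exists c => // x; apply: opn_le => [|v /(hc x)[]//].
by rewrite mulr_ge0 ?anorm_ge0.
Qed.

Lemma opnM x y : opn (x * y) <= opn x * opn y.
Proof.
apply: opn_le => [|v lv]; first by rewrite mulr_ge0 ?opn_ge0.
rewrite mopM// (le_trans (opn_ub x (mop_l2 y lv)))// -mulrA ler_wpM2l ?opn_ge0//.
exact: opn_ub.
Qed.

Lemma nrm_mop_sqr x v : l2 v -> nrm (mop x v) ^+ 2 <= opn (mstar x * x) * nrm v ^+ 2.
Proof.
move=> lv; have lx := mop_l2 x lv.
have -> : nrm (mop x v) ^+ 2 = cabs (dot2 (mop x v) (mop x v)).
  by rewrite dot2_nrm// cabs_real ger0_norm// exprn_ge0 ?nrm_ge0.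
rewrite mop_adjoint// -mopM// (le_trans (cauchy_schwarz lv (mop_l2 _ lv)))//.
by rewrite mulrC (expr2 (nrm v)) mulrA ler_wpM2r ?nrm_ge0// opn_ub.
Qed.

Lemma opn_star_sqr x : opn x ^+ 2 <= opn (mstar x * x).
Proof.
have P0 := opn_ge0 (mstar x * x).
rewrite -(sqr_sqrtr P0) ler_sqr ?nnegrE ?opn_ge0 ?sqrtr_ge0//.
apply: opn_le => [|v lv]; first exact: sqrtr_ge0.
rewrite -ler_sqr ?nnegrE ?mulr_ge0 ?nrm_ge0 ?sqrtr_ge0// exprMn sqr_sqrtr//.
exact: nrm_mop_sqr.
Qed.

(** With [x'] for the adjoint, [|x'|^2 <= |x x'| <= |x| |x'|]. *)
Lemma opn_star x : opn (mstar x) <= opn x.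
Proof.
have h1 := opn_star_sqr (mstar x); rewrite mstarK in h1.
have := le_trans h1 (opnM x (mstar x)).
have [->|n0] := eqVneq (opn (mstar x)) 0; first by rewrite opn_ge0.
have P0 : 0 < opn (mstar x) by rewrite lt_def n0 opn_ge0.
by rewrite expr2 (ler_pM2r P0).
Qed.

Lemma opn_cstar : cstar_seminorm (opn : E -> R) mstar.
Proof.
split.
- move=> x y; apply: opn_le => [|v lv]; first by rewrite addr_ge0 ?opn_ge0.
  have [_ hD] := l2D (mop_l2 x lv) (mop_l2 y lv).
  by rewrite mopD// mulrDl (le_trans hD)// lerD// opn_ub.
- move=> c x; apply: opn_le => [|v lv]; first by rewrite mulr_ge0 ?opn_ge0 ?cabs_ge0.
  have [_ hZ] := l2Z c (mop_l2 x lv).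
  by rewrite mopZ// (le_trans hZ)// -mulrA ler_wpM2l ?cabs_ge0// opn_ub.
- exact: opnM.
- by apply: opn_le => // v lv; rewrite mop1 mul1r.
- move=> x; apply/le_anti; rewrite opn_star_sqr andbT (le_trans (opnM _ _))//.
  by rewrite expr2; apply: ler_wpM2r (opn_star x); exact: opn_ge0.
- exact: mstarB.
- exact: mstarZ.
- exact: mstarM.
- exact: mstarK.
Qed.

End OperatorNorm.

(** * Inverse-closedness *)

Section Dot.
Context {R : realType} {d : nat}.
Implicit Types u v w : lattice d -> R[i].

Lemma dot2BZl (c : R[i]) u v w : l2 u -> l2 v -> l2 w ->
  dot2 (fun k => u k - c * v k) w = dot2 u w - c * dot2 v w.
Proof.
move=> lu lv lw; have [lc _] := l2Z c lv.
rewrite /dot2 -csumZ; last exact: dot2_summable.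
rewrite -csumB; first by apply: eq_csum => k; rewrite mulrBl mulrA.
- exact: dot2_summable.
- by apply: csummable_mono (dot2_summable lc lw) => k; rewrite mulrA.
Qed.

Lemma l2BZ (c : R[i]) u v : l2 u -> l2 v -> l2 (fun k => u k - c * v k).
Proof.
move=> lu lv; have [lc _] := l2Z (- c) lv; have [] := l2D lu lc.
by rewrite (_ : (fun k => _ + - c * _) = (fun k => u k - c * v k))//; apply/funext => k; rewrite mulNr.
Qed.

Lemma dot2_basisl v j : l2 v -> dot2 (basis j) v = conjc (v j).
Proof. by move=> lv; have [lb _] := @basis_l2 R d j; rewrite (dot2C lv lb) dot2_basis. Qed.

End Dot.

Section Wiener.
Context {R : realType} {d : nat} {K : algebra_kind} {p : \bar R} {alpha : R}
  {h : (1 <= p)%E /\ d%:R * dual_exp p < alpha}.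
Local Notation C := R[i].
Local Notation E := (malg K h).
Implicit Types (x y z : E) (v w : lattice d -> C).

Lemma opn_mnorm : exists2 c, 0 <= c & forall x, opn x <= c * mnorm x.
Proof.
have k0 := @anorm_const_gt0 R d K p alpha h.
have [c c0 hc] := @opn_anorm R d K p alpha h; exists (c / @anorm_const R d K p alpha h).
  by rewrite divr_ge0// ltW.
by move=> x; rewrite /mnorm mulrA divfK ?gt_eqF.
Qed.

Lemma mnorm_ge0 x : 0 <= mnorm x.
Proof. by rewrite mulr_ge0 ?anorm_ge0// ltW// anorm_const_gt0. Qed.

Lemma mnorm_star x : mnorm (mstar x) <= mnorm x.
Proof. by rewrite ler_pM2l ?anorm_const_gt0// anorm_star. Qed.

(* [<x* x v, v> = |x v|^2] and [|x* x v|^2 <= t |x v|^2] for [t >= |x|^2]. *)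
Lemma gram_contraction x v (c t : R) : 0 <= c -> 0 < t -> opn x ^+ 2 <= t -> l2 v ->
  c * nrm v <= nrm (mop x v) ->
  nrm (mop (1 - (t^-1)%:C%C *: (mstar x * x)) v) ^+ 2 <= (1 - c ^+ 2 / t) * nrm v ^+ 2.
Proof.
move=> c0 t0 xt lv cv; set T := mstar x * x; pose s := t^-1.
have lx := mop_l2 x lv; have lT := mop_l2 T lv.
have Tv : mop T v = mop (mstar x) (mop x v) by rewrite mopM.
have e : mop (1 - s%:C%C *: T) v = (fun k => v k - s%:C%C * mop T v k).
  by rewrite mopB// mop1 mopZ.
have lr := l2BZ s%:C%C lv lT.
have vTv : dot2 v (mop T v) = (nrm (mop x v) ^+ 2)%:C%C.
  by rewrite Tv -mop_adjoint// dot2_nrm.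
have Tvv : dot2 (mop T v) v = (nrm (mop x v) ^+ 2)%:C%C.
  by rewrite dot2C// vTv conjc_real.
have dd : dot2 (mop (1 - s%:C%C *: T) v) (mop (1 - s%:C%C *: T) v) =
    (nrm v ^+ 2 - 2 * s * nrm (mop x v) ^+ 2 + s ^+ 2 * nrm (mop T v) ^+ 2)%:C%C.
  have re a b : a%:C%C - s%:C%C * b%:C%C = (a - s * b)%:C%C :> C by rewrite rmorphB rmorphM.
  rewrite e dot2BZl// (dot2C lr lv) (dot2C lr lT) !dot2BZl// Tvv vTv !dot2_nrm//.
  by rewrite !re !conjc_real re; congr (_%:C)%C; ring.
move: dd; rewrite dot2_nrm ?e// => /(congr1 (@complex.Re R)) /= ->.
have Tb : nrm (mop T v) ^+ 2 <= t * nrm (mop x v) ^+ 2.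
  rewrite (le_trans (y := (opn x * nrm (mop x v)) ^+ 2))//; last first.
    by rewrite exprMn ler_wpM2r ?exprn_ge0 ?nrm_ge0.
  apply: lerXn2r; rewrite ?nnegrE ?nrm_ge0//; first by rewrite mulr_ge0 ?opn_ge0 ?nrm_ge0.
  rewrite Tv; apply: le_trans (opn_ub _ lx) _.
  by apply: ler_wpM2r (opn_star x); exact: nrm_ge0.
have cb : c ^+ 2 * nrm v ^+ 2 <= nrm (mop x v) ^+ 2.
  by rewrite -exprMn ler_sqr ?nnegrE ?mulr_ge0 ?nrm_ge0.
move: (nrm (mop T v) ^+ 2) (nrm (mop x v) ^+ 2) (nrm v ^+ 2) Tb cb => X Y Z Tb cb.
have s0 : 0 < s by rewrite invr_gt0.
have st : t * s = 1 by rewrite mulfV ?gt_eqF.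
have h1 : s ^+ 2 * X <= s * Y.
  rewrite expr2 -mulrA ler_pM2l// -[leRHS]mul1r -st (mulrC t) -mulrA ler_pM2l//.
have h2 : s * (c ^+ 2 * Z) <= s * Y by rewrite ler_pM2l.
rewrite -/s; move: h1 h2; rewrite mulrBl mul1r (mulrC _ s) -(mulrA s); clear; lra.
Qed.

(** Bounded below and onto are what a bounded inverse on l^2 provides, and [H] depends only on [c]
    and [M]. Inverting the Gram matrix in the algebra yields a left inverse of [x]; surjectivity
    makes it two-sided. *)
Lemma wiener (c M : R) : 0 < c -> exists H, forall x, mnorm x <= M ->
  (forall v, l2 v -> c * nrm v <= nrm (mop x v)) ->
  (forall w, l2 w -> exists2 v, l2 v & mop x v = w) ->
  exists y, inv_of x y /\ mnorm y <= H.
Proof.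
move=> c0; have bn := @mnorm_banach R d K p alpha h.
have cs := @opn_cstar R d K p alpha h.
have [k k0 hk] := opn_mnorm.
have [K1 [D [tau [K11 D1 tau0 tau1 hsqr]]]] := @mnorm_sqr R d K p alpha h.
(* [k M] bounds the operator norm; adding [c ^ 2] makes [t] positive and [c ^ 2 / t] at most [1]. *)
pose t := (k * M) ^+ 2 + c ^+ 2; pose q := Num.sqrt (1 - c ^+ 2 / t).
have c20 : 0 < c ^+ 2 by rewrite exprn_gt0.
have t0 : 0 < t by rewrite ltr_wpDl ?sqr_ge0.
have ct0 : 0 < c ^+ 2 / t by rewrite divr_gt0.
have ct1 : 0 <= 1 - c ^+ 2 / t by rewrite subr_ge0 ler_pdivrMr// mul1r lerDr sqr_ge0.
have q0 : 0 <= q by exact: sqrtr_ge0.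
have q1 : q < 1.
  rewrite -ltr_sqr ?nnegrE// sqr_sqrtr// expr1n; move: ct0; clear; lra.
have [H0 hH] := decay_inv bn K11 D1 tau0 tau1 (@opn_ge0 R d K p alpha h)
  (@opnM R d K p alpha h) (fun x n => hsqr x _ (opn_entry x) n) (q := q)
  (mnorm (1 : E) + t^-1 * (M * M)) q0 q1.
exists (t^-1 * (H0 * M)) => x xM low sur.
have M0 : 0 <= M := le_trans (mnorm_ge0 x) xM.
pose r := 1 - (t^-1)%:C%C *: (mstar x * x).
have rq : opn r <= q.
  apply: opn_le => // v lv.
  rewrite -ler_sqr ?nnegrE ?mulr_ge0 ?nrm_ge0// exprMn sqr_sqrtr//.
  apply: gram_contraction; rewrite ?(ltW c0)//; last exact: low.
  rewrite (le_trans (y := (k * M) ^+ 2))//; last by rewrite lerDl ltW.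
  rewrite ler_sqr ?nnegrE ?opn_ge0 ?mulr_ge0// (le_trans (hk x))// ler_wpM2l//.
have ti : cabs (t^-1)%:C%C = t^-1 by rewrite cabs_real ger0_norm// invr_ge0 ltW.
have rM : mnorm r <= mnorm (1 : E) + t^-1 * (M * M).
  rewrite /r (le_trans (bnD bn _ _))// lerD2l bn_opp// (le_trans (bnZ bn _ _))// ti.
  rewrite ler_wpM2l ?invr_ge0 ?(ltW t0)// (le_trans (bnM bn _ _))// ler_pM ?mnorm_ge0//.
  exact: le_trans (mnorm_star x) xM.
have [y [[_ yr] yH]] := hH r rq rM.
have rE : 1 - r = (t^-1)%:C%C *: (mstar x * x) by rewrite /r opprB addrC subrK.
pose V := (t^-1)%:C%C *: (y * mstar x).
have Vx : V * x = 1 by rewrite /V -scalerAl -mulrA scalerAr -rE.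
exists V; split; last first.
  rewrite (le_trans (bnZ bn _ _))// ti ler_wpM2l ?invr_ge0 ?(ltW t0)//.
  rewrite (le_trans (bnM bn _ _))// ler_pM ?mnorm_ge0// (le_trans (mnorm_star x))//.
split=> //; apply: mop_ext => w lw; have [v lv <-] := sur w lw.
by rewrite mop1 -mopM ?mop_l2// -mulrA Vx mulr1.
Qed.

End Wiener.

(** * Spectra and the Sylvester equation *)

Section Spectrum.
Context {R : realType} {d : nat} {K : algebra_kind} {p : \bar R} {alpha : R}
  {h : (1 <= p)%E /\ d%:R * dual_exp p < alpha}.
Local Notation C := R[i].
Local Notation E := (malg K h).
Implicit Types (x y z a b : E) (v w : lattice d -> C).

Lemma mop_bounded_op x : bounded_op (mop x).
Proof.
split; first exact: mop_l2; first by move=> c v w; exact: mop_linear.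
by exists (opn x) => v lv; rewrite (norm2E lv) (norm2E (mop_l2 x lv)) -EFinM lee_fin opn_ub.
Qed.

Lemma mop_shift x (l : C) v : l2 v -> (fun k => l * v k - mop x v k) = mop (l%:A - x) v.
Proof. by move=> lv; rewrite mopB// mopZ// mop1. Qed.

Lemma bounded_op_ext (S T : (lattice d -> C) -> lattice d -> C) :
  (forall v, l2 v -> S v = T v) -> bounded_op S -> bounded_op T.
Proof.
move=> ST [S1 S2 [M S3]]; split.
- by move=> v lv; rewrite -ST//; exact: S1.
- move=> c v w lv lw; have [lc _] := l2Z c lv; have [lD _] := l2D lc lw.
  by rewrite -!ST// S2.
- by exists M => v lv; rewrite -ST//; exact: S3.
Qed.

(** Inverse-closedness: an inverse in B(l^2) bounds [l - x] below and makes it onto, and [wiener]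
    then finds the inverse in the algebra. *)
Lemma sigmaP x (l : C) : ~ sigma (mval x) l <-> exists y, inv_of (x - l%:A) y.
Proof.
split=> [/contrapT|[y [xy yx]]].
  move=> [_ [S [[S1 _ [M S3]] ST]]].
  have M1 : 0 < `|M| + 1 by rewrite ltr_wpDl.
  have low v : l2 v -> (`|M| + 1)^-1 * nrm v <= nrm (mop (l%:A - x) v).
    move=> lv; rewrite ler_pdivrMl//; have lT := mop_l2 (l%:A - x) lv.
    have Sv : S (mop (l%:A - x) v) = v by have [] := ST v lv; rewrite mop_shift.
    have := S3 _ lT; rewrite Sv (norm2E lv) (norm2E lT) -EFinM lee_fin => hS.
    rewrite (le_trans hS)// ler_wpM2r ?nrm_ge0//.
    by rewrite (le_trans (ler_norm M))// lerDl.
  have sur w : l2 w -> exists2 v, l2 v & mop (l%:A - x) v = w.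
    move=> lw; exists (S w); first exact: S1.
    by rewrite -mop_shift; [have [] := ST w lw|exact: S1].
  have ci : 0 < (`|M| + 1)^-1 by rewrite invr_gt0.
  have [H hH] := @wiener R d K p alpha h _ (mnorm (l%:A - x)) ci.
  have [y [[xy yx] _]] := hH _ (lexx _) low sur.
  by exists (- y); rewrite -opprB; split; rewrite mulrNN.
move=> sg; apply: sg; have shift v : l2 v -> mop (l%:A - x) v = (fun k => l * v k - mop x v k).
  by move=> lv; rewrite mop_shift.
split; first exact: bounded_op_ext shift (mop_bounded_op _).
exists (mop (- y)); split; first exact: mop_bounded_op.
move=> v lv; split.
  apply: etrans (congr1 (mop (- y)) (esym (shift v lv))) _.
  by rewrite -mopM// -opprB mulrNN yx mop1.
apply: etrans (esym (shift _ (mop_l2 (- y) lv))) _.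
by rewrite -mopM// -opprB mulrNN xy mop1.
Qed.

(** Inner products with basis vectors identify any adjoint on l^2 with the operator of the conjugate
    transpose. *)
Lemma normal_star x : normal_op (imx_op (mval x)) -> @normal R E mstar x.
Proof.
move=> [_ [S [[S1 adj] com]]].
have Sx v : l2 v -> S v = mop (mstar x) v.
  move=> lv; apply/funext => j; have [lb _] := @basis_l2 R d j.
  have lS := bounded_op_l2 S1 lv; have lx := mop_l2 (mstar x) lv.
  apply: (can_inj (@conjcK R)); rewrite -!dot2_basisl// -mop_adjoint//.
  by rewrite -adj.
apply: mop_ext => v lv; rewrite !mopM//.
have lx := mop_l2 x lv; have lx' := mop_l2 (mstar x) lv.
by rewrite -!Sx//; exact: com.
Qed.

Lemma normal_small_inv x (l : C) (delta : R) : @normal R E mstar x -> 0 < delta ->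
  (forall mu, cabs (mu - l) < delta -> ~ sigma (mval x) mu) ->
  exists y, inv_of (x - l%:A) y /\ opn y <= delta^-1.
Proof.
move=> nx d0 hd; have [k k0 hk] := @opn_mnorm R d K p alpha h.
apply: (normal_resolvent (@opn_cstar R d K p alpha h) (@mnorm_banach R d K p alpha h) k0 hk nx d0).
by move=> mu /hd; case: (sigmaP x mu).
Qed.

(** If the spectrum were empty, discs of every radius would bound the inverse of [x] by every
    [e > 0]. Nonemptiness matters for the distance: the infimum of the empty set is [0] by
    convention. *)
Lemma spectrum_nonempty x : @normal R E mstar x -> exists z : C, sigma (mval x) z.
Proof.
move=> nx; apply: contrapT => no.
have ns (z : C) : ~ sigma (mval x) z by move=> sz; apply: no; exists z.
have [y xy] := (sigmaP x 0).1 (ns 0).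
have y0 e : 0 < e -> opn y <= e.
  move=> e0; have ei : 0 < e^-1 by rewrite invr_gt0.
  have [z [xz ze]] := @normal_small_inv x 0 e^-1 nx ei (fun mu _ => ns mu).
  by rewrite (inv_of_uniq xy xz) (le_trans ze)// invrK.
have {y0}y0 : opn y <= 0.
  by apply/ler_addgt0Pr => e e0; rewrite add0r y0.
have e1 : (x - 0%:A) * y = 1 := xy.1.
suff y00 : y = 0 by move: e1; rewrite y00 mulr0 => /eqP; rewrite eq_sym oner_eq0.
apply: malg_ext => i j; apply/eqP.
by rewrite -[mval 0 i j]/(0 : C) -cabs_eq0 eq_le cabs_ge0 (le_trans (opn_entry _ _ _)).
Qed.

Lemma spectrum_bounded x (z : C) : sigma (mval x) z -> cabs z <= 2 * mnorm x.
Proof.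
move=> sz; rewrite leNgt; apply/negP => lt; have bn := @mnorm_banach R d K p alpha h.
have z0 : 0 < cabs z by rewrite (le_lt_trans _ lt)// mulr_ge0 ?mnorm_ge0.
have [y [xy _]] := inv_large bn (lexx _) (ltW lt) z0.
by move: sz; apply/sigmaP; exists y.
Qed.

Lemma inv_open x (l : C) y : inv_of (x - l%:A) y -> exists e H, 0 < e /\
  forall mu, cabs (mu - l) < e -> exists y', inv_of (x - mu%:A) y' /\ mnorm y' <= H.
Proof.
move=> xy; have bn := @mnorm_banach R d K p alpha h.
exists (2 * (mnorm y + 1))^-1, (mnorm (1 : E) *+ 2 * (mnorm y + 1)).
have y1 : 0 < mnorm y + 1 by rewrite ltr_wpDl ?mnorm_ge0.
split=> [|mu hmu]; first by rewrite invr_gt0 mulr_gt0.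
have [||y' [hy' y'H]] := @inv_perturb _ _ _ bn _ _ (mu - l) (mnorm y + 1) xy.
- by rewrite lerDl.
- by rewrite -ler_pdivlMr// -invfM ltW.
- exists y'; split=> //; move: hy'; rewrite -addrA -opprD scalerBl.
  by rewrite (addrC l%:A) subrK.
Qed.

Variables a b : E.
Hypothesis disj : sigma (mval a) `&` sigma (mval b) = set0.

Lemma resolvent_alternative (l : C) :
  (exists y, inv_of (a - l%:A) y) \/ (exists y, inv_of (b - l%:A) y).
Proof.
have [sa|/sigmaP ?] := pselect (sigma (mval a) l); last by left.
have [sb|/sigmaP ?] := pselect (sigma (mval b) l); last by right.
by have : set0 l by rewrite -disj.
Qed.

Lemma uniform_resolvent (L : R) : exists H, forall l,
  `|complex.Re l| <= L -> `|complex.Im l| <= L ->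
  (exists y, inv_of (a - l%:A) y /\ mnorm y <= H) \/
  (exists y, inv_of (b - l%:A) y /\ mnorm y <= H).
Proof.
apply: (@square_bound R (fun l H => (exists y, inv_of (a - l%:A) y /\ mnorm y <= H) \/
  (exists y, inv_of (b - l%:A) y /\ mnorm y <= H))) => [l H H' HH|l _ _].
  by case=> -[y [iy yH]]; [left|right]; exists y; split=> //; exact: le_trans yH HH.
by have [[y iy]|[y iy]] := resolvent_alternative l;
  have [e [H [e0 he]]] := inv_open iy; exists H, e; split=> // mu /he; [left|right].
Qed.

(** Compactness of a square containing the spectrum of [a] gives one radius such that every disc of
    that radius centered in the square misses one of the two spectra. *)
Lemma spectra_gap : exists2 e, 0 < e &
  forall z w : C, sigma (mval a) z -> sigma (mval b) w -> e <= cabs (z - w).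
Proof.
(* The radius is the inverse of a bound, because [square_bound] produces upper bounds; [Num.max]
   keeps it positive and monotone in [H]. *)
pose free x l (H : R) := forall mu : C, cabs (mu - l) < (Num.max H 1)^-1 -> exists y, inv_of (x - mu%:A) y.
have m0 H : 0 < Num.max H 1 :> R by rewrite lt_max ltr01 orbT.
have free_mono x l H H' : H <= H' -> free x l H -> free x l H'.
  move=> HH fx mu hmu; apply: fx; apply: (lt_le_trans hmu).
  by rewrite lef_pV2 ?posrE// ge_max !le_max HH lexx orbT.
have free_open x l y : inv_of (x - l%:A) y -> exists H e, 0 < e /\
    forall l', cabs (l' - l) < e -> free x l' H.
  move=> iy; have [e [H [e0 he]]] := inv_open iy; exists (2 / e), (e / 2).
  split=> [|l' hl' mu hmu]; first by rewrite divr_gt0.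
  have hmu2 : cabs (mu - l') < e / 2.
    apply: (lt_le_trans hmu); rewrite -[e / 2]invrK lef_pV2 ?posrE// ?invr_gt0 ?divr_gt0//.
    by rewrite invf_div le_max lexx.
  have [|y' [hy' _]] := he mu; last by exists y'.
  rewrite -(subrK l' mu) -addrA (le_lt_trans (cabsD _ _))//.
  by rewrite [ltRHS](splitr e) ltrD.
have [H hH] := @square_bound R (fun l H => free a l H \/ free b l H) (2 * mnorm a + 2 * mnorm b)
  (fun l H H' HH => fun o => match o with or_introl f => or_introl (free_mono a l H H' HH f)
     | or_intror f => or_intror (free_mono b l H H' HH f) end)
  ltac:(by move=> l _ _; have [[y iy]|[y iy]] := resolvent_alternative l;
    have [H [e [e0 he]]] := free_open _ _ _ iy; exists H, e; split=> // mu /he; [left|right]).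
exists (Num.max H 1)^-1 => [|z w sz sw]; first by rewrite invr_gt0.
have zL := spectrum_bounded sz; rewrite leNgt; apply/negP => lt.
have zL' : cabs z <= 2 * mnorm a + 2 * mnorm b.
  by rewrite (le_trans zL)// lerDl mulr_ge0 ?mnorm_ge0.
have [fa|fb] := hH z (le_trans (cabs_ge_Re _) zL') (le_trans (cabs_ge_Im _) zL').
  by move: sz; apply/sigmaP; apply: fa; rewrite subrr cabs0 invr_gt0.
by move: sw; apply/sigmaP; apply: fb; rewrite -cabsN opprB.
Qed.

End Spectrum.

Section SylvesterEquation.
Context {R : realType} {d : nat} {K : algebra_kind} {p : \bar R} {alpha : R}
  {h : (1 <= p)%E /\ d%:R * dual_exp p < alpha}.
Local Notation C := R[i].
Local Notation E := (malg K h).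
Implicit Types (x y z a b q : E).

Lemma malg_of_alg (A : imatrix R d) : alg K p alpha A -> exists x, mval x = A.
Proof.
by move=> /(algP K h.1) hA; exists (MAlg h (ex_intro _ _ hA)).
Qed.

Lemma alg_mval x : alg K p alpha (mval x).
Proof. by have [] := alg_of_mat_le h.1 (anorm_mat x). Qed.

Lemma sylvesterP a b q x :
  sylvester (mval a) (mval b) (mval q) (mval x) <-> b * x - x * a = q.
Proof. by split=> [e|<-]; [exact: mval_inj|]. Qed.

Lemma sylvesterB a b x y :
  b * (x - y) - (x - y) * a = (b * x - x * a) - (b * y - y * a).
Proof. by rewrite mulrBr mulrBl !opprD !opprK addrACA. Qed.

Lemma spectra_dist_le a b (z w : C) : sigma (mval a) z -> sigma (mval b) w ->
  spectra_dist (mval a) (mval b) <= cabs (z - w).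
Proof.
move=> sz sw; apply: ge_inf; first by exists 0 => _ [? _ [? _ <-]]; exact: cabs_ge0.
by exists z => //; exists w.
Qed.

Lemma spectra_dist_gt0 a b : sigma (mval a) `&` sigma (mval b) = set0 ->
  @normal R E mstar a -> @normal R E mstar b -> 0 < spectra_dist (mval a) (mval b).
Proof.
move=> disj na nb; have [e e0 he] := spectra_gap disj.
rewrite (lt_le_trans e0)//; apply: lb_le_inf => [|_ [z sz [w sw <-]]]; last exact: he.
have [[z sz] [w sw]] := (spectrum_nonempty na, spectrum_nonempty nb).
by exists (cabs (z - w)), z => //; exists w.
Qed.

Lemma sylvester_unique_solution a b : sigma (mval a) `&` sigma (mval b) = set0 ->
  (forall q, exists x, b * x - x * a = q) /\ (forall x, b * x - x * a = 0 -> x = 0).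
Proof.
move=> disj; have bn := @mnorm_banach R d K p alpha h.
have [L hL] := sylvester_bound bn (Num.max (mnorm a) (mnorm b)).
have [H hH] := uniform_resolvent disj L; have [G hG] := hL H.
have [||sol uniq] := hG a b _ _ hH; rewrite ?le_max ?lexx ?orbT//.
by split=> // q; have [x [? _]] := sol q; exists x.
Qed.

(* A disc of radius at most half the distance of the spectra misses one of them. *)
Lemma resolvent_gap a b (l : C) (e : R) : @normal R E mstar a -> @normal R E mstar b ->
  0 < e -> e *+ 2 <= spectra_dist (mval a) (mval b) ->
  (exists y, inv_of (a - l%:A) y /\ opn y <= e^-1) \/
  (exists y, inv_of (b - l%:A) y /\ opn y <= e^-1).
Proof.
move=> na nb e0 he.
have [[z [zl sz]]|noz] := pselect (exists z : C, cabs (z - l) < e /\ sigma (mval a) z); last first.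
  by left; apply: normal_small_inv => // mu hmu smu; apply: noz; exists mu.
right; apply: normal_small_inv => // w wl sw.
have := le_trans he (spectra_dist_le sz sw).
rewrite -(subrK l z) -addrA leNgt (le_lt_trans (cabsD _ _))//.
by rewrite mulr2n ltrD// -cabsN opprB.
Qed.

(** An inverse of operator norm at most [1 / e] bounds [x] below by [e], so [wiener] provides the
    same inverse with its norm bound. *)
Lemma inv_mnorm_bound (e M : R) : 0 < e -> exists H, forall x y, mnorm x <= M ->
  inv_of x y -> opn y <= e^-1 -> mnorm y <= H.
Proof.
move=> e0; have [H hH] := @wiener R d K p alpha h e M e0; exists H => x y xM xy ye.
have [||z [xz zH]] := hH x xM; last by rewrite (inv_of_uniq xy xz).
- move=> v lv; rewrite -ler_pdivlMl//; apply: le_trans (_ : opn y * nrm (mop x v) <= _).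
    by rewrite -{1}(mop1 (h := h) (K := K) v) -xy.2 mopM// opn_ub//; exact: mop_l2.
  by rewrite ler_wpM2r ?nrm_ge0.
- by move=> w lw; exists (mop y w); [exact: mop_l2|rewrite -mopM// xy.1 mop1].
Qed.

Lemma normal_sylvester_bound (s t : R) : 0 < s -> exists G, forall a b q x,
  @normal R E mstar a -> @normal R E mstar b -> (spectra_dist (mval a) (mval b))^-1 = s ->
  anorm a + anorm b <= t -> b * x - x * a = q -> anorm x <= G * anorm q.
Proof.
move=> s0; have bn := @mnorm_banach R d K p alpha h.
set c := @anorm_const R d K p alpha h.
have c0 : 0 < c by exact: anorm_const_gt0.
have [L hL] := sylvester_bound bn (c * t).
(* Half the distance of the spectra. *)
pose e := s^-1 / 2; have e0 : 0 < e by rewrite divr_gt0 ?invr_gt0.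
(* On the square [|l| <= 2 L], which bounds the norms of [a - l] and [b - l] together. *)
have [H hH] := inv_mnorm_bound (c * t + L *+ 2 * mnorm (1 : E)) e0.
have [G hG] := hL H; exists G => a b q x na nb sE tE eq.
have [aM bM] : mnorm a <= c * t /\ mnorm b <= c * t.
  by rewrite !ler_pM2l//; split; apply: le_trans tE; rewrite ?lerDl ?lerDr anorm_ge0.
have shift y l : mnorm y <= c * t -> `|complex.Re l| <= L -> `|complex.Im l| <= L ->
    mnorm (y - l%:A) <= c * t + L *+ 2 * mnorm (1 : E).
  move=> yM lr li; rewrite (le_trans (bnD bn _ _))// lerD// bn_opp//.
  rewrite (le_trans (bnZ bn _ _))// ler_wpM2r ?mnorm_ge0//.
  by rewrite (le_trans (cabs_ReIm _))// mulr2n lerD.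
have [l lr li|sol uniq] := hG a b aM bM.
  have se : e *+ 2 <= spectra_dist (mval a) (mval b).
    by rewrite /e -[leRHS]invrK sE -mulr_natr divfK.
  have [[y [iy yP]]|[y [iy yP]]] := resolvent_gap l na nb e0 se.
  - by left; exists y; split=> //; apply: hH iy yP; exact: shift.
  - by right; exists y; split=> //; apply: hH iy yP; exact: shift.
have [x' [x'E x'G]] := sol q.
have -> : x = x'.
  by apply/eqP; rewrite -subr_eq0; apply/eqP/uniq; rewrite sylvesterB x'E eq subrr.
by move: x'G; rewrite /mnorm mulrCA ler_pM2l.
Qed.

End SylvesterEquation.

Theorem theorem3p1 (R : realType) (d : nat) (hd : (1 <= d)%N)
    (p : \bar R) (hp : (1 <= p)%E)
    (alpha : R) (halpha : (d%:R%:E - d%:R%:E / p < alpha%:E)%E)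
    (K : algebra_kind) :
  (forall A B : imatrix R d,
     alg K p alpha A -> alg K p alpha B ->
     sigma A `&` sigma B = set0 ->
     forall Q : imatrix R d, alg K p alpha Q ->
     exists! X : imatrix R d, alg K p alpha X /\ sylvester A B Q X)
  /\
  (exists g : R -> R -> R,
     forall A B : imatrix R d,
       alg K p alpha A -> alg K p alpha B ->
       sigma A `&` sigma B = set0 ->
       normal_op (imx_op A) -> normal_op (imx_op B) ->
       forall Q X : imatrix R d,
         alg K p alpha Q -> alg K p alpha X -> sylvester A B Q X ->
         fine (alg_norm K p alpha X) <=
           g (spectra_dist A B)^-1
             (fine (alg_norm K p alpha A) + fine (alg_norm K p alpha B)) *
           fine (alg_norm K p alpha Q)).
Proof.
pose h := conj hp (dual_exp_lt hp halpha); split.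
  move=> A B /(malg_of_alg (h := h))[a <-] /(malg_of_alg (h := h))[b <-] disj
    Q /(malg_of_alg (h := h))[q <-].
  have [sol uniq] := sylvester_unique_solution disj; have [x xE] := sol q.
  exists (mval x); split; first by split; [exact: alg_mval|exact/sylvesterP].
  move=> X [/(malg_of_alg (h := h))[y <-] /sylvesterP yE]; congr mval.
  apply/eqP; rewrite -subr_eq0; apply/eqP/uniq.
  by rewrite sylvesterB xE yE subrr.
have /choice[g hg] (st : R * R) : exists G, forall a b q x : malg K h, 0 < st.1 ->
    @normal R (malg K h) mstar a -> @normal R (malg K h) mstar b ->
    (spectra_dist (mval a) (mval b))^-1 = st.1 -> anorm a + anorm b = st.2 ->
    b * x - x * a = q -> anorm x <= G * anorm q.
  (* [g] is chosen separately for each pair of arguments. A nonpositive first argument is never the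
     inverse of the distance of the spectra, so [0] serves there. *)
  have [s0|s0] := ltP 0 st.1; last by exists 0.
  have [G hG] := @normal_sylvester_bound R d K p alpha h st.1 st.2 s0; exists G => a b q x _ na nb sE tE.
  by apply: hG; rewrite ?tE.
exists (fun s t => g (s, t)) => A B /(malg_of_alg (h := h))[a <-] /(malg_of_alg (h := h))[b <-] disj.
move=> /normal_star na /normal_star nb Q X /(malg_of_alg (h := h))[q <-].
move=> /(malg_of_alg (h := h))[x <-] /sylvesterP xE.
by apply: (hg (_, _) a b q x) => //=; rewrite invr_gt0 spectra_dist_gt0.
Qed.
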